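(* Let $R$ be a domain of characteristic $0$, let $F$ be a one-dimensional commutative formal group law over $R$, let $A$ be a generalized Cartan matrix and let $\Lambda$ be a Demazure lattice for its root datum. Let $S=R[[\Lambda]]_F$ be the formal group algebra, $Q_W$ the twisted group algebra acting on $Q$, and $\mathbf{D}_F\subset Q_W$ the formal affine Demazure algebra. Then $$\mathbf{D}_F=\{z\in Q_W\mid z\cdot S\subseteq S\}.$$
   Context: Root datum: $A=(a_{ij})_{1\le i,j\le n}$ is an integer matrix with $a_{ii}=2$, $-a_{ij}\in\mathbb{Z}_{\ge 0}$ for $i\ne j$, and $a_{ij}=0\Leftrightarrow a_{ji}=0$. Let $\mathfrak{h}$ be a complex vector space of dimension $2n-\mathrm{rank}\,A$ with linearly independent subsets $\{\alpha_1,\dots,\alpha_n\}\subset\mathfrak{h}^*$ (simple roots) and $\{\alpha_1^\vee,\dots,\alpha_n^\vee\}\subset\mathfrak{h}$ (simple coroots) with $a_{ij}=\langle\alpha_j,\alpha_i^\vee\rangle$. The Weyl group $W$ is generated by $s_i(\lambda)=\lambda-\langle\lambda,\alpha_i^\vee\rangle\alpha_i$ on $\mathfrak{h}^*$. The set of (real) roots is $\Phi=\{w(\alpha_i)\}$; $\Phi_+=\Phi\cap\sum_i\mathbb{Z}_{\ge0}\alpha_i$, $\Phi_-=-\Phi_+$, $\Phi=\Phi_+\amalg\Phi_-$. For $\alpha=w(\alpha_i)$, $s_\alpha=ws_iw^{-1}$. Demazure lattice: a finitely generated free abelian subgroup $\Lambda$ of $\mathfrak{h}^*$ containing the simple roots,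 with $\langle\Lambda,\alpha_i^\vee\rangle\subset\mathbb{Z}$ for all $i$, such that every simple root can be extended to a $\mathbb{Z}$-basis of $\Lambda$. It is $W$-invariant. Formal group algebra: $S=R[[\Lambda]]_F=R[[x_\lambda\mid\lambda\in\Lambda]]/J$, where $R[[x_\lambda\mid\lambda\in\Lambda]]$ is the completion of the polynomial ring at the kernel of $x_\lambda\mapsto0$, and $J$ is the closure of the ideal generated by $x_0$ and $x_{\lambda+\mu}-F(x_\lambda,x_\mu)$, $\lambda,\mu\in\Lambda$. $W$ acts on $S$ by $w(x_\lambda)=x_{w(\lambda)}$. Twisted group algebra: $Q=S[\frac1{x_\alpha}\mid\alpha\in\Phi_+]$; $Q_W$ is the left $Q$-module with basis $\{\delta_w\}_{w\in W}$ and product $q\delta_w\cdot q'\delta_{w'}=qw(q')\delta_{ww'}$; $\delta_e=1$, $\delta_\alpha=\delta_{s_\alpha}$. It acts on $Q$ by $(q\delta_w)\cdot q'=q\,w(q')$. Formal Demazure elements: $X_\alpha=\frac1{x_\alpha}(1-\delta_\alpha)\in Q_W$ for $\alpha\in\Phi$. The formal affine Demazure algebra $\mathbf{D}_F$ is the $R$-subalgebra of $Q_W$ generated by the elements of $S$ and all $X_\alpha$, $\alpha\in\Phi$. *)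

(* Defs.v *)
From HB Require Import structures.
From mathcomp Require Import all_boot all_order all_algebra.
From mathcomp Require Import finmap generic_quotient complex monalg ring.
From mathcomp Require Import boolp classical_sets reals.

Set Implicit Arguments.
Unset Strict Implicit.
Unset Printing Implicit Defensive.

Import GRing.Theory Num.Theory.

Local Open Scope ring_scope.
Local Open Scope quotient_scope.
Local Open Scope classical_set_scope.

Section Ideals.
Context (P : comPzRingType).

Record ideal := Ideal {
  ideal_set :> P -> Prop;
  ideal0 : ideal_set 0;
  idealD : forall x y, ideal_set x -> ideal_set y -> ideal_set (x + y);
  idealM : forall x y, ideal_set y -> ideal_set (x * y) }.

Lemma idealN (I : ideal) x : I x -> I (- x).
Proof. by rewrite -mulN1r; apply: idealM. Qed.

Lemma idealB (I : ideal) x y : I x -> I y -> I (x - y).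
Proof. by move=> Ix Iy; apply: idealD => //; apply: idealN. Qed.

Section Gen.
Variable X : set P.
Definition ideal_gen_set : set P :=
  [set f | forall I : ideal, X `<=` I -> I f].

Fact ideal_gen0 : ideal_gen_set 0.
Proof. by move=> I _; apply: ideal0. Qed.
Fact ideal_genD x y :
  ideal_gen_set x -> ideal_gen_set y -> ideal_gen_set (x + y).
Proof. by move=> hx hy I XI; apply: idealD; [apply: hx|apply: hy]. Qed.
Fact ideal_genM x y : ideal_gen_set y -> ideal_gen_set (x * y).
Proof. by move=> hy I XI; apply: idealM; apply: hy. Qed.

Definition ideal_gen := Ideal ideal_gen0 ideal_genD ideal_genM.

Lemma sub_ideal_gen : X `<=` ideal_gen.
Proof. by move=> x Xx I; apply. Qed.
End Gen.

Definition idealT : ideal :=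
  @Ideal setT Logic.I (fun _ _ _ _ => Logic.I) (fun _ _ _ => Logic.I).

Definition ideal_mul (I J : ideal) : ideal :=
  ideal_gen [set f | exists x y, [/\ I x, J y & f = x * y]].

Definition ideal_pow (I : ideal) (k : nat) : ideal :=
  iter k (ideal_mul I) idealT.

Lemma ideal_powS (I : ideal) k x y :
  I x -> ideal_pow I k y -> ideal_pow I k.+1 (x * y).
Proof. by move=> Ix Iy; apply: sub_ideal_gen; exists x, y. Qed.

Lemma ideal_pow_exp (I : ideal) k m x y : (k <= m)%N ->
  I x -> ideal_pow I k (x ^+ m * y).
Proof.
elim: k m => [//|k IH] [//|m] km Ix.
by rewrite exprS -mulrA; apply: ideal_powS => //; apply: IH.
Qed.

Lemma ideal_pow_le (I : ideal) k m : (k <= m)%N -> ideal_pow I m `<=` ideal_pow I k.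
Proof.
elim: k m => [//|k IH] [//|m] km f If; apply: If => _ [x [y [Ix Iy ->]]].
by apply: ideal_powS => //; apply: IH Iy.
Qed.

Lemma ideal_pow_sub (I : ideal) k : ideal_pow I k.+1 `<=` I.
Proof.
by move=> f; apply => _ [x [y [Ix _ ->]]]; rewrite mulrC; apply: idealM.
Qed.

Section Quotient.
Variable I : ideal.

Definition quot_rel (x y : P) : bool := `[< I (x - y) >].

Fact quot_relxx : reflexive quot_rel.
Proof. by move=> x; apply/asboolP; rewrite subrr; apply: ideal0. Qed.
Fact quot_rel_sym : symmetric quot_rel.
Proof.
by move=> x y; apply/asboolP/asboolP => /idealN; rewrite opprB.
Qed.
Fact quot_rel_trans : transitive quot_rel.
Proof.
move=> y x z /asboolP xy /asboolP yz; apply/asboolP.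
by rewrite -(subrKA y); apply: idealD.
Qed.

Canonical quot_equiv := EquivRel quot_rel quot_relxx quot_rel_sym quot_rel_trans.

Definition quot := {eq_quot quot_equiv}.
HB.instance Definition _ : EqQuotient P quot_rel quot := EqQuotient.on quot.
HB.instance Definition _ := Choice.on quot.

Lemma quotP (x y : P) : \pi_quot x = \pi_quot y <-> I (x - y).
Proof. by split=> [/eqmodP/asboolP|h]; [|apply/eqmodP/asboolP]. Qed.

Lemma quot_ind (T : quot -> Prop) :
  (forall x, T (\pi_quot x)) -> forall q, T q.
Proof. by move=> h q; rewrite -[q]reprK. Qed.

Definition quot_add (x y : quot) : quot := \pi_quot (repr x + repr y).
Definition quot_opp (x : quot) : quot := \pi_quot (- repr x).
Definition quot_mul (x y : quot) : quot := \pi_quot (repr x * repr y).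

Lemma quot_repr (x : P) : I (repr (\pi_quot x) - x).
Proof. by apply/quotP; rewrite reprK. Qed.

Lemma quot_piD x y : \pi_quot (x + y) = quot_add (\pi_quot x) (\pi_quot y).
Proof.
apply/esym/quotP; rewrite opprD addrACA.
by apply: idealD; apply: quot_repr.
Qed.
Lemma quot_piN x : \pi_quot (- x) = quot_opp (\pi_quot x).
Proof. by apply/esym/quotP; rewrite -opprD; apply/idealN/quot_repr. Qed.
Lemma quot_piM x y : \pi_quot (x * y) = quot_mul (\pi_quot x) (\pi_quot y).
Proof.
apply/esym/quotP; set x' := repr _; set y' := repr _.
have -> : x' * y' - x * y = y' * (x' - x) + x * (y' - y).
  by rewrite !mulrBr addrA mulrC [y' * x]mulrC subrK.
by apply: idealD; apply/idealM/quot_repr.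
Qed.

Fact quot_addA : associative quot_add.
Proof.
by elim/quot_ind=> x; elim/quot_ind=> y; elim/quot_ind=> z; rewrite -!quot_piD addrA.
Qed.
Fact quot_addC : commutative quot_add.
Proof. by elim/quot_ind=> x; elim/quot_ind=> y; rewrite -!quot_piD addrC. Qed.
Fact quot_add0 : left_id (\pi_quot 0) quot_add.
Proof. by elim/quot_ind=> x; rewrite -!quot_piD add0r. Qed.
Fact quot_addN : left_inverse (\pi_quot 0) quot_opp quot_add.
Proof. by elim/quot_ind=> x; rewrite -quot_piN -!quot_piD addNr. Qed.

HB.instance Definition _ :=
  GRing.isZmodule.Build quot quot_addA quot_addC quot_add0 quot_addN.

Fact quot_mulA : associative quot_mul.
Proof.
by elim/quot_ind=> x; elim/quot_ind=> y; elim/quot_ind=> z; rewrite -!quot_piM mulrA.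
Qed.
Fact quot_mulC : commutative quot_mul.
Proof. by elim/quot_ind=> x; elim/quot_ind=> y; rewrite -!quot_piM mulrC. Qed.
Fact quot_mul1 : left_id (\pi_quot 1) quot_mul.
Proof. by elim/quot_ind=> x; rewrite -!quot_piM mul1r. Qed.
Fact quot_mulDl : left_distributive quot_mul +%R.
Proof.
elim/quot_ind=> x; elim/quot_ind=> y; elim/quot_ind=> z.
by rewrite -![_ + _]quot_piD -!quot_piM mulrDl quot_piD.
Qed.

HB.instance Definition _ := GRing.Zmodule_isComPzRing.Build quot
  quot_mulA quot_mulC quot_mul1 quot_mulDl.

Definition quot_pi (x : P) : quot := \pi_quot x.

Fact quot_pi_is_zmod_morphism : zmod_morphism quot_pi.
Proof. by move=> x y; rewrite /quot_pi quot_piD quot_piN. Qed.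
Fact quot_pi_is_monoid_morphism : monoid_morphism quot_pi.
Proof. by split=> // x y; rewrite /quot_pi quot_piM. Qed.

HB.instance Definition _ := GRing.isZmodMorphism.Build P quot quot_pi
  quot_pi_is_zmod_morphism.
HB.instance Definition _ := GRing.isMonoidMorphism.Build P quot quot_pi
  quot_pi_is_monoid_morphism.

Lemma quot_piP (x y : P) : quot_pi x = quot_pi y <-> I (x - y).
Proof. exact: quotP. Qed.

Lemma quot_pi0 (x : P) : quot_pi x = 0 <-> I x.
Proof. by rewrite -(rmorph0 quot_pi) quot_piP subr0. Qed.

Lemma quot_pi_surj (q : quot) : exists x, q = quot_pi x.
Proof. by exists (repr q); rewrite /quot_pi reprK. Qed.

End Quotient.

End Ideals.

Arguments quot_pi {P} I x.

Section Ker.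
Context (P T : comPzRingType) (f : {rmorphism P -> T}).
Fact ker0 : f 0 = 0. Proof. exact: rmorph0. Qed.
Fact kerD x y : f x = 0 -> f y = 0 -> f (x + y) = 0.
Proof. by rewrite rmorphD => -> ->; rewrite addr0. Qed.
Fact kerM x y : f y = 0 -> f (x * y) = 0.
Proof. by rewrite rmorphM => ->; rewrite mulr0. Qed.
Definition ideal_ker : ideal P := @Ideal P [set x | f x = 0] ker0 kerD kerM.
End Ker.

Section QuotientMap.
Context (P T : comPzRingType) (I : ideal P) (J : ideal T).
Context (f : {rmorphism P -> T}).

Definition quot_map (_ : forall x, I x -> J (f x)) (q : quot I) : quot J :=
  quot_pi J (f (repr q)).

Variable fIJ : forall x, I x -> J (f x).

Lemma quot_mapE x : quot_map fIJ (quot_pi I x) = quot_pi J (f x).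
Proof. by apply/quot_piP; rewrite -rmorphB; apply/fIJ/quot_repr. Qed.

Fact quot_map_is_zmod_morphism : zmod_morphism (quot_map fIJ).
Proof.
move=> a b; have [x ->] := quot_pi_surj a; have [y ->] := quot_pi_surj b.
by rewrite -rmorphB !quot_mapE !rmorphB.
Qed.
Fact quot_map_is_monoid_morphism : monoid_morphism (quot_map fIJ).
Proof.
split=> [|a b]; first by rewrite -(rmorph1 (quot_pi I)) quot_mapE !rmorph1.
have [x ->] := quot_pi_surj a; have [y ->] := quot_pi_surj b.
by rewrite -rmorphM !quot_mapE !rmorphM.
Qed.
HB.instance Definition _ := GRing.isZmodMorphism.Build _ _ (quot_map fIJ)
  quot_map_is_zmod_morphism.
HB.instance Definition _ := GRing.isMonoidMorphism.Build _ _ (quot_map fIJ)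
  quot_map_is_monoid_morphism.
End QuotientMap.

Arguments quot_map {P T I J f} _ q.

Section Completion.
Context (P : comPzRingType) (I : ideal P).

(* Compatible families in [\lim_k P / I^k] are represented by sequences in [P];
   [completion] below identifies the sequences with the same classes. *)
Record adic_seq := AdicSeq {
  aseq :> nat -> P;
  aseqP : forall k, ideal_pow I k (aseq k.+1 - aseq k) }.

HB.instance Definition _ := gen_eqMixin adic_seq.
HB.instance Definition _ := gen_choiceMixin adic_seq.

Lemma adic_seq_eq (u v : adic_seq) : u =1 v -> u = v.
Proof.
case: u v => [u up] [v vp] /= /funext uv; subst v.
by congr AdicSeq; apply: Prop_irrelevance.
Qed.

Fact aconst_subproof (c : P) k : ideal_pow I k (c - c).
Proof. by rewrite subrr; apply: ideal0. Qed.
Definition aconst c := @AdicSeq (fun=> c) (aconst_subproof c).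

Fact aadd_subproof (u v : adic_seq) k :
  ideal_pow I k ((u k.+1 + v k.+1) - (u k + v k)).
Proof. by rewrite opprD addrACA; apply: idealD; apply: aseqP. Qed.
Definition aadd (u v : adic_seq) := @AdicSeq (fun k => u k + v k) (aadd_subproof u v).

Fact aopp_subproof (u : adic_seq) k : ideal_pow I k ((- u k.+1) - (- u k)).
Proof. by rewrite -opprD; apply/idealN/aseqP. Qed.
Definition aopp (u : adic_seq) := @AdicSeq (fun k => - u k) (aopp_subproof u).

Fact amul_subproof (u v : adic_seq) k :
  ideal_pow I k ((u k.+1 * v k.+1) - (u k * v k)).
Proof.
have E (w : adic_seq) :
    quot_pi (ideal_pow I k) (w k.+1) = quot_pi (ideal_pow I k) (w k).
  exact/quot_piP/aseqP.
by apply/quot_piP; rewrite !rmorphM /= !E.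
Qed.
Definition amul (u v : adic_seq) := @AdicSeq (fun k => u k * v k) (amul_subproof u v).

Fact aaddA : associative aadd.
Proof. by move=> u v w; apply: adic_seq_eq => k /=; rewrite addrA. Qed.
Fact aaddC : commutative aadd.
Proof. by move=> u v; apply: adic_seq_eq => k /=; rewrite addrC. Qed.
Fact aadd0 : left_id (aconst 0) aadd.
Proof. by move=> u; apply: adic_seq_eq => k /=; rewrite add0r. Qed.
Fact aaddN : left_inverse (aconst 0) aopp aadd.
Proof. by move=> u; apply: adic_seq_eq => k /=; rewrite addNr. Qed.
HB.instance Definition _ :=
  GRing.isZmodule.Build adic_seq aaddA aaddC aadd0 aaddN.

Fact amulA : associative amul.
Proof. by move=> u v w; apply: adic_seq_eq => k /=; rewrite mulrA. Qed.
Fact amulC : commutative amul.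
Proof. by move=> u v; apply: adic_seq_eq => k /=; rewrite mulrC. Qed.
Fact amul1 : left_id (aconst 1) amul.
Proof. by move=> u; apply: adic_seq_eq => k /=; rewrite mul1r. Qed.
Fact amulDl : left_distributive amul +%R.
Proof. by move=> u v w; apply: adic_seq_eq => k /=; rewrite mulrDl. Qed.
HB.instance Definition _ :=
  GRing.Zmodule_isComPzRing.Build adic_seq amulA amulC amul1 amulDl.

Definition aproj k (u : adic_seq) : quot (ideal_pow I k) := quot_pi _ (u k).
Fact aproj_is_zmod_morphism k : zmod_morphism (aproj k).
Proof. by move=> u v; rewrite /aproj /= rmorphB. Qed.
Fact aproj_is_monoid_morphism k : monoid_morphism (aproj k).
Proof. by split=> [|u v]; rewrite /aproj /= (rmorph1, rmorphM). Qed.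
HB.instance Definition _ k := GRing.isZmodMorphism.Build adic_seq _ (aproj k)
  (aproj_is_zmod_morphism k).
HB.instance Definition _ k := GRing.isMonoidMorphism.Build adic_seq _ (aproj k)
  (aproj_is_monoid_morphism k).

Lemma aproj_le (u : adic_seq) k m : (k <= m)%N ->
  quot_pi (ideal_pow I k) (u m) = aproj k u.
Proof.
elim: m => [|m IH]; first by rewrite leqn0 => /eqP ->.
rewrite leq_eqVlt => /predU1P [->//|km]; rewrite -IH //.
by apply/quot_piP; exact: (@ideal_pow_le P I k m km _ (aseqP u m)).
Qed.

Fact anull0 k : aproj k 0 = 0. Proof. exact: rmorph0. Qed.
Definition adic_null_set : set adic_seq := [set u | forall k, aproj k u = 0].
Fact adic_nullD u v :
  adic_null_set u -> adic_null_set v -> adic_null_set (u + v).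
Proof. by move=> hu hv k; rewrite rmorphD /= hu hv addr0. Qed.
Fact adic_nullM u v : adic_null_set v -> adic_null_set (u * v).
Proof. by move=> hv k; rewrite rmorphM /= hv mulr0. Qed.
Definition adic_null := @Ideal _ adic_null_set anull0 adic_nullD adic_nullM.

Definition completion := quot adic_null.
HB.instance Definition _ := GRing.ComPzRing.copy completion (quot adic_null).

Definition cmpl_pi : adic_seq -> completion := quot_pi adic_null.
HB.instance Definition _ := GRing.RMorphism.copy cmpl_pi (quot_pi adic_null).

Definition cmpl_proj k (f : completion) : quot (ideal_pow I k) :=
  aproj k (repr f).

Lemma cmpl_projE k u : cmpl_proj k (cmpl_pi u) = aproj k u.
Proof.
apply/eqP; rewrite -subr_eq0 -rmorphB; apply/eqP.
exact: (quot_repr adic_null u).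
Qed.

Lemma cmpl_pi_surj f : exists u, f = cmpl_pi u.
Proof. exact: quot_pi_surj. Qed.

Fact cmpl_proj_is_zmod_morphism k : zmod_morphism (cmpl_proj k).
Proof.
move=> f g; have [u ->] := cmpl_pi_surj f; have [v ->] := cmpl_pi_surj g.
by rewrite -[in LHS]rmorphB !cmpl_projE rmorphB.
Qed.
Fact cmpl_proj_is_monoid_morphism k : monoid_morphism (cmpl_proj k).
Proof.
split=> [|f g]; first by rewrite -(rmorph1 cmpl_pi) cmpl_projE rmorph1.
have [u ->] := cmpl_pi_surj f; have [v ->] := cmpl_pi_surj g.
by rewrite -rmorphM !cmpl_projE rmorphM.
Qed.
HB.instance Definition _ k := GRing.isZmodMorphism.Build completion _
  (cmpl_proj k) (cmpl_proj_is_zmod_morphism k).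
HB.instance Definition _ k := GRing.isMonoidMorphism.Build completion _
  (cmpl_proj k) (cmpl_proj_is_monoid_morphism k).

Lemma cmpl_proj_inj f g : (forall k, cmpl_proj k f = cmpl_proj k g) -> f = g.
Proof.
have [u ->] := cmpl_pi_surj f; have [v ->] := cmpl_pi_surj g => h.
by apply/quot_piP => k; rewrite rmorphB /= -!cmpl_projE h subrr.
Qed.

Lemma cmpl_proj_eq0 k m f : (k <= m)%N -> cmpl_proj m f = 0 -> cmpl_proj k f = 0.
Proof.
have [u ->] := cmpl_pi_surj f; rewrite !cmpl_projE => km /quot_pi0 um.
by rewrite -(aproj_le _ km); apply/quot_pi0; apply: ideal_pow_le um.
Qed.

Definition cmpl_of (x : P) : completion := cmpl_pi (aconst x).
Fact cmpl_of_is_zmod_morphism : zmod_morphism cmpl_of.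
Proof.
by move=> x y; rewrite -[RHS]rmorphB; congr cmpl_pi; apply: adic_seq_eq.
Qed.
Fact cmpl_of_is_monoid_morphism : monoid_morphism cmpl_of.
Proof.
split=> [|x y]; first exact: rmorph1.
by rewrite -[RHS]rmorphM; congr cmpl_pi; apply: adic_seq_eq.
Qed.
HB.instance Definition _ := GRing.isZmodMorphism.Build P completion cmpl_of
  cmpl_of_is_zmod_morphism.
HB.instance Definition _ := GRing.isMonoidMorphism.Build P completion cmpl_of
  cmpl_of_is_monoid_morphism.

Lemma cmpl_proj_of k x : cmpl_proj k (cmpl_of x) = quot_pi _ x.
Proof. exact: cmpl_projE. Qed.

(* Topology of the inverse limit, each [P / I^k] being discrete: the kernels
   of the [cmpl_proj k] form a basis of neighbourhoods of 0.  (They need not be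
   the powers of an ideal of the completion when [I] is not finitely
   generated.) *)
Definition cmpl_cvg (u : nat -> completion) (l : completion) : Prop :=
  forall k, exists N, forall m, (N <= m)%N -> cmpl_proj k (u m) = cmpl_proj k l.

Definition cmpl_lim (u : nat -> completion) : completion :=
  xget 0 [set l | cmpl_cvg u l].

Lemma cmpl_cvg_lim u l : cmpl_cvg u l -> cmpl_lim u = l.
Proof.
move=> ul; rewrite /cmpl_lim; case: xgetP => [l' _ ul'|/(_ l)]; last by [].
apply: cmpl_proj_inj => k.
have [N hN] := ul k; have [N' hN'] := ul' k.
by rewrite -(hN (maxn N N')) ?leq_maxl// hN' ?leq_maxr.
Qed.

Definition cmpl_closure (X : set completion) : set completion :=
  [set f | forall k, exists2 g, X g & cmpl_proj k f = cmpl_proj k g].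

Section IdealClosure.
Variable J : ideal completion.
Fact ideal_closure0 : cmpl_closure J 0.
Proof. by move=> k; exists 0 => //; apply: ideal0. Qed.
Fact ideal_closureD f g :
  cmpl_closure J f -> cmpl_closure J g -> cmpl_closure J (f + g).
Proof.
move=> hf hg k; have [f' Jf fE] := hf k; have [g' Jg gE] := hg k.
by exists (f' + g'); [exact: idealD | rewrite !rmorphD /= fE gE].
Qed.
Fact ideal_closureM f g : cmpl_closure J g -> cmpl_closure J (f * g).
Proof.
move=> hg k; have [g' Jg gE] := hg k.
by exists (f * g'); [exact: idealM | rewrite !rmorphM /= gE].
Qed.
Definition ideal_closure :=
  @Ideal _ (cmpl_closure J) ideal_closure0 ideal_closureD ideal_closureM.
End IdealClosure.

End Completion.

Arguments cmpl_of {P} I x.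
Arguments cmpl_proj {P I} k f.

Section CompletionMap.
Context (P T : comPzRingType) (I : ideal P) (J : ideal T).
Context (f : {rmorphism P -> T}) (fIJ : forall x, I x -> J (f x)).

Lemma ideal_pow_map k x : ideal_pow I k x -> ideal_pow J k (f x).
Proof.
elim: k x => [//|k IH] x.
have h0 : ideal_pow J k.+1 (f 0) by rewrite rmorph0; apply: ideal0.
have hD y z : ideal_pow J k.+1 (f y) -> ideal_pow J k.+1 (f z) ->
    ideal_pow J k.+1 (f (y + z)) by rewrite rmorphD; exact: (@idealD _ (ideal_pow J k.+1)).
have hM y z : ideal_pow J k.+1 (f z) -> ideal_pow J k.+1 (f (y * z)).
  by rewrite rmorphM; exact: (@idealM _ (ideal_pow J k.+1)).
apply: (_ : _ -> @Ideal P [set x | ideal_pow J k.+1 (f x)] h0 hD hM x).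
apply => _ [y [z [Iy Iz ->]]] /=; rewrite rmorphM.
by apply: ideal_powS; [apply: fIJ | apply: IH].
Qed.

Fact aseq_map_subproof (u : adic_seq I) k :
  ideal_pow J k (f (u k.+1) - f (u k)).
Proof. by rewrite -rmorphB; apply/ideal_pow_map/aseqP. Qed.
Definition aseq_map (u : adic_seq I) := @AdicSeq T J (fun k => f (u k)) (aseq_map_subproof u).

Definition cmpl_map (a : completion I) : completion J :=
  cmpl_pi (aseq_map (repr a)).

Lemma cmpl_mapE u : cmpl_map (cmpl_pi u) = cmpl_pi (aseq_map u).
Proof.
apply/quot_piP => k; rewrite rmorphB; apply/eqP; rewrite subr_eq0; apply/eqP.
apply/quot_piP; rewrite /= -rmorphB; apply: ideal_pow_map; apply/quot_piP.
have /(_ k) := quot_repr (adic_null I) u.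
by rewrite rmorphB => /eqP; rewrite subr_eq0 => /eqP.
Qed.

Fact cmpl_map_is_zmod_morphism : zmod_morphism cmpl_map.
Proof.
move=> a b; have [u ->] := cmpl_pi_surj a; have [v ->] := cmpl_pi_surj b.
rewrite -rmorphB !cmpl_mapE -rmorphB; congr cmpl_pi.
by apply: adic_seq_eq => k /=; rewrite rmorphB.
Qed.
Fact cmpl_map_is_monoid_morphism : monoid_morphism cmpl_map.
Proof.
split=> [|a b].
  rewrite -[1 in LHS](rmorph1 (@cmpl_pi P I)) cmpl_mapE -[RHS](rmorph1 (@cmpl_pi T J)).
  by congr cmpl_pi; apply: adic_seq_eq => k /=; rewrite rmorph1.
have [u ->] := cmpl_pi_surj a; have [v ->] := cmpl_pi_surj b.
rewrite -rmorphM !cmpl_mapE -rmorphM; congr cmpl_pi.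
by apply: adic_seq_eq => k /=; rewrite rmorphM.
Qed.
HB.instance Definition _ := GRing.isZmodMorphism.Build _ _ cmpl_map
  cmpl_map_is_zmod_morphism.
HB.instance Definition _ := GRing.isMonoidMorphism.Build _ _ cmpl_map
  cmpl_map_is_monoid_morphism.

Lemma cmpl_map_of x : cmpl_map (cmpl_of I x) = cmpl_of J (f x).
Proof. by rewrite [LHS]cmpl_mapE; congr cmpl_pi; apply: adic_seq_eq. Qed.

Lemma cmpl_map_proj k a b :
  cmpl_proj k a = cmpl_proj k b ->
  cmpl_proj k (cmpl_map a) = cmpl_proj k (cmpl_map b).
Proof.
have [u ->] := cmpl_pi_surj a; have [v ->] := cmpl_pi_surj b.
rewrite !cmpl_mapE !cmpl_projE => /quot_piP uv; apply/quot_piP => /=.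
by rewrite -rmorphB; apply: ideal_pow_map.
Qed.

Lemma cmpl_map_cvg u l : cmpl_cvg u l ->
  cmpl_cvg (fun m => cmpl_map (u m)) (cmpl_map l).
Proof.
by move=> ul k; have [N hN] := ul k; exists N => m /hN /cmpl_map_proj.
Qed.

End CompletionMap.

(* Total inverse in a commutative ring which may be zero: [1 / x] when [x] is
   invertible, and 0 otherwise. *)
Definition pzinv (T : comPzRingType) (x : T) : T := xget 0 [set y | x * y = 1].

Lemma pzinv_eq (T : comPzRingType) (x y : T) : x * y = 1 -> pzinv x = y.
Proof.
move=> xy; rewrite /pzinv; case: xgetP => [z _ /= xz|/(_ y)//].
by rewrite -[z]mul1r -xy mulrAC xz mul1r.
Qed.

Section Localization.
Context (S : comPzRingType) (G : set S).

Definition mult_closure : set S :=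
  [set m | exists2 s : seq S, (forall x, x \in s -> G x) & m = \prod_(x <- s) x].

Lemma mult_closure1 : mult_closure 1.
Proof. by exists [::]; rewrite ?big_nil. Qed.

Lemma mult_closureM m n :
  mult_closure m -> mult_closure n -> mult_closure (m * n).
Proof.
move=> [s sG ->] [t tG ->]; exists (s ++ t); last by rewrite big_cat.
by move=> x; rewrite mem_cat => /orP [/sG|/tG].
Qed.

Lemma sub_mult_closure : G `<=` mult_closure.
Proof.
move=> x Gx; exists [:: x]; last by rewrite big_seq1.
by move=> y; rewrite inE => /eqP ->.
Qed.

Record fracs := Frac {
  fnum : S;
  fden : S;
  fdenP : mult_closure fden }.

HB.instance Definition _ := gen_eqMixin fracs.
HB.instance Definition _ := gen_choiceMixin fracs.

Definition frac_rel (x y : fracs) : bool :=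
  `[< exists2 m, mult_closure m &
        m * (fnum x * fden y) = m * (fnum y * fden x) >].

Fact frac_relxx : reflexive frac_rel.
Proof. by move=> x; apply/asboolP; exists 1 => //; apply: mult_closure1. Qed.
Fact frac_rel_sym : symmetric frac_rel.
Proof. by move=> x y; apply/asboolP/asboolP => -[m mG e]; exists m. Qed.
Fact frac_rel_trans : transitive frac_rel.
Proof.
move=> [y t yG] [x s xG] [z u zG] /asboolP [m mG /= e] /asboolP [n nG /= e'].
apply/asboolP; exists (m * n * t); first by do 2?apply: mult_closureM.
rewrite /=.
have -> : m * n * t * (x * u) = m * (x * t) * (n * u) by ring.
rewrite e; have -> : m * (y * s) * (n * u) = n * (y * u) * (m * s) by ring.
by rewrite e'; ring.
Qed.

Canonical frac_equiv := EquivRel frac_rel frac_relxx frac_rel_sym frac_rel_trans.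

Definition loc := {eq_quot frac_equiv}.
HB.instance Definition _ : EqQuotient fracs frac_rel loc := EqQuotient.on loc.
HB.instance Definition _ := Choice.on loc.

Definition loc_pi (x : fracs) : loc := \pi_loc x.

Lemma loc_piP (x y : fracs) : loc_pi x = loc_pi y <->
  exists2 m, mult_closure m & m * (fnum x * fden y) = m * (fnum y * fden x).
Proof. by split=> [/eqmodP/asboolP|h]; [|apply/eqmodP/asboolP]. Qed.

Lemma loc_ind (T : loc -> Prop) : (forall x, T (loc_pi x)) -> forall q, T q.
Proof. by move=> h q; rewrite -[q]reprK. Qed.

Definition frac_of (s : S) : fracs := Frac s mult_closure1.
Definition frac_add (x y : fracs) : fracs :=
  Frac (fnum x * fden y + fnum y * fden x) (mult_closureM (fdenP x) (fdenP y)).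
Definition frac_opp (x : fracs) : fracs := Frac (- fnum x) (fdenP x).
Definition frac_mul (x y : fracs) : fracs :=
  Frac (fnum x * fnum y) (mult_closureM (fdenP x) (fdenP y)).

Definition loc_add (x y : loc) : loc := loc_pi (frac_add (repr x) (repr y)).
Definition loc_opp (x : loc) : loc := loc_pi (frac_opp (repr x)).
Definition loc_mul (x y : loc) : loc := loc_pi (frac_mul (repr x) (repr y)).

Lemma loc_repr (x : fracs) : exists2 m, mult_closure m &
  m * (fnum (repr (loc_pi x)) * fden x) = m * (fnum x * fden (repr (loc_pi x))).
Proof. by apply/loc_piP; rewrite /loc_pi reprK. Qed.

Lemma loc_piD x y : loc_pi (frac_add x y) = loc_add (loc_pi x) (loc_pi y).
Proof.
apply/esym/loc_piP; have [m mG] := loc_repr x; have [n nG] := loc_repr y.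
case: (repr _) => y' t' /= _; case: (repr _) => x' s' /= _.
case: x => x s sG /=; case: y => y t tG /= ey ex.
exists (m * n); first exact: mult_closureM.
have -> : m * n * ((x' * t' + y' * s') * (s * t)) =
  m * (x' * s) * (n * t * t') + n * (y' * t) * (m * s * s') by ring.
by rewrite ex ey; ring.
Qed.

Lemma loc_piN x : loc_pi (frac_opp x) = loc_opp (loc_pi x).
Proof.
apply/esym/loc_piP; have [m mG ex] := loc_repr x; exists m => //=.
by rewrite !mulNr !mulrN ex.
Qed.

Lemma loc_piM x y : loc_pi (frac_mul x y) = loc_mul (loc_pi x) (loc_pi y).
Proof.
apply/esym/loc_piP; have [m mG] := loc_repr x; have [n nG] := loc_repr y.
case: (repr _) => y' t' /= _; case: (repr _) => x' s' /= _.
case: x => x s sG /=; case: y => y t tG /= ey ex.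
exists (m * n); first exact: mult_closureM.
have -> : m * n * (x' * y' * (s * t)) = m * (x' * s) * (n * (y' * t)) by ring.
by rewrite ex ey; ring.
Qed.

Let loc_eq (x y : fracs) :
  fnum x * fden y = fnum y * fden x -> loc_pi x = loc_pi y.
Proof.
by move=> e; apply/loc_piP; exists 1; [exact: mult_closure1|rewrite e].
Qed.

Fact loc_addA : associative loc_add.
Proof.
elim/loc_ind=> x; elim/loc_ind=> y; elim/loc_ind=> z.
by rewrite -!loc_piD; apply: loc_eq => /=; ring.
Qed.
Fact loc_addC : commutative loc_add.
Proof.
elim/loc_ind=> x; elim/loc_ind=> y.
by rewrite -!loc_piD; apply: loc_eq => /=; ring.
Qed.
Fact loc_add0 : left_id (loc_pi (frac_of 0)) loc_add.
Proof. by elim/loc_ind=> x; rewrite -!loc_piD; apply: loc_eq => /=; ring. Qed.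
Fact loc_addN : left_inverse (loc_pi (frac_of 0)) loc_opp loc_add.
Proof.
by elim/loc_ind=> x; rewrite -loc_piN -!loc_piD; apply: loc_eq => /=; ring.
Qed.
HB.instance Definition _ :=
  GRing.isZmodule.Build loc loc_addA loc_addC loc_add0 loc_addN.

Fact loc_mulA : associative loc_mul.
Proof.
elim/loc_ind=> x; elim/loc_ind=> y; elim/loc_ind=> z.
by rewrite -!loc_piM; apply: loc_eq => /=; ring.
Qed.
Fact loc_mulC : commutative loc_mul.
Proof.
elim/loc_ind=> x; elim/loc_ind=> y.
by rewrite -!loc_piM; apply: loc_eq => /=; ring.
Qed.
Fact loc_mul1 : left_id (loc_pi (frac_of 1)) loc_mul.
Proof. by elim/loc_ind=> x; rewrite -!loc_piM; apply: loc_eq => /=; ring. Qed.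
Fact loc_mulDl : left_distributive loc_mul +%R.
Proof.
elim/loc_ind=> x; elim/loc_ind=> y; elim/loc_ind=> z.
rewrite -[loc_pi x + _]loc_piD -!loc_piM -[RHS]loc_piD.
by apply: loc_eq => /=; ring.
Qed.
HB.instance Definition _ := GRing.Zmodule_isComPzRing.Build loc
  loc_mulA loc_mulC loc_mul1 loc_mulDl.

Definition loc_of (s : S) : loc := loc_pi (frac_of s).
Fact loc_of_is_zmod_morphism : zmod_morphism loc_of.
Proof.
move=> x y; rewrite -[- loc_of y]loc_piN -[RHS]loc_piD.
by apply: loc_eq => /=; ring.
Qed.
Fact loc_of_is_monoid_morphism : monoid_morphism loc_of.
Proof.
by split=> // x y; rewrite -[RHS]loc_piM; apply: loc_eq => /=; ring.
Qed.
HB.instance Definition _ := GRing.isZmodMorphism.Build S loc loc_of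
  loc_of_is_zmod_morphism.
HB.instance Definition _ := GRing.isMonoidMorphism.Build S loc loc_of
  loc_of_is_monoid_morphism.

Lemma loc_den_inv m : mult_closure m -> loc_of m * pzinv (loc_of m) = 1.
Proof.
move=> mG; have e : loc_of m * loc_pi (Frac 1 mG) = 1.
  by rewrite -[LHS]loc_piM; apply: loc_eq => /=; ring.
by rewrite (pzinv_eq e).
Qed.

Lemma loc_piE (x : fracs) : loc_pi x = loc_of (fnum x) * pzinv (loc_of (fden x)).
Proof.
rewrite (_ : pzinv _ = loc_pi (Frac 1 (fdenP x))); last first.
  by apply: pzinv_eq; rewrite -[LHS]loc_piM; apply: loc_eq => /=; ring.
by rewrite -[RHS]loc_piM; apply: loc_eq => /=; ring.
Qed.

(* The extension of [f] to the localization, [s / m |-> f s / f m]; it is the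
   morphism given by the universal property when [f] maps [G] to invertible
   elements, see [loc_liftE]. *)
Definition loc_lift (T : comPzRingType) (f : S -> T) (q : loc) : T :=
  f (fnum (repr q)) * pzinv (f (fden (repr q))).

Section LiftE.
Context (T : comPzRingType) (f : {rmorphism S -> T}).
Hypothesis fG : forall x, G x -> exists y, f x * y = 1.

Lemma mult_closure_inv m : mult_closure m -> f m * pzinv (f m) = 1.
Proof.
case=> s sG ->; suff [y e] : exists y, f (\prod_(x <- s) x) * y = 1.
  by rewrite (pzinv_eq e).
elim: s sG => [|x s IH] sG.
  by exists 1; rewrite big_nil rmorph1 mulr1.
have [|y e] := IH; first by move=> z zs; apply: sG; rewrite inE zs orbT.
have [z e'] := fG (sG x (mem_head _ _)).
exists (z * y); rewrite big_cons rmorphM.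
set p := f _ in e *; rewrite -[RHS]mulr1 -{1}e -e'; ring.
Qed.

Lemma loc_liftE (x : fracs) :
  loc_lift f (loc_pi x) = f (fnum x) * pzinv (f (fden x)).
Proof.
have [m mG] := loc_repr x; rewrite /loc_lift.
have /mult_closure_inv := fdenP (repr (loc_pi x)).
have /mult_closure_inv := fdenP x; have := mult_closure_inv mG.
case: (repr _) => x' s' /= _; case: x => x s sG /=.
set im := pzinv _; set i := pzinv _; set i' := pzinv _ => em e e' /(congr1 f).
rewrite !rmorphM => h.
rewrite -[LHS]mulr1 -[RHS]mulr1 -em -{1}[_ * (f m * im)]mulr1 -e.
rewrite -[RHS]mulr1 -e'.
transitivity (f m * (f x' * f s) * im * i * i'); first by ring.
by rewrite h; ring.
Qed.
End LiftE.

End Localization.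

Arguments loc_of {S} G s.

Section PowerSeries.
Context (R : comNzRingType) (I : choiceType).

Definition mvpoly := {malg R[{cmonom I}]}.
HB.instance Definition _ := GRing.ComNzRing.on mvpoly.

Definition polX (i : I) : mvpoly := << ucm i >>.

(* The coefficient of the monomial 1 is the value at [polX i |-> 0]. *)
Definition augmentation : {rmorphism {malg R[{cmonom I}]} -> R} :=
  @mcoeff {cmonom I} R mone.

Lemma augmentationX i : augmentation (polX i) = 0.
Proof.
rewrite /augmentation /polX /= mcoeffU; case: eqP => // e.
by have := cm1 i; rewrite -e ucmE eqxx.
Qed.

Definition aug_ideal : ideal mvpoly := ideal_ker augmentation.

Definition pseries := completion aug_ideal.
HB.instance Definition _ := GRing.ComPzRing.on pseries.

Definition psC (c : R) : pseries := cmpl_of aug_ideal (malgC c : mvpoly).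
Definition psX (i : I) : pseries := cmpl_of aug_ideal (polX i).

Section Rename.
Context (g : I -> I).
Definition mon_rename (m : {cmonom I}) : mvpoly :=
  \prod_(i <- finsupp m) polX (g i) ^+ m i.

Lemma mon_renameEw (d : {fset I}) (m : {cmonom I}) : (finsupp m `<=` d)%fset ->
  mon_rename m = \prod_(i <- d) polX (g i) ^+ m i.
Proof.
move=> md; rewrite /mon_rename.
by rewrite (big_fset_incl _ md)// => i _ /fsfun_dflt ->; rewrite expr0.
Qed.

Fact mon_rename_mmorphism : mmorphism mon_rename.
Proof.
split=> [m1 m2|]; last by rewrite /mon_rename mdom1 big_seq_fset0.
rewrite {1}/mon_rename mdomD.
rewrite (mon_renameEw (fsubsetUl (finsupp m1) (finsupp m2))).
rewrite (mon_renameEw (fsubsetUr (finsupp m1) (finsupp m2))).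
by rewrite -big_split /=; apply: eq_bigr => i _; rewrite cmM exprD.
Qed.
HB.instance Definition _ :=
  monalg.isMultiplicative.Build _ _ mon_rename mon_rename_mmorphism.

Definition pol_rename : {rmorphism mvpoly -> mvpoly} :=
  mmap (@malgC {cmonom I} R) mon_rename.

Lemma pol_renameX i : pol_rename (polX i) = polX (g i).
Proof.
rewrite /pol_rename /polX /= mmapU.
transitivity (1 * mon_rename (ucm i)) => //; rewrite mul1r.
by rewrite /mon_rename mdomU big_seq_fset1 ucmE eqxx.
Qed.

Lemma pol_renameC c : pol_rename (malgC c) = malgC c.
Proof. exact: mmapC. Qed.

Lemma aug_pol_rename p : aug_ideal p -> aug_ideal (pol_rename p).
Proof.
rewrite /aug_ideal /= => p0; rewrite -[RHS]p0 /pol_rename /= mmapE.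
have -> : p@_mone = \sum_(m <- msupp p) p@_m * (m == mone)%:R.
  rewrite [in LHS](monalgE p) raddf_sum; apply: eq_bigr => m _ /=.
  by rewrite mcoeffU mulr_natr.
rewrite raddf_sum; apply: eq_bigr => m _ /=.
rewrite -/(augmentation (_ * _)) rmorphM /=; congr (_ * _).
  exact: mcoeffUU.
have [->|m1] := eqVneq m mone; first by rewrite mmorph1; exact: mcoeffUU.
rewrite /mon_rename -/(augmentation (\prod_(i <- _) _)).
have /fset0Pn [i im] : finsupp m != fset0.
  apply: contraNneq m1 => m0; apply/cmP => i.
  by rewrite cm1; apply: fsfun_dflt; rewrite m0.
rewrite (big_fsetD1 _ im) /= rmorphM rmorphXn augmentationX.
by rewrite expr0n cmE_eq0 im mul0r.
Qed.

Definition ps_rename : {rmorphism pseries -> pseries} :=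
  cmpl_map aug_pol_rename.

Lemma ps_renameX i : ps_rename (psX i) = psX (g i).
Proof. by rewrite [LHS]cmpl_map_of pol_renameX. Qed.

Lemma ps_renameC c : ps_rename (psC c) = psC c.
Proof. by rewrite [LHS]cmpl_map_of pol_renameC. Qed.
End Rename.

(* [F(a, b)] for [F = \sum_(i, j) (F i j) x^i y^j] and [a], [b] without
   constant term. *)
Definition ps2_partial (F : nat -> nat -> R) (a b : pseries) (m : nat) :
    pseries :=
  \sum_(i < m) \sum_(j < m) psC (F i j) * (a ^+ i * b ^+ j).
Definition ps2_eval (F : nat -> nat -> R) (a b : pseries) : pseries :=
  cmpl_lim (ps2_partial F a b).

Lemma sum_square_trunc (V : nmodType) (E : nat -> nat -> V) k m : (k <= m)%N ->
  (forall i j, (k <= i)%N || (k <= j)%N -> E i j = 0) ->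
  \sum_(i < m) \sum_(j < m) E i j = \sum_(i < k) \sum_(j < k) E i j.
Proof.
move=> km E0; rewrite (big_ord_widen_cond m xpredT (fun i => \sum_(j < k) E i j)) //=.
rewrite [RHS]big_mkcond; apply: eq_bigr => i _; case: ltnP => ik; last first.
  by rewrite big1 // => j _; apply: E0; rewrite ik.
rewrite [RHS](big_ord_widen_cond m xpredT (E i)) //= [RHS]big_mkcond.
by apply: eq_bigr => j _; case: ltnP => // jk; apply: E0; rewrite jk orbT.
Qed.

Lemma ps2_cvg F a b : cmpl_proj 1 a = 0 -> cmpl_proj 1 b = 0 ->
  cmpl_cvg (ps2_partial F a b) (ps2_eval F a b).
Proof.
have [u ->] := cmpl_pi_surj a; have [v ->] := cmpl_pi_surj b.
rewrite !cmpl_projE => /quot_pi0/ideal_pow_sub u1 /quot_pi0/ideal_pow_sub v1.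
pose c i j : mvpoly := malgC (F i j).
pose E k i j : quot (ideal_pow aug_ideal k) :=
  quot_pi _ (c i j) * (aproj k u ^+ i * aproj k v ^+ j).
have uI (w : adic_seq aug_ideal) k : aug_ideal (w 1%N) -> aug_ideal (w k.+1).
  move=> w1; elim: k => [//|k IH]; rewrite -(subrK (w k.+1) (w k.+2)).
  by apply: idealD => //; apply: (@ideal_pow_sub _ _ k); apply: aseqP.
have E0 k i j : (k <= i)%N || (k <= j)%N -> E k i j = 0.
  case: k => [|k] h.
    by rewrite /E -!rmorphXn -!rmorphM; apply/quot_pi0.
  rewrite /E /aproj -!rmorphXn -!rmorphM; apply/quot_pi0/idealM.
  case/orP: h => h; last rewrite mulrC.
    by apply: ideal_pow_exp => //; apply: uI.
  by apply: ideal_pow_exp => //; apply: uI.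
pose w k : mvpoly := \sum_(i < k) \sum_(j < k) c i j * (u k ^+ i * v k ^+ j).
have wE k m : (k <= m)%N ->
    quot_pi (ideal_pow aug_ideal k) (w m) = \sum_(i < k) \sum_(j < k) E k i j.
  move=> km; rewrite -(sum_square_trunc km (@E0 k)) rmorph_sum.
  apply: eq_bigr => i _; rewrite rmorph_sum; apply: eq_bigr => j _.
  by rewrite rmorphM [in LHS]rmorphM !rmorphXn /= !aproj_le.
have wP k : ideal_pow aug_ideal k (w k.+1 - w k).
  by apply/quot_piP; rewrite !wE.
suff cvg : cmpl_cvg (ps2_partial F (cmpl_pi u) (cmpl_pi v))
    (cmpl_pi (AdicSeq wP)).
  by rewrite /ps2_eval (cmpl_cvg_lim cvg).
move=> k; exists k => m km; rewrite cmpl_projE /aproj /= wE //.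
rewrite -(sum_square_trunc km (@E0 k)) rmorph_sum.
apply: eq_bigr => i _; rewrite rmorph_sum; apply: eq_bigr => j _.
rewrite rmorphM [in LHS]rmorphM !rmorphXn /= !cmpl_projE.
by congr (_ * _); exact: cmpl_proj_of.
Qed.

Lemma psX_proj1 i : cmpl_proj 1 (psX i) = 0.
Proof.
rewrite cmpl_proj_of; apply/quot_pi0; rewrite -[polX i]mulr1.
by apply: ideal_powS => //; apply: augmentationX.
Qed.

Lemma ps_rename_eval g F a b : cmpl_proj 1 a = 0 -> cmpl_proj 1 b = 0 ->
  ps_rename g (ps2_eval F a b) = ps2_eval F (ps_rename g a) (ps_rename g b).
Proof.
move=> a0 b0; have /(cmpl_map_cvg (@aug_pol_rename g)) h := ps2_cvg F a0 b0.
apply/esym/cmpl_cvg_lim => k; have [N hN] := h k; exists N => m /hN <-.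
congr cmpl_proj; rewrite /ps2_partial -/(ps_rename g (\sum_(i < m) _)).
rewrite rmorph_sum; apply: eq_bigr => i _; rewrite rmorph_sum.
by apply: eq_bigr => j _; rewrite !rmorphM !rmorphXn ps_renameC.
Qed.

Lemma ps_rename_sub_eval g F a b c a' b' c' :
  cmpl_proj 1 a = 0 -> cmpl_proj 1 b = 0 ->
  ps_rename g a = a' -> ps_rename g b = b' -> ps_rename g c = c' ->
  ps_rename g (c - ps2_eval F a b) = c' - ps2_eval F a' b'.
Proof.
move=> a0 b0 <- <- <-; rewrite -(ps_rename_eval g F a0 b0).
exact: (rmorphB (ps_rename g)).
Qed.

End PowerSeries.

Arguments psX {R I} i.
Arguments ps_rename {R I} g.

(* One-dimensional commutative formal group laws; [F i j] is the coefficient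
   of [x^i y^j]. *)
Record fgl (R : comNzRingType) := Fgl {
  fgl_coef :> nat -> nat -> R;
  fglx0 : forall i, fgl_coef i 0 = (i == 1%N)%:R;
  fglC : forall i j, fgl_coef i j = fgl_coef j i;
  fglA : let x := psX 0 : pseries R 'I_3 in let y := psX 1 in let z := psX 2 in
    ps2_eval fgl_coef (ps2_eval fgl_coef x y) z =
    ps2_eval fgl_coef x (ps2_eval fgl_coef y z) }.

Record gcm (n : nat) := Gcm {
  gcm_mx :> 'M[int]_n;
  gcm_diag : forall i, gcm_mx i i = 2;
  gcm_offdiag : forall i j, i != j -> gcm_mx i j <= 0;
  gcm_sym0 : forall i j, gcm_mx i j = 0 <-> gcm_mx j i = 0 }.

(* [K] is the field of real numbers, [K[i]] the field of complex numbers. *)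
Definition dual (K : realType) (h : vectType K[i]%C) := 'Hom(h, K[i]%C^o).
HB.instance Definition _ (K : realType) (h : vectType K[i]%C) :=
  Vector.on (dual h).

Record root_datum (K : realType) (n : nat) (A : gcm n) := RootDatum {
  rd_h : vectType K[i]%C;
  rd_root : n.-tuple (dual rd_h);
  rd_coroot : n.-tuple rd_h;
  rd_dim : \dim {:rd_h} = (2 * n - \rank (map_mx intr A : 'M[rat]_n))%N;
  rd_root_free : free rd_root;
  rd_coroot_free : free rd_coroot;
  rd_pairing : forall i j,
    (tnth rd_root j) (tnth rd_coroot i) = (A i j)%:~R }.

Section LfunInverse.
Context (C : fieldType) (V : vectType C) (f g : 'End(V)).
Hypothesis gf : (g \o f)%VF = \1%VF.

Lemma linv_lker0 : lker f == 0%VS.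
Proof.
apply/lker0P => x y /(congr1 g).
by rewrite -!comp_lfunE gf !id_lfunE.
Qed.

Lemma linvE : (f^-1)%VF = g.
Proof.
rewrite -[LHS]comp_lfun1l -gf -comp_lfunA lker0_compfV ?comp_lfun1r//.
exact: linv_lker0.
Qed.

Lemma linv_compVf : (f^-1 \o f)%VF = \1%VF.
Proof. exact: lker0_compVf linv_lker0. Qed.
Lemma linv_compfV : (f \o f^-1)%VF = \1%VF.
Proof. exact: lker0_compfV linv_lker0. Qed.
End LfunInverse.

Section Weyl.
Context (K : realType) (n : nat) (A : gcm n) (D : root_datum K A).

Local Notation V := (dual (rd_h D)).

Definition simple_root (i : 'I_n) : V := tnth (rd_root D) i.
Definition simple_coroot (i : 'I_n) : rd_h D := tnth (rd_coroot D) i.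
Definition pairing (la : V) (i : 'I_n) : K[i]%C := la (simple_coroot i).

Definition simple_refl_fun (i : 'I_n) (la : V) : V :=
  la - pairing la i *: simple_root i.

Fact simple_refl_fun_is_linear i : linear (simple_refl_fun i).
Proof.
move=> a x y; rewrite /simple_refl_fun /pairing add_lfunE scale_lfunE.
by rewrite scalerDl opprD addrACA scalerBr scalerA.
Qed.
HB.instance Definition _ i :=
  GRing.isLinear.Build _ _ _ _ (simple_refl_fun i) (simple_refl_fun_is_linear i).

Definition simple_refl (i : 'I_n) : 'End(V) := linfun (simple_refl_fun i).

Lemma simple_reflE i la :
  simple_refl i la = la - pairing la i *: simple_root i.
Proof. by rewrite lfunE. Qed.

Lemma simple_reflK i : (simple_refl i \o simple_refl i)%VF = \1%VF.
Proof.
have ii : pairing (simple_root i) i = 2%:R by rewrite [LHS]rd_pairing gcm_diag.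
apply/lfunP => la; rewrite comp_lfunE id_lfunE !simple_reflE.
have -> : pairing (la - pairing la i *: simple_root i) i = - pairing la i.
  rewrite {1}/pairing add_lfunE opp_lfunE scale_lfunE.
  rewrite -/(pairing la i) -/(pairing (simple_root i) i) ii.
  by rewrite [_ *: _]mulr_natr mulr2n opprD addrA subrr sub0r.
by rewrite scaleNr opprK subrK.
Qed.

Definition weyl_word (s : seq 'I_n) : 'End(V) :=
  foldr (fun i f => (simple_refl i \o f)%VF) \1%VF s.

Lemma weyl_word_cat s t : weyl_word (s ++ t) = (weyl_word s \o weyl_word t)%VF.
Proof.
by elim: s => [|i s IH] /=; rewrite ?comp_lfun1l// IH comp_lfunA.
Qed.

Lemma weyl_wordV s : (weyl_word (rev s) \o weyl_word s)%VF = \1%VF.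
Proof.
elim: s => [|i s IH]; first by rewrite comp_lfun1l.
rewrite rev_cons -cats1 weyl_word_cat /= comp_lfun1r -comp_lfunA.
by rewrite [(simple_refl i \o (_ \o _))%VF]comp_lfunA simple_reflK comp_lfun1l.
Qed.

(* Since the [simple_refl i] are involutions, the group they generate consists
   of the products of simple reflections. *)
Record weyl := Weyl {
  weyl_fun :> 'End(V);
  weylP : `[< exists s, weyl_fun = weyl_word s >] }.
HB.instance Definition _ := [isSub for weyl_fun].
HB.instance Definition _ := [Choice of weyl by <:].

Lemma weyl_wordP (w : weyl) : exists s, weyl_fun w = weyl_word s.
Proof. exact/asboolP/weylP. Qed.

Fact weyl1_subproof : `[< exists s, \1%VF = weyl_word s >].
Proof. by apply/asboolP; exists [::]. Qed.
Definition weyl1 := Weyl weyl1_subproof.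

Fact weylM_subproof (v w : weyl) : `[< exists s, (v \o w)%VF = weyl_word s >].
Proof.
apply/asboolP; have [s ->] := weyl_wordP v; have [t ->] := weyl_wordP w.
by exists (s ++ t); rewrite weyl_word_cat.
Qed.
Definition weylM (v w : weyl) := Weyl (weylM_subproof v w).

Lemma weyl_linv (w : weyl) : exists g : 'End(V), (g \o w)%VF = \1%VF.
Proof.
by have [s ->] := weyl_wordP w; exists (weyl_word (rev s)); exact: weyl_wordV.
Qed.

Lemma weyl_eq (v w : weyl) : weyl_fun v = weyl_fun w -> v = w.
Proof. exact: val_inj. Qed.

Fact weylV_subproof (w : weyl) : `[< exists s, (w^-1)%VF = weyl_word s >].
Proof.
apply/asboolP; have [s ws] := weyl_wordP w; exists (rev s).
by rewrite ws; exact: linvE (weyl_wordV s).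
Qed.
Definition weylV (w : weyl) := Weyl (weylV_subproof w).

Fact weylMA : associative weylM.
Proof. by move=> u v w; apply: weyl_eq; apply: comp_lfunA. Qed.
Fact weyl1M : left_id weyl1 weylM.
Proof. by move=> w; apply: weyl_eq; apply: comp_lfun1l. Qed.
Fact weylM1 : right_id weyl1 weylM.
Proof. by move=> w; apply: weyl_eq; apply: comp_lfun1r. Qed.
Fact weylVM : left_inverse weyl1 weylV weylM.
Proof. by move=> w; apply: weyl_eq; have [g /linv_compVf] := weyl_linv w. Qed.
Fact weylMV : right_inverse weyl1 weylV weylM.
Proof. by move=> w; apply: weyl_eq; have [g /linv_compfV] := weyl_linv w. Qed.
HB.instance Definition _ :=
  isGroup.Build weyl weylMA weyl1M weylM1 weylVM weylMV.

Fact simple_weyl_subproof i : `[< exists s, simple_refl i = weyl_word s >].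
Proof. by apply/asboolP; exists [:: i]; rewrite /= comp_lfun1r. Qed.
Definition simple_weyl i : weyl := Weyl (simple_weyl_subproof i).

End Weyl.

Definition zbasis (V : zmodType) (L : {pred V}) (b : seq V) : Prop :=
  [/\ {subset b <= L},
      forall v, v \in L ->
        exists c : 'I_(size b) -> int, v = \sum_(i < size b) b`_i *~ c i &
      forall c : 'I_(size b) -> int,
        \sum_(i < size b) b`_i *~ c i = 0 -> forall i, c i = 0].

Record demazure_lattice (K : realType) (n : nat) (A : gcm n)
    (D : root_datum K A) := DemazureLattice {
  dl_lattice :> zmodClosed (dual (rd_h D));
  dl_free : exists b, zbasis dl_lattice b;
  dl_root : forall i, simple_root D i \in dl_lattice;
  dl_int : forall la i, la \in dl_lattice ->
    exists c : int, pairing la i = c%:~R;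
  dl_basis : forall i,
    exists2 b, zbasis dl_lattice b & simple_root D i \in b }.

Section Lattice.
Context (K : realType) (n : nat) (A : gcm n) (D : root_datum K A).
Context (L : demazure_lattice D).

Local Notation V := (dual (rd_h D)).

Record lattice_elt := LatticeElt {
  lattice_val : V;
  lattice_valP : lattice_val \in (L : zmodClosed V) }.
HB.instance Definition _ := [isSub for lattice_val].
HB.instance Definition _ := [Choice of lattice_elt by <:].
HB.instance Definition _ := [SubChoice_isSubZmodule of lattice_elt by <:].

Lemma simple_refl_lattice i (la : V) :
  la \in (L : zmodClosed V) -> simple_refl D i la \in (L : zmodClosed V).
Proof.
move=> laL; have [c ce] := dl_int i laL.
rewrite simple_reflE ce scaler_int; apply: rpredB => //.
by apply: rpredMz; apply: dl_root.
Qed.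

Fact weyl_lattice (w : weyl D) (la : lattice_elt) :
  weyl_fun w (lattice_val la) \in (L : zmodClosed V).
Proof.
have [s ->] := weyl_wordP w; elim: s => [|i s IH] /=.
  by rewrite id_lfunE; apply: lattice_valP.
by rewrite comp_lfunE; apply: simple_refl_lattice.
Qed.

Definition lattice_act (w : weyl D) (la : lattice_elt) : lattice_elt :=
  LatticeElt (weyl_lattice w la).

Fact lattice_actD w : {morph lattice_act w : la mu / la + mu}.
Proof. by move=> la mu; apply: val_inj; rewrite /= linearD. Qed.
Fact lattice_act0 w : lattice_act w 0 = 0.
Proof. by apply: val_inj; rewrite /= linear0. Qed.

Definition lattice_root (i : 'I_n) : lattice_elt := LatticeElt (dl_root L i).

(* The roots belong to the lattice, which is stable under the Weyl group. *)
Definition roots : set lattice_elt :=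
  [set la | exists w i, la = lattice_act w (lattice_root i)].

Definition positive_roots : set lattice_elt :=
  [set la | roots la /\
    exists c : 'I_n -> nat, la = \sum_i lattice_root i *+ c i].

End Lattice.

Arguments roots {K n A D} L _.
Arguments positive_roots {K n A D} L _.

Section Demazure.
Context (R : comNzRingType) (F : fgl R).
Context (K : realType) (n : nat) (A : gcm n) (D : root_datum K A).
Context (L : demazure_lattice D).

Local Notation Lam := (lattice_elt L).
Local Notation W := (weyl D).

Definition fga_rel : set (pseries R Lam) :=
  [set psX 0] `|`
  [set f | exists la mu, f = psX (la + mu) - ps2_eval F (psX la) (psX mu)].

Definition fga_ideal : ideal (pseries R Lam) :=
  ideal_closure (ideal_gen fga_rel).

Definition fga := quot fga_ideal.
HB.instance Definition _ := GRing.ComPzRing.on fga.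

Definition fgaX (la : Lam) : fga := quot_pi fga_ideal (psX la).
Definition fgaC (c : R) : fga := quot_pi fga_ideal (psC Lam c).

Lemma ps_rename_fga_ideal (w : W) f :
  fga_ideal f -> fga_ideal (ps_rename (lattice_act w) f).
Proof.
move=> hf k; have [g Jg gE] := hf k.
exists (ps_rename (lattice_act w) g); last exact: cmpl_map_proj.
have rel0 : ideal_gen fga_rel (ps_rename (lattice_act w) 0).
  by rewrite rmorph0; apply: ideal0.
have relD x y : ideal_gen fga_rel (ps_rename (lattice_act w) x) ->
    ideal_gen fga_rel (ps_rename (lattice_act w) y) ->
    ideal_gen fga_rel (ps_rename (lattice_act w) (x + y)).
  by rewrite rmorphD; apply: (@idealD _ (ideal_gen fga_rel)).
have relM x y : ideal_gen fga_rel (ps_rename (lattice_act w) y) ->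
    ideal_gen fga_rel (ps_rename (lattice_act w) (x * y)).
  by rewrite rmorphM; apply: (@idealM _ (ideal_gen fga_rel)).
apply: (Jg (@Ideal _ [set x | ideal_gen fga_rel (ps_rename (lattice_act w) x)]
  rel0 relD relM)).
move=> _ [->|[la [mu ->]]] /=; apply: sub_ideal_gen.
  by left; rewrite /= ps_renameX lattice_act0.
right; exists (lattice_act w la), (lattice_act w mu).
apply: ps_rename_sub_eval; rewrite -?lattice_actD.
- exact: psX_proj1.
- exact: psX_proj1.
- exact: ps_renameX.
- exact: ps_renameX.
- exact: ps_renameX.
Qed.

Definition fga_act (w : W) : {rmorphism fga -> fga} :=
  quot_map (ps_rename_fga_ideal w).

Lemma fga_actX w la : fga_act w (fgaX la) = fgaX (lattice_act w la).
Proof. by rewrite [LHS]quot_mapE ps_renameX. Qed.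

Lemma fga_actC w c : fga_act w (fgaC c) = fgaC c.
Proof. by rewrite [LHS]quot_mapE ps_renameC. Qed.

Definition fga_loc := loc [set fgaX al | al in positive_roots L].
HB.instance Definition _ := GRing.ComPzRing.on fga_loc.

Local Notation Q := fga_loc.

Definition loc_incl (s : fga) : Q := loc_of _ s.

(* [w (s / m) = w s / w m].  The quotient makes sense in [Q]: for a root [al],
   [w al] is either a positive root or the opposite of one, and [x_(- be)] is
   the product of [x_be] and a unit of [fga]. *)
Definition fga_loc_act (w : W) (q : Q) : Q := loc_lift (loc_incl \o fga_act w) q.

(* [Q_W], as the [Q]-module of finitely supported functions on [W], with
   [tw_mono q w] for [q delta_w]; its product is [tw_mul]. *)
Definition twisted := {malg Q[W]}.
HB.instance Definition _ := GRing.Zmodule.on twisted.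

Definition tw_mono (q : Q) (w : W) : twisted := << q *g w >>.

Definition tw_delta (w : W) : twisted := tw_mono 1 w.

Definition tw_scale (q : Q) (z : twisted) : twisted :=
  \sum_(w <- msupp z) tw_mono (q * z@_w) w.

Definition tw_mul (z z' : twisted) : twisted :=
  \sum_(w <- msupp z) \sum_(w' <- msupp z')
    tw_mono (z@_w * fga_loc_act w (z'@_w')) (w * w')%g.

Definition tw_act (z : twisted) (q : Q) : Q :=
  \sum_(w <- msupp z) z@_w * fga_loc_act w q.

(* [X_al = (1 / x_al) (1 - delta_al)] for [al = w (al_i)], where
   [s_al = w s_i w^-1].  The inverse exists in [Q] even if [al] is negative. *)
Definition demazure_elt (w : W) (i : 'I_n) : twisted :=
  tw_scale (pzinv (loc_incl (fgaX (lattice_act w (lattice_root L i)))))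
    (tw_delta 1%g - tw_delta (w * simple_weyl D i * w^-1)%g).

Definition tw_subalgebra (B : set twisted) : Prop :=
  [/\ B (tw_delta 1%g),
      forall z z', B z -> B z' -> B (z - z'),
      forall z z', B z -> B z' -> B (tw_mul z z') &
      forall (c : R) z, B z -> B (tw_scale (loc_incl (fgaC c)) z)].

Definition affine_demazure : set twisted :=
  [set z | forall B, tw_subalgebra B ->
    (forall s : fga, B (tw_mono (loc_incl s) 1%g)) ->
    (forall w i, B (demazure_elt w i)) -> B z].

End Demazure.

Arguments affine_demazure {R} F {K n A D} L _.

(* Main.v *)
From HB Require Import structures.
From mathcomp Require Import mpoly.
Require Import Defs.
From mathcomp Require Import all_boot all_order all_algebra.
From mathcomp Require Import finmap complex monalg zify ring.
From mathcomp Require Import boolp classical_sets reals.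

Set Implicit Arguments.
Unset Strict Implicit.
Unset Printing Implicit Defensive.

Import Order.TTheory GRing.Theory Num.Theory.
Local Open Scope ring_scope.
Local Open Scope classical_set_scope.

(* A basis of the lattice identifies [S] with a power series ring over [R].  A
   basis containing a simple root shows that its [x_al] is prime and that
   [S / x_al] has a trivial action of [s_al], so that [X_al] preserves [S].
   As [x_(w al) = w x_al], the same holds for every root.

   Conversely, let [z = \sum_w z_w delta_w] preserve [S], and let [al] be a
   positive root.  Replacing [z] by [z b - v(b) z] for suitable [b] in [S] kills
   the coefficient at [v] and multiplies the one at [w] by [w(b) - v(b)], which
   can be made prime to [x_al] as long as [v] is neither [w] nor [s_al w].
   Hence [z_w] has at most a simple pole at [x_al], and none if the coefficient
   at [s_al w] vanishes.  For [w] of maximal length in the support, the strong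
   exchange condition leaves only poles at the [al > 0] with [w^-1 al < 0].
   These are also the poles of the leading coefficient of a product [Y] of
   the [X_(al_i)] along a reduced word of [w], so that [z - c Y] has no term at
   [w] for some [c] in [S].  One concludes by induction on the length. *)

(** * Formal power series in one variable *)

(** Characteristic 0 serves twice, each time modulo [x_al]. A linear form in the other basis
    variables with integer coefficients vanishes only if these integers do, so that [x_la = x_mu]
    forces [la - mu] to be a multiple of [al]; this gives the elements [b] that isolate a
    coefficient of [z]. And [x_al - x_(- al) = x_al e], where [e] has constant term 2 and so is
    prime to [x_al]; this bounds the order of the poles by one.

    There may be infinitely many roots, hence infinitely many denominators in [Q]. Regularity is
    therefore tested at one prime [x_al] at a time, in the form [c q] in [S] with [c] prime to
    [x_al], and the finitely many factors of an actual denominator are cancelled one by one. As [W]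
    may have no longest element, the induction is driven by the lengths in the finite support of
    [z].

    Series in several variables are written as series in one variable [T] over a polynomial ring,
    with [T] recording the degree. The absence of zero divisors then comes from the polynomial
    ring. *)

Record fps (A : Type) := Fps { fps_coef :> nat -> A }.

Section FormalPowerSeries.
Context (A : comNzRingType).
Implicit Types f g : fps A.

Lemma fps_eq f g : f =1 g -> f = g.
Proof. by case: f g => [f] [g] /= /funext ->. Qed.

HB.instance Definition _ := gen_eqMixin (fps A).
HB.instance Definition _ := gen_choiceMixin (fps A).

Definition fps_add f g := Fps (fun d => f d + g d).
Definition fps_opp f := Fps (fun d => - f d).
Definition fpsC (a : A) := Fps (fun d => if d == 0%N then a else 0).
Definition fps_mul f g := Fps (fun d => \sum_(i < d.+1) f i * g (d - i)%N).

Fact fps_addA : associative fps_add.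
Proof. by move=> f g h; apply: fps_eq => d /=; rewrite addrA. Qed.
Fact fps_addC : commutative fps_add.
Proof. by move=> f g; apply: fps_eq => d /=; rewrite addrC. Qed.
Fact fps_add0 : left_id (fpsC 0) fps_add.
Proof. by move=> f; apply: fps_eq => d /=; rewrite if_same add0r. Qed.
Fact fps_addN : left_inverse (fpsC 0) fps_opp fps_add.
Proof. by move=> f; apply: fps_eq => d /=; rewrite if_same addNr. Qed.
HB.instance Definition _ :=
  GRing.isZmodule.Build (fps A) fps_addA fps_addC fps_add0 fps_addN.

Let trunc m f : {poly A} := \poly_(i < m.+1) f i.

Let coef_trunc m f d : (d <= m)%N -> (trunc m f)`_d = f d.
Proof. by move=> dm; rewrite coef_poly ltnS dm. Qed.

(** The product in degree [d] only sees coefficients of degree at most [d], so any polynomials that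
    agree with the factors that far compute it. Commutativity and associativity are thus inherited
    from [{poly A}]. *)
Let fps_mulE m f g d (p q : {poly A}) : (d <= m)%N ->
  (forall i, (i <= m)%N -> p`_i = f i) -> (forall i, (i <= m)%N -> q`_i = g i) ->
  fps_mul f g d = (p * q)`_d.
Proof.
move=> dm pf qg; rewrite coefM; apply: eq_bigr => i _ /=; rewrite pf ?qg //.
  by rewrite (leq_trans _ dm) ?leq_subr.
by rewrite (leq_trans _ dm) // -ltnS.
Qed.

Fact fps_mulC : commutative fps_mul.
Proof.
move=> f g; apply: fps_eq => d.
rewrite (fps_mulE (leqnn d) (@coef_trunc d f) (@coef_trunc d g)) mulrC.
by rewrite -(fps_mulE (leqnn d) (@coef_trunc d g) (@coef_trunc d f)).
Qed.
Fact fps_mulA : associative fps_mul.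
Proof.
move=> f g h; apply: fps_eq => d.
have tM f' g' i : (i <= d)%N -> (trunc d f' * trunc d g')`_i = fps_mul f' g' i.
  by move=> id; rewrite -(fps_mulE id (@coef_trunc d f') (@coef_trunc d g')).
rewrite (fps_mulE (leqnn d) (@coef_trunc d f) (@tM g h)) mulrA.
by rewrite -(fps_mulE (leqnn d) (@tM f g) (@coef_trunc d h)).
Qed.
Fact fps_mul1 : left_id (fpsC 1) fps_mul.
Proof.
move=> f; apply: fps_eq => d /=; rewrite big_ord_recl subn0 mul1r big1 ?addr0//.
by move=> i _; rewrite mul0r.
Qed.
Fact fps_mulDl : left_distributive fps_mul fps_add.
Proof.
move=> f g h; apply: fps_eq => d /=; rewrite -big_split /=.
by apply: eq_bigr => i _; rewrite mulrDl.
Qed.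
Fact fps_1neq0 : fpsC 1 != fpsC 0.
Proof.
by apply/eqP => /(congr1 (fun f : fps A => f 0%N)) /eqP; rewrite /= oner_eq0.
Qed.
HB.instance Definition _ := GRing.Zmodule_isComNzRing.Build (fps A)
  fps_mulA fps_mulC fps_mul1 fps_mulDl fps_1neq0.

Lemma fps_coefD f g d : (f + g) d = f d + g d. Proof. by []. Qed.
Lemma fps_coefN f d : (- f) d = - f d. Proof. by []. Qed.
Lemma fps_coefB f g d : (f - g) d = f d - g d. Proof. by []. Qed.
Lemma fps_coef0 d : (0 : fps A) d = 0. Proof. exact: if_same. Qed.
Lemma fps_coefM f g d : (f * g) d = \sum_(i < d.+1) f i * g (d - i)%N.
Proof. by []. Qed.

Lemma fps_coef_sum (I : Type) (r : seq I) (P : pred I) (E : I -> fps A) d :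
  (\sum_(i <- r | P i) E i) d = \sum_(i <- r | P i) E i d.
Proof.
by elim/big_rec2: _ => [|i y x _ <-]; rewrite ?fps_coef0.
Qed.

Fact fpsC_is_zmod_morphism : zmod_morphism fpsC.
Proof.
by move=> a b; apply: fps_eq => d; rewrite fps_coefB /=; case: eqP; rewrite ?subr0.
Qed.
Fact fpsC_is_monoid_morphism : monoid_morphism fpsC.
Proof.
split=> // a b; apply: fps_eq => d; rewrite fps_coefM big_ord_recl /= subn0.
rewrite big1 ?addr0; first by case: eqP; rewrite ?mulr0.
by move=> i _; rewrite mul0r.
Qed.
HB.instance Definition _ := GRing.isZmodMorphism.Build A (fps A) fpsC
  fpsC_is_zmod_morphism.
HB.instance Definition _ := GRing.isMonoidMorphism.Build A (fps A) fpsC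
  fpsC_is_monoid_morphism.

Lemma fps_coefCM a f d : (fpsC a * f) d = a * f d.
Proof.
rewrite fps_coefM big_ord_recl subn0 big1 ?addr0 //= => i _.
by rewrite mul0r.
Qed.

Lemma fps_coef0M f g : (f * g) 0%N = f 0%N * g 0%N.
Proof. by rewrite fps_coefM big_ord_recl big_ord0 addr0. Qed.

Definition fpsXn k (a : A) : fps A := Fps (fun d => if d == k then a else 0).

Lemma fpsXnM k l a b : fpsXn k a * fpsXn l b = fpsXn (k + l)%N (a * b).
Proof.
apply: fps_eq => d; rewrite fps_coefM.
have [kd|dk] := ltnP d k.
  rewrite big1 /= => [|i _].
    by case: (d =P (k + l)%N) => // dkl; rewrite dkl ltnNge leq_addr in kd.
  by rewrite (ltn_eqF (leq_trans (ltn_ord i) kd)) mul0r.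
rewrite (bigD1 (Ordinal (dk : (k < d.+1)%N))) //= eqxx big1 ?addr0.
  by rewrite -(eqn_add2l k) subnKC //; case: eqP; rewrite ?mulr0.
by move=> i; rewrite -val_eqE /= => /negbTE ->; rewrite mul0r.
Qed.

Lemma fpsXnX k a m : fpsXn k a ^+ m = fpsXn (k * m)%N (a ^+ m).
Proof.
elim: m => [|m IH]; first by rewrite muln0 expr0; apply: fps_eq.
by rewrite !exprS IH fpsXnM mulnS.
Qed.

Definition fpsX1 : A -> fps A := fpsXn 1.

Lemma fps_coefX1M a f d : (fpsX1 a * f) d.+1 = a * f d.
Proof.
rewrite fps_coefM !big_ord_recl mul0r add0r big1 ?addr0 ?subn1 //= => i _.
by rewrite mul0r.
Qed.

(** Order at least [k]: the form in which the T-adic topology is used. *)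
Definition fps_vanish k f := forall d, (d < k)%N -> f d = 0.

Lemma fps_vanish0 k : fps_vanish k 0.
Proof. by move=> d _; exact: fps_coef0. Qed.
Lemma fps_vanishD k f g : fps_vanish k f -> fps_vanish k g -> fps_vanish k (f + g).
Proof. by move=> fk gk d dk; rewrite fps_coefD fk ?gk ?addr0. Qed.
Lemma fps_vanishN k f : fps_vanish k f -> fps_vanish k (- f).
Proof. by move=> fk d dk; rewrite fps_coefN fk ?oppr0. Qed.
Lemma fps_vanishB k f g : fps_vanish k f -> fps_vanish k g -> fps_vanish k (f - g).
Proof. by move=> fk /fps_vanishN; apply: fps_vanishD. Qed.
Lemma fps_vanish_sum k (I : Type) (r : seq I) (P : pred I) (E : I -> fps A) :
  (forall i, P i -> fps_vanish k (E i)) ->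
  fps_vanish k (\sum_(i <- r | P i) E i).
Proof.
by move=> h; elim/big_ind: _ => //; [exact: fps_vanish0|exact: fps_vanishD].
Qed.
Lemma fps_vanish_le k m f : (k <= m)%N -> fps_vanish m f -> fps_vanish k f.
Proof. by move=> km h d dk; apply: h; apply: leq_trans km. Qed.
Lemma fps_vanishM k m f g :
  fps_vanish k f -> fps_vanish m g -> fps_vanish (k + m) (f * g).
Proof.
move=> fk gm d dkm; rewrite fps_coefM big1 // => i _.
have [ik|ki] := ltnP i k; first by rewrite fk ?mul0r.
have id : (i <= d)%N by rewrite -ltnS.
have dim : (d - i < m)%N by rewrite ltn_subLR // (leq_trans dkm) // leq_add2r.
by rewrite (gm _ dim) mulr0.
Qed.
Lemma fps_vanishMl k f g : fps_vanish k g -> fps_vanish k (f * g).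
Proof. by move=> gk; apply: (@fps_vanishM 0) => // -[]. Qed.
Lemma fps_vanishX k f : f 0%N = 0 -> fps_vanish k (f ^+ k).
Proof.
move=> f0; elim: k => [//|k IH]; rewrite exprS -add1n.
by apply: fps_vanishM => // -[].
Qed.
Lemma fps_coef_eq k f g d : fps_vanish k (f - g) -> (d < k)%N -> f d = g d.
Proof. by move=> h dk; apply/eqP; rewrite -subr_eq0 -fps_coefB h. Qed.

Lemma fps_coef0X f k : f 0%N = 0 -> (0 < k)%N -> (f ^+ k) 0%N = 0.
Proof. by move=> f0 k0; exact: (@fps_vanishX k f f0 0%N k0). Qed.

Lemma fps_coefE0 f d : (forall k, fps_vanish k f) -> f d = 0.
Proof. by move=> h; apply: (h d.+1). Qed.

End FormalPowerSeries.

(** If [m] is the order of [f], and [g] vanishes below degree [d], the coefficient of [f * g] in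
    degree [m + d] is the single product [f m * g d]. *)
Lemma fps_mulf_eq0 (A : idomainType) (f g : fps A) :
  f * g = 0 -> f != 0 -> g = 0.
Proof.
move=> fg f0.
have fneq : exists d, f d != 0.
  apply: contra_notP (negP f0) => h; apply/eqP/fps_eq => d; rewrite fps_coef0.
  by apply/eqP; apply: contra_notT h => ?; exists d.
have [m fm minm] := ex_minnP fneq.
suff h d : fps_vanish d g by apply: fps_eq => d; rewrite fps_coefE0 ?fps_coef0.
elim: d => [[]//|d IH] e; rewrite ltnS leq_eqVlt => /predU1P [->|/IH//].
have := congr1 (fun f : fps A => f (m + d)%N) fg.
have mi : (m < (m + d).+1)%N by rewrite ltnS leq_addr.
rewrite fps_coef0 fps_coefM (bigD1 (Ordinal mi)) //= addKn big1 ?addr0.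
  by move/eqP; rewrite mulf_eq0 (negbTE fm) => /eqP.
move=> i; rewrite -val_eqE /= => im.
have [ilt|ige] := ltnP i m.
  suff -> : f i = 0 by rewrite mul0r.
  by apply/eqP; apply: contraTT ilt => /minm; rewrite -leqNgt.
have id : (i <= m + d)%N by rewrite -ltnS.
have dim : (m + d - i < d)%N.
  by rewrite ltn_subLR // ltn_add2r ltn_neqAle eq_sym im ige.
by rewrite (IH _ dim) mulr0.
Qed.

(** * Evaluation of polynomials and of power series at power series *)

Section PolynomialEvaluation.
Context (R A : comNzRingType) (iota : {rmorphism R -> A}) (I : choiceType).
Variable f : I -> fps A.

Definition mon_eval (m : {cmonom I}) : fps A := \prod_(i <- finsupp m) f i ^+ m i.

Lemma mon_evalEw (d : {fset I}) (m : {cmonom I}) : (finsupp m `<=` d)%fset ->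
  mon_eval m = \prod_(i <- d) f i ^+ m i.
Proof.
move=> md; rewrite /mon_eval.
by rewrite (big_fset_incl _ md)// => i _ /fsfun_dflt ->; rewrite expr0.
Qed.

Fact mon_eval_mmorphism : mmorphism mon_eval.
Proof.
split=> [m1 m2|]; last by rewrite /mon_eval mdom1 big_seq_fset0.
rewrite {1}/mon_eval mdomD.
rewrite (mon_evalEw (fsubsetUl (finsupp m1) (finsupp m2))).
rewrite (mon_evalEw (fsubsetUr (finsupp m1) (finsupp m2))).
by rewrite -big_split /=; apply: eq_bigr => i _; rewrite cmM exprD.
Qed.
HB.instance Definition _ :=
  monalg.isMultiplicative.Build _ _ mon_eval mon_eval_mmorphism.

Definition pol_eval : {rmorphism mvpoly R I -> fps A} :=
  mmap (@fpsC A \o iota) mon_eval.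

Lemma pol_evalX i : pol_eval (polX R i) = f i.
Proof.
rewrite /pol_eval /polX /= mmapU.
transitivity (1 * mon_eval (ucm i)); first by congr (_ * _); exact: (rmorph1 (@fpsC A \o iota)).
by rewrite mul1r /mon_eval mdomU big_seq_fset1 ucmE eqxx.
Qed.

Lemma pol_evalC c : pol_eval (malgC c) = fpsC (iota c).
Proof. exact: mmapC. Qed.

Hypothesis f0 : forall i, f i 0%N = 0.

Lemma pol_eval_coef0 p : pol_eval p 0%N = iota (augmentation R I p).
Proof.
rewrite /pol_eval /= mmapE.
have -> : monalg.mcoeff mone p =
    \sum_(m <- monalg.msupp p) monalg.mcoeff m p * (m == mone)%:R.
  rewrite [in LHS](monalg.monalgE p) raddf_sum; apply: eq_bigr => m _ /=.
  by rewrite monalg.mcoeffU mulr_natr.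
rewrite fps_coef_sum rmorph_sum; apply: eq_bigr => m _ /=.
transitivity ((fpsC (iota (monalg.mcoeff m p)) * mon_eval m) 0%N) => //.
rewrite fps_coefCM rmorphM /= rmorph_nat; congr (_ * _).
have [->|m1] := eqVneq m mone; first by rewrite mmorph1.
have /fset0Pn [i im] : finsupp m != fset0.
  apply: contraNneq m1 => m0; apply/cmP => i.
  by rewrite cm1; apply: fsfun_dflt; rewrite m0.
rewrite /mon_eval (big_fsetD1 _ im) fps_coef0M fps_coef0X ?mul0r //.
by rewrite lt0n cmE_eq0 negbK.
Qed.

Lemma pol_eval_vanish k p : ideal_pow (aug_ideal R I) k p ->
  fps_vanish k (pol_eval p).
Proof.
elim: k p => [//|k IH] p.
have h0 : fps_vanish k.+1 (pol_eval 0) by rewrite rmorph0; apply: fps_vanish0.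
have hD y z : fps_vanish k.+1 (pol_eval y) -> fps_vanish k.+1 (pol_eval z) ->
    fps_vanish k.+1 (pol_eval (y + z)) by rewrite rmorphD; apply: fps_vanishD.
have hM y z : fps_vanish k.+1 (pol_eval z) -> fps_vanish k.+1 (pol_eval (y * z)).
  by rewrite rmorphM; apply: fps_vanishMl.
(* A generated ideal lies in every ideal containing the generators; here that ideal is the preimage
   of the series of order at least [k.+1]. *)
apply: (_ : _ -> @Ideal (mvpoly R I) [set x | fps_vanish k.+1 (pol_eval x)] h0 hD hM p).
apply => _ [y [z [Iy Iz ->]]] /=; rewrite rmorphM -add1n; apply: fps_vanishM.
  move=> -[|//] _; rewrite pol_eval_coef0.
  by move: Iy; rewrite /aug_ideal /= => ->; rewrite rmorph0.
exact: IH.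
Qed.

End PolynomialEvaluation.

(** When the [f i] have no constant term, polynomials in the power [d.+1] of the augmentation ideal
    contribute nothing in degree [d]. The term of index [d.+1] of any representing sequence then
    gives the right coefficient. *)
HB.lock Definition ps_eval (R A : comNzRingType) (iota : {rmorphism R -> A})
    (I : choiceType) (f : I -> fps A) (a : pseries R I) : fps A :=
  Fps (fun d => pol_eval iota f ((repr a : adic_seq _) d.+1) d).

Section SeriesEvaluation.
Context (R A : comNzRingType) (iota : {rmorphism R -> A}) (I : choiceType).
Variable f : I -> fps A.
Hypothesis f0 : forall i, f i 0%N = 0.

Local Notation pol_eval := (pol_eval iota f).
Local Notation ps_eval := (ps_eval iota f).

Lemma pol_eval_aseq (u : adic_seq (aug_ideal R I)) d k m : (d < k)%N -> (k <= m)%N ->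
  pol_eval (u m) d = pol_eval (u k) d.
Proof.
move=> dk km; apply: (@fps_coef_eq _ k) => //; rewrite -rmorphB.
by apply: (pol_eval_vanish iota f0); apply/quot_piP; exact: aproj_le.
Qed.

Lemma ps_evalE u d k : (d < k)%N -> ps_eval (cmpl_pi u) d = pol_eval (u k) d.
Proof.
move=> dk; rewrite unlock /= (@pol_eval_aseq u d d.+1 k) //.
apply: (@fps_coef_eq _ d.+1) => //; rewrite -rmorphB; apply: (pol_eval_vanish iota f0).
have /(_ d.+1) := quot_repr (adic_null (aug_ideal R I)) u.
by rewrite rmorphB => /eqP; rewrite subr_eq0 => /eqP/quot_piP.
Qed.

Fact ps_eval_is_zmod_morphism : zmod_morphism ps_eval.
Proof.
move=> a b; have [u ->] := cmpl_pi_surj a; have [v ->] := cmpl_pi_surj b.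
apply: fps_eq => d; rewrite -rmorphB fps_coefB !(@ps_evalE _ _ d.+1) //=.
by rewrite rmorphB.
Qed.
Fact ps_eval_is_monoid_morphism : monoid_morphism ps_eval.
Proof.
split=> [|a b].
  rewrite -(rmorph1 (@cmpl_pi _ _)); apply: fps_eq => d.
  by rewrite (@ps_evalE _ _ d.+1) //= rmorph1.
have [u ->] := cmpl_pi_surj a; have [v ->] := cmpl_pi_surj b.
apply: fps_eq => d; rewrite -rmorphM (@ps_evalE _ _ d.+1) //= rmorphM !fps_coefM.
apply: eq_bigr => i _; have id : (i <= d)%N by rewrite -ltnS.
by rewrite -!(@ps_evalE _ _ d.+1) // ltnS leq_subr.
Qed.
HB.instance Definition _ := GRing.isZmodMorphism.Build _ _ ps_eval
  ps_eval_is_zmod_morphism.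
HB.instance Definition _ := GRing.isMonoidMorphism.Build _ _ ps_eval
  ps_eval_is_monoid_morphism.

Lemma ps_eval_of p : ps_eval (cmpl_of _ p) = pol_eval p.
Proof. by apply: fps_eq => d; rewrite (@ps_evalE _ _ d.+1). Qed.

Lemma ps_evalX i : ps_eval (psX i) = f i.
Proof. by rewrite ps_eval_of pol_evalX. Qed.

Lemma ps_evalC c : ps_eval (psC I c) = fpsC (iota c).
Proof. by rewrite ps_eval_of pol_evalC. Qed.

Lemma ps_eval_vanish k a : cmpl_proj k a = 0 -> fps_vanish k (ps_eval a).
Proof.
have [u ->] := cmpl_pi_surj a; rewrite cmpl_projE => /quot_pi0 uk d dk.
by rewrite (ps_evalE _ dk) (pol_eval_vanish iota f0 uk).
Qed.

Lemma ps_eval_proj k d a b : cmpl_proj k a = cmpl_proj k b -> (d < k)%N ->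
  ps_eval a d = ps_eval b d.
Proof.
move=> ab; apply: fps_coef_eq; rewrite -rmorphB; apply: ps_eval_vanish.
by rewrite rmorphB /= ab subrr.
Qed.

End SeriesEvaluation.

(** For a formal group law, row 0 is that of [F(0, y) = y], and every other term has a factor [x].
    This is what allows [F(x, y) = 0] to be solved for [y] by successive approximations. *)
Lemma sum_row0 (T : comPzRingType) (C : nat -> nat -> T) (x y : T) m :
  (forall j, C 0%N j = (j == 1%N)%:R) ->
  \sum_(i < m.+2) \sum_(j < m.+2) C i j * (x ^+ i * y ^+ j) =
  y + \sum_(i < m.+1) \sum_(j < m.+2) C i.+1 j * (x ^+ i.+1 * y ^+ j).
Proof.
move=> C0; rewrite big_ord_recl; congr (_ + _).
rewrite (bigD1 (lift ord0 ord0)) //= C0 mul1r expr0 mul1r expr1 big1 ?addr0 //.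
move=> j j1; rewrite C0; case: eqP => [e1|_]; last by rewrite mul0r.
by case/eqP: j1; apply: val_inj.
Qed.

(** * The formal group law on power series without constant term *)

Definition fps2_partial (R A : comNzRingType) (iota : {rmorphism R -> A})
    (F : fgl R) (a b : fps A) m : fps A :=
  \sum_(i < m) \sum_(j < m) fpsC (iota (F i j)) * (a ^+ i * b ^+ j).

HB.lock Definition fgl_add (R A : comNzRingType) (iota : {rmorphism R -> A})
    (F : fgl R) (a b : fps A) : fps A :=
  Fps (fun d => fps2_partial iota F a b d.+1 d).

Section FormalGroup.
Context (R A : comNzRingType) (iota : {rmorphism R -> A}) (F : fgl R).
Implicit Types a b c : fps A.

Local Notation fps2_partial := (fps2_partial iota F).
Local Notation fgl_add := (fgl_add iota F).

Lemma fps2_term_vanish a b i j k : a 0%N = 0 -> b 0%N = 0 ->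
  (k <= i)%N || (k <= j)%N ->
  fps_vanish k (fpsC (iota (F i j)) * (a ^+ i * b ^+ j)).
Proof.
move=> a0 b0 h; apply: fps_vanishMl; case/orP: h => h; last first.
  by apply: fps_vanishMl; apply: fps_vanish_le h _; apply: fps_vanishX.
by rewrite mulrC; apply: fps_vanishMl; apply: fps_vanish_le h _; apply: fps_vanishX.
Qed.

Lemma fgl_addE a b d m : a 0%N = 0 -> b 0%N = 0 -> (d < m)%N ->
  fgl_add a b d = fps2_partial a b m d.
Proof.
move=> a0 b0 dm; rewrite unlock /= /fps2_partial !fps_coef_sum.
under eq_bigr do rewrite fps_coef_sum.
under [RHS]eq_bigr do rewrite fps_coef_sum.
pose E i j := (fpsC (iota (F i j)) * (a ^+ i * b ^+ j)) d.
apply/esym/(@sum_square_trunc _ E) => // i j h.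
exact: fps2_term_vanish h _ (ltnSn d).
Qed.

Lemma fgl_addC a b : fgl_add a b = fgl_add b a.
Proof.
apply: fps_eq => d; rewrite unlock /= /fps2_partial exchange_big; congr (fps_coef _ d).
by apply: eq_bigr => i _; apply: eq_bigr => j _; rewrite fglC [a ^+ _ * _]mulrC.
Qed.

(** Evaluation is continuous: the coefficient of degree [d] can be read on a partial sum far enough,
    where only ring operations occur. *)
Lemma ps2_eval_evals (I : choiceType) (f : I -> fps A) (f0 : forall i, f i 0%N = 0)
    (a b : pseries R I) :
  cmpl_proj 1 a = 0 -> cmpl_proj 1 b = 0 ->
  ps_eval iota f (ps2_eval F a b) = fgl_add (ps_eval iota f a) (ps_eval iota f b).
Proof.
move=> a0 b0; apply: fps_eq => d.
have [N hN] := ps2_cvg F a0 b0 d.+1.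
rewrite -(ps_eval_proj iota f0 (hN (maxn N d.+1) (leq_maxl _ _))) //.
rewrite (@fgl_addE _ _ d (maxn N d.+1)) ?leq_maxr //; first last.
- exact: (ps_eval_vanish iota f0 b0).
- exact: (ps_eval_vanish iota f0 a0).
congr (fps_coef _ d); rewrite [LHS]rmorph_sum; apply: eq_bigr => i _.
rewrite rmorph_sum; apply: eq_bigr => j _.
by rewrite !rmorphM !rmorphXn /= ps_evalC.
Qed.

Lemma fgl_add_coef0 a b : a 0%N = 0 -> b 0%N = 0 -> fgl_add a b 0%N = 0.
Proof.
move=> a0 b0; rewrite (@fgl_addE _ _ 0 1) // /fps2_partial !big_ord_recl !big_ord0 !addr0 fps_coefCM.
by rewrite !expr0 mulr1 fglx0 rmorph0 mul0r.
Qed.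

Lemma fgl_add0 a : a 0%N = 0 -> fgl_add a 0 = a.
Proof.
move=> a0; apply: fps_eq => d.
rewrite (@fgl_addE _ _ d d.+2) ?fps_coef0 //; congr (fps_coef _ d).
rewrite /fps2_partial (bigD1 (lift ord0 ord0)) //= big_ord_recl.
rewrite fglx0 eqxx !rmorph1 mul1r expr1 expr0 mulr1.
rewrite [X in _ + X + _]big1 ?addr0 => [|j _]; last by rewrite expr0n !mulr0.
rewrite big1 ?addr0 // => i /negP i1; apply: big1 => -[[|j] jlt] _ /=.
  rewrite fglx0; case: eqP => [e|_]; last by rewrite !rmorph0 mul0r.
  by case: i1; apply/eqP/val_inj.
by rewrite expr0n !mulr0.
Qed.

Lemma ps2_eval_proj1 (I : choiceType) (x y : pseries R I) :
  cmpl_proj 1 x = 0 -> cmpl_proj 1 y = 0 -> cmpl_proj 1 (ps2_eval F x y) = 0.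
Proof.
move=> x0 y0; have [N hN] := ps2_cvg F x0 y0 1%N.
rewrite -(hN (maxn N 1) (leq_maxl _ _)) /ps2_partial.
rewrite rmorph_sum big1 // => i _; rewrite rmorph_sum big1 // => j _.
rewrite !rmorphM !rmorphXn /= x0 y0 !expr0n.
case: (val i) => [|i'] /=; last by rewrite mul0r mulr0.
case: (val j) => [|j'] /=; last by rewrite !mulr0.
suff -> : psC I (F 0%N 0%N) = 0 by rewrite rmorph0 mul0r.
by rewrite fglx0 /psC [malgC _](raddf0 (@malgC {cmonom I} R)) rmorph0.
Qed.

Lemma ps2_eval_assoc (I : choiceType) (f : I -> fps A) (x y z : I) :
  (forall i, f i 0%N = 0) ->
  ps2_eval F (ps2_eval F (psX x) (psX y)) (psX z) =
  ps2_eval F (psX x) (ps2_eval F (psX y) (psX z)) ->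
  fgl_add (fgl_add (f x) (f y)) (f z) = fgl_add (f x) (fgl_add (f y) (f z)).
Proof.
move=> f0 xyz; rewrite -!(ps_evalX iota f0).
have X0 i : cmpl_proj 1 (psX i : pseries R I) = 0 by exact: psX_proj1.
have ev := @ps2_eval_evals I f f0; pose e i := ps_eval iota f (psX i).
apply: etrans (congr1 (fgl_add^~ (e z)) (esym (ev _ _ (X0 x) (X0 y)))) _.
apply: etrans (esym (ev _ _ (ps2_eval_proj1 (X0 x) (X0 y)) (X0 z))) _.
apply: etrans (congr1 (ps_eval iota f) xyz) _.
apply: etrans (ev _ _ (X0 x) (ps2_eval_proj1 (X0 y) (X0 z))) _.
have yz := congr1 (fgl_add (e x)) (ev _ _ (X0 y) (X0 z)); exact: yz.
Qed.

(** The associativity axiom is an identity between series in three variables; evaluating these at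
    [a], [b] and [c] transports it. *)
Lemma fgl_addA a b c : a 0%N = 0 -> b 0%N = 0 -> c 0%N = 0 ->
  fgl_add (fgl_add a b) c = fgl_add a (fgl_add b c).
Proof.
move=> a0 b0 c0; pose f (i : 'I_3) := [:: a; b; c]`_i.
have f0 i : f i 0%N = 0 by case: i => -[|[|[|]]].
exact: (ps2_eval_assoc f0 (fglA F)).
Qed.

(** In [F(a, b) = b + ...] all the remaining terms are divisible by [a]. Changing [b] by [c] alters
    them by multiples of [a * c], whose order exceeds that of [c]. *)
Lemma fgl_add_approx a b c k : a 0%N = 0 -> b 0%N = 0 -> (0 < k)%N ->
  fps_vanish k c -> fps_vanish k.+1 (fgl_add a (b - c) - (fgl_add a b - c)).
Proof.
move=> a0 b0 k0 ck d dk; rewrite !fps_coefB.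
have bc0 : (b - c) 0%N = 0 by rewrite fps_coefB b0 ck ?subr0.
have dk2 : (d < k.+2)%N by exact: ltnW.
rewrite (fgl_addE a0 bc0 dk2) (fgl_addE a0 b0 dk2) -!fps_coefB.
suff: fps_vanish k.+1 (fps2_partial a (b - c) k.+2 - (fps2_partial a b k.+2 - c)).
  exact.
pose S e := \sum_(i < k.+1) \sum_(j < k.+2) fpsC (iota (F i.+1 j)) * (a ^+ i.+1 * e ^+ j).
have partialE e : fps2_partial a e k.+2 = e + S e.
  rewrite /fps2_partial (sum_row0 _ _ _ (C := fun i j => fpsC (iota (F i j)))) //.
  by move=> j; rewrite fglC fglx0 !rmorph_nat.
have -> : fps2_partial a (b - c) k.+2 - (fps2_partial a b k.+2 - c) = S (b - c) - S b.
  rewrite !partialE; ring.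
rewrite -sumrB; apply: fps_vanish_sum => i _; rewrite -sumrB.
apply: fps_vanish_sum => j _; rewrite -!mulrBr.
apply: fps_vanishMl; rewrite exprSr -mulrA; apply: fps_vanishMl.
apply: (@fps_vanishM _ 1 k); first by case.
rewrite subrXX mulrC; apply: fps_vanishMl.
by rewrite addrAC subrr add0r; apply: fps_vanishN.
Qed.

Lemma fgl_add_local a b b' k : a 0%N = 0 -> b 0%N = 0 -> (0 < k)%N ->
  fps_vanish k (b - b') -> fps_vanish k (fgl_add a b - fgl_add a b').
Proof.
move=> a0 b0 k0 bb'; have := fgl_add_approx a0 b0 k0 bb'.
rewrite subKr => h; have {}h := fps_vanish_le (leqnSn k) h.
have -> : fgl_add a b - fgl_add a b' =
  (b - b') - (fgl_add a b' - (fgl_add a b - (b - b'))) by ring.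
exact: fps_vanishB.
Qed.

(** Iterating [b |-> b - F(a, b)] from 0 makes [F(a, b)] gain one order at each step, by
    [fgl_add_approx]. The coefficient of degree [d] is stationary from stage [d] on, and the limit
    is the diagonal. *)
Lemma fgl_inverse a : a 0%N = 0 -> exists2 b : fps A, b 0%N = 0 & fgl_add a b = 0.
Proof.
move=> a0; pose bs : nat -> fps A := fix bs k := if k is k.+1 then bs k - fgl_add a (bs k) else 0.
have bsS k : bs k.+1 = bs k - fgl_add a (bs k) by [].
have bs0 k : bs k 0%N = 0.
  elim: k => [|k IH]; first exact: fps_coef0.
  by rewrite bsS fps_coefB IH fgl_add_coef0 ?subr0.
have Fbs k : fps_vanish k.+1 (fgl_add a (bs k)).
  elim: k => [|k IH]; first by move=> -[|//] _; rewrite fgl_add_coef0 ?bs0.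
  have := @fgl_add_approx a (bs k) _ k.+1 a0 (bs0 k) isT IH.
  by rewrite subrr subr0.
have bsE d m : (d <= m)%N -> bs m d = bs d d.
  elim: m => [|m IH]; first by rewrite leqn0 => /eqP ->.
  rewrite leq_eqVlt => /predU1P [->//|dm].
  by rewrite -IH // bsS fps_coefB Fbs ?subr0.
pose b := Fps (fun d => bs d d); exists b; first exact: bs0.
apply: fps_eq => d; rewrite fps_coef0 -[RHS](Fbs d d) //.
apply: (@fps_coef_eq _ d.+1) => //; apply: fgl_add_local => //.
by move=> e ed; rewrite fps_coefB /b /= (@bsE e d) ?subrr.
Qed.

End FormalGroup.

(* The power series without constant term, with [F] as addition. *)
Record fgroup (R A : comNzRingType) (iota : {rmorphism R -> A}) (F : fgl R) :=
  FGroup { fgval :> fps A; fgvalP : fgval 0%N == 0 }.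

Section FormalGroupZmod.
Context (R A : comNzRingType) (iota : {rmorphism R -> A}) (F : fgl R).
Local Notation G := (fgroup iota F).
HB.instance Definition _ := [isSub for @fgval R A iota F].
HB.instance Definition _ := [Choice of G by <:].
Implicit Types x y : G.

Lemma fgval0 x : x 0%N = 0. Proof. exact/eqP/fgvalP. Qed.

Fact fg_add_subproof x y : fgl_add iota F x y 0%N == 0.
Proof. by rewrite fgl_add_coef0 ?fgval0. Qed.
Definition fg_add x y : G := FGroup iota F (fg_add_subproof x y).

Fact fg_zero_subproof : (0 : fps A) 0%N == 0.
Proof. by rewrite fps_coef0. Qed.
Definition fg_zero : G := FGroup iota F fg_zero_subproof.

Fact fg_opp_subproof x : exists y : G, fg_add y x = fg_zero.
Proof.
have [b b0 e] := fgl_inverse iota F (fgval0 x).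
move/eqP: b0 => b0; exists (FGroup iota F b0); apply: val_inj => /=.
by rewrite fgl_addC.
Qed.
Definition fg_opp x : G := sval (cid (fg_opp_subproof x)).

Fact fg_addA : associative fg_add.
Proof. by move=> x y z; apply: val_inj; rewrite /= fgl_addA ?fgval0. Qed.
Fact fg_addC : commutative fg_add.
Proof. by move=> x y; apply: val_inj; rewrite /= fgl_addC. Qed.
Fact fg_add0 : left_id fg_zero fg_add.
Proof. by move=> x; apply: val_inj; rewrite /= fgl_addC fgl_add0 ?fgval0. Qed.
Fact fg_addN : left_inverse fg_zero fg_opp fg_add.
Proof. by move=> x; rewrite /fg_opp; case: cid. Qed.
HB.instance Definition _ :=
  GRing.isZmodule.Build G fg_addA fg_addC fg_add0 fg_addN.

Lemma fgvalD x y : fgval (x + y) = fgl_add iota F x y. Proof. by []. Qed.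
Definition fg_coef1 x : A := x 1%N.

(** [F(x, y) = x + y] up to terms of order 2. *)
Fact fg_coef1D x y : fg_coef1 (x + y) = fg_coef1 x + fg_coef1 y.
Proof.
have F01 : F 0%N 1%N = 1 by rewrite fglC fglx0.
have E : fps2_partial iota F x y 2 =
    fgval y + (fgval x + fpsC (iota (F 1 1)%N) * (fgval x * fgval y)).
  rewrite /fps2_partial !big_ord_recl !big_ord0 !addr0 /= !fglx0 F01 /=.
  by rewrite !rmorph0 !rmorph1 !expr0 !expr1 mul0r !mul1r mulr1 add0r.
rewrite /fg_coef1 fgvalD (fgl_addE iota F (fgval0 x) (fgval0 y) (ltnSn 1)) E.
rewrite !fps_coefD fps_coefCM fps_coefM !big_ord_recl big_ord0 !fgval0.
by rewrite !(mul0r, mulr0, addr0) addrC.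
Qed.
Fact fg_coef1_is_zmod_morphism : zmod_morphism fg_coef1.
Proof.
move=> x y; apply/eqP; rewrite eq_sym subr_eq -fg_coef1D.
by rewrite subrK.
Qed.
HB.instance Definition _ := GRing.isZmodMorphism.Build G A fg_coef1
  fg_coef1_is_zmod_morphism.

Fact fgX_subproof a : fpsX1 (a : A) 0%N == 0. Proof. by []. Qed.
Definition fgX (a : A) : G := FGroup iota F (fgX_subproof a).

End FormalGroupZmod.

(** * Evaluation of the formal group algebra *)

Section MvpolyTheory.
Context (R : comNzRingType) (I : choiceType).

Lemma mvpoly_ind (P : mvpoly R I -> Prop) :
  (forall c, P (malgC c)) -> (forall i, P (polX R i)) ->
  (forall p q, P p -> P q -> P (p + q)) ->
  (forall p q, P p -> P q -> P (p * q)) -> forall p, P p.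
Proof.
move=> PC PX PD PM p.
have Pm k (m : {cmonom I}) : mdeg m = k -> P << m >>.
  elim: k m => [|k IH] m mk; first by rewrite (mdeg_eq0I mk); apply: PC.
  have /fset0Pn [i im] : finsupp m != fset0.
    by apply: contra_eq_neq mk => m0; rewrite mdegE m0 big_seq_fset0.
  have me : m = mmul (ucm i) (divcm m (ucm i)).
    apply/eqP/cmP => j; rewrite cmM divcmE ucmE; case: eqP => [<-|_].
      by rewrite subnKC // lt0n cmE_neq0.
    by rewrite add0n subn0.
  have -> : << m >> = polX R i * << divcm m (ucm i) >> :> mvpoly R I.
    by rewrite {1}me /polX [RHS]malgM_def fgmulUU mulr1.
  apply: PM => //; apply: IH; apply: succn_inj.
  by rewrite -mk {2}me mdegM mdegU.
rewrite [p]monalgE; elim/big_ind: _ => [||m _]; [|exact: PD|].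
  by have := PC 0; rewrite [malgC _](raddf0 (@malgC {cmonom I} R)).
have -> : << monalg.mcoeff m p *g m >> =
    malgC (monalg.mcoeff m p) * << m >> :> mvpoly R I.
  by rewrite [RHS]malgM_def fgmulUU mulr1 mul1m.
by apply: PM; [exact: PC|exact: Pm].
Qed.

Lemma eq_mvpoly_rmorph (T : pzRingType) (f g : {rmorphism mvpoly R I -> T}) :
  (forall c, f (malgC c) = g (malgC c)) -> (forall i, f (polX R i) = g (polX R i)) ->
  f =1 g.
Proof.
move=> fgC fgX; elim/mvpoly_ind => [//|//|p q fp fq|p q fp fq].
  by rewrite !rmorphD fp fq.
by rewrite !rmorphM fp fq.
Qed.

End MvpolyTheory.

Section FgaEval.
Context (R : comNzRingType) (F : fgl R).
Context (K : realType) (n : nat) (A : gcm n) (D : root_datum K A).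
Context (L : demazure_lattice D).
Local Notation Lam := (lattice_elt L).
Local Notation S := (fga F L).

Fact lattice_act_is_zmod_morphism w : zmod_morphism (@lattice_act K n A D L w).
Proof.
move=> x y; apply/eqP; rewrite eq_sym subr_eq -lattice_actD.
by rewrite subrK.
Qed.
HB.instance Definition _ w := GRing.isZmodMorphism.Build Lam Lam
  (lattice_act w) (lattice_act_is_zmod_morphism w).

Context (B : comNzRingType) (iota : {rmorphism R -> B}).
Local Notation G := (fgroup iota F).

Section Eval.
Variable g : {additive Lam -> G}.

Let f la : fps B := fgval (g la).
Let f0 la : f la 0%N = 0. Proof. exact: fgval0. Qed.

(** The universal property of [fga]: additivity of [g] for the group law [F] kills the generators,
    hence the ideal. It also kills the closure, since each coefficient depends only on a class
    modulo some neighbourhood of 0. *)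
Lemma fga_ideal_eval (u : pseries R Lam) : fga_ideal F L u -> ps_eval iota f u = 0.
Proof.
move=> uJ; apply: fps_eq => d; rewrite fps_coef0.
have [v Jv uv] := uJ d.+1; rewrite (ps_eval_proj iota f0 uv) //.
suff -> : ps_eval iota f v = 0 by rewrite fps_coef0.
apply: (Jv (ideal_ker (ps_eval iota f : {rmorphism _ -> _}))) => _ [->|[la [mu ->]]] /=.
  by rewrite ps_evalX // /f raddf0.
pose e : pseries R Lam -> fps B := ps_eval iota f.
have X0 := @psX_proj1 R Lam.
have e1 : e (psX (la + mu)) = f (la + mu) := ps_evalX iota f0 _.
have e2 := ps2_eval_evals iota F f0 (X0 la) (X0 mu).
apply: etrans (rmorphB (ps_eval iota f) _ _) _.
have e3 : fgl_add iota F (e (psX la)) (e (psX mu)) = f (la + mu).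
  apply: etrans (congr2 (fgl_add iota F) (ps_evalX iota f0 la) (ps_evalX iota f0 mu)) _.
  by rewrite /f raddfD fgvalD.
apply: etrans (congr2 (fun a b => a - b) e1 (etrans e2 e3)) _.
exact: subrr.
Qed.

Definition fga_eval (s : S) : fps B := ps_eval iota f (repr s).

Lemma fga_evalE u : fga_eval (quot_pi (fga_ideal F L) u) = ps_eval iota f u.
Proof.
apply/eqP; rewrite -subr_eq0 -rmorphB; apply/eqP/fga_ideal_eval.
exact: quot_repr.
Qed.

Fact fga_eval_is_zmod_morphism : zmod_morphism fga_eval.
Proof.
move=> a b; have [x ->] := quot_pi_surj a; have [y ->] := quot_pi_surj b.
by rewrite -rmorphB !fga_evalE !rmorphB.
Qed.
Fact fga_eval_is_monoid_morphism : monoid_morphism fga_eval.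
Proof.
split=> [|a b].
  by rewrite -(rmorph1 (quot_pi (fga_ideal F L))) fga_evalE rmorph1.
have [x ->] := quot_pi_surj a; have [y ->] := quot_pi_surj b.
by rewrite -rmorphM !fga_evalE !rmorphM.
Qed.
HB.instance Definition _ := GRing.isZmodMorphism.Build S (fps B) fga_eval
  fga_eval_is_zmod_morphism.
HB.instance Definition _ := GRing.isMonoidMorphism.Build S (fps B) fga_eval
  fga_eval_is_monoid_morphism.

Lemma fga_evalX la : fga_eval (fgaX F la) = g la.
Proof. by rewrite fga_evalE ps_evalX. Qed.

End Eval.

(** Each coefficient is computed on a polynomial, where it suffices to compare both sides on the
    variables. For [g] invariant under [w], the evaluation becomes invariant under [w]. *)
Lemma fga_eval_act (g g' : {additive Lam -> G}) w s :
  (forall la, g (lattice_act w la) = g' la) ->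
  fga_eval g (fga_act F L w s) = fga_eval g' s.
Proof.
move=> gg'; have [u ->] := quot_pi_surj s; rewrite [X in fga_eval g X]quot_mapE.
rewrite !fga_evalE; have [a ->] := cmpl_pi_surj u.
have g0 (h : {additive Lam -> G}) la : fgval (h la) 0%N = 0 by exact: fgval0.
apply: fps_eq => d; rewrite [ps_rename _ _]cmpl_mapE.
rewrite !(ps_evalE iota _ _ (ltnSn d)) //.
congr (fps_coef _ d); rewrite /=.
pose r1 : {rmorphism mvpoly R Lam -> fps B} :=
  pol_eval iota (fun la => fgval (g la)) \o pol_rename R (lattice_act w).
apply: (@eq_mvpoly_rmorph _ _ _ r1 (pol_eval iota (fun la => fgval (g' la)))).
  by move=> c; rewrite /= [pol_rename _ _ _]pol_renameC !pol_evalC.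
by move=> la; rewrite /= [pol_rename _ _ _]pol_renameX !pol_evalX gg'.
Qed.

End FgaEval.

(** * The formal group algebra as a power series ring *)

Section BasisEval.
Context (R : idomainType) (F : fgl R).
Context (K : realType) (n : nat) (A : gcm n) (D : root_datum K A).
Context (L : demazure_lattice D).
Local Notation Lam := (lattice_elt L).
Local Notation S := (fga F L).
Context (b : seq (dual (rd_h D))) (hb : zbasis (dl_lattice L) b).
Local Notation r := (size b).
Local Notation B := (mpoly r R).
Local Notation iota := (@mpolyC r R).
Local Notation G := (fgroup iota F).

Fact basis_elt_subproof (j : 'I_r) : b`_j \in dl_lattice L.
Proof. by have [bL _ _] := hb; apply/bL/mem_nth. Qed.
Definition basis_elt (j : 'I_r) : Lam := LatticeElt (basis_elt_subproof j).

Fact lattice_val_is_zmod_morphism : zmod_morphism (@lattice_val K n A D L).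
Proof. by []. Qed.
HB.instance Definition _ := GRing.isZmodMorphism.Build Lam _ (@lattice_val K n A D L)
  lattice_val_is_zmod_morphism.

Lemma basis_val (c : 'I_r -> int) :
  lattice_val (\sum_j basis_elt j *~ c j) = \sum_(j < r) b`_j *~ c j.
Proof.
by rewrite raddf_sum; apply: eq_bigr => j _; rewrite raddfMz.
Qed.

Lemma basis_span (la : Lam) : exists c : 'I_r -> int,
  la = \sum_j basis_elt j *~ c j.
Proof.
have [_ span _] := hb; have [c e] := span _ (lattice_valP la).
by exists c; apply: val_inj; rewrite [RHS]basis_val.
Qed.

Definition basis_coord (la : Lam) : 'I_r -> int := sval (cid (basis_span la)).

Lemma basis_coordK la : \sum_j basis_elt j *~ basis_coord la j = la.
Proof. by rewrite /basis_coord; case: cid. Qed.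

Lemma basis_coord_sum (c : 'I_r -> int) j : basis_coord (\sum_j basis_elt j *~ c j) j = c j.
Proof.
have [_ _ free] := hb; set la := \sum_j _.
apply/eqP; rewrite -subr_eq0; apply/eqP.
apply: (free (fun j => basis_coord la j - c j)).
under eq_bigr do rewrite mulrzBr.
by rewrite sumrB -!basis_val basis_coordK subrr.
Qed.

Lemma basis_coordB la mu j : basis_coord (la - mu) j = basis_coord la j - basis_coord mu j.
Proof.
rewrite -(basis_coord_sum (fun j => basis_coord la j - basis_coord mu j)); congr (basis_coord _ j).
under [RHS]eq_bigr do rewrite mulrzBr.
by rewrite sumrB !basis_coordK.
Qed.

Lemma basis_coord_elt i j : basis_coord (basis_elt i) j = (i == j)%:R.
Proof.
rewrite -(basis_coord_sum (fun j => (i == j)%:R)); congr (basis_coord _ j).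
rewrite (bigD1 i) //= eqxx mulr1z big1 ?addr0 // => k /negbTE ki.
by rewrite eq_sym ki mulr0z.
Qed.

(* [fga_eval (basis_eval t)] sends [x_(b_j)] to [t_j T].  For [t_j = 'X_j] the
   coefficient of [T^d] is the homogeneous part of degree [d], which identifies
   [fga] with the power series in [size b] variables. *)
Definition basis_eval (t : 'I_r -> B) (la : Lam) : G :=
  \sum_j fgX iota F (t j) *~ basis_coord la j.

Fact basis_eval_is_zmod_morphism t : zmod_morphism (basis_eval t).
Proof.
move=> la mu; rewrite -sumrB; apply: eq_bigr => j _.
by rewrite basis_coordB mulrzBr.
Qed.
HB.instance Definition _ t := GRing.isZmodMorphism.Build Lam G (basis_eval t)
  (basis_eval_is_zmod_morphism t).

Lemma basis_eval_basis t j : basis_eval t (basis_elt j) = fgX iota F (t j).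
Proof.
rewrite /basis_eval (bigD1 j) //= basis_coord_elt eqxx mulr1z big1 ?addr0 // => k.
by rewrite basis_coord_elt eq_sym => /negbTE ->; rewrite mulr0z.
Qed.

Lemma basis_eval_coef1 t la :
  fg_coef1 (basis_eval t la) = \sum_j t j *~ basis_coord la j.
Proof. by rewrite raddf_sum; apply: eq_bigr => j _; rewrite raddfMz. Qed.

Definition poly_series : {rmorphism B -> mvpoly R Lam} :=
  mpoly.mmap (@malgC {cmonom Lam} R) (fun j => polX R (basis_elt j)).

Definition fga_poly : {rmorphism B -> S} :=
  quot_pi (fga_ideal F L) \o (cmpl_of (aug_ideal R Lam) \o poly_series).

Lemma poly_seriesE p : poly_series p =
  \sum_(m <- mpoly.msupp p) malgC p@_m * \prod_j polX R (basis_elt j) ^+ m j.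
Proof. by []. Qed.

Lemma fga_polyX j : fga_poly 'X_j = fgaX F (basis_elt j).
Proof.
congr (quot_pi _ (cmpl_of _ _)); rewrite /poly_series /= mmapX.
exact: mmap1U.
Qed.

Lemma fga_polyC c : fga_poly (mpolyC r c) = fgaC F L c.
Proof. by congr (quot_pi _ (cmpl_of _ _)); exact: mpoly.mmapC. Qed.

Lemma prod_fpsX1 (t : 'I_r -> B) (m : multinom r) :
  \prod_j fpsX1 (t j) ^+ m j = fpsXn (mpoly.mdeg m) (\prod_j t j ^+ m j).
Proof.
rewrite mpoly.mdegE; elim: (index_enum _) => [|j s IH].
  by rewrite !big_nil; apply: fps_eq.
by rewrite !big_cons IH fpsXnX mul1n fpsXnM.
Qed.

(** The variable of index [j] becomes [t_j T], so a monomial of degree [e] only contributes to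
    [T^e]. *)
Lemma fga_eval_poly t p d :
  fga_eval (basis_eval t) (fga_poly p) d =
  mpoly.mmap iota t (pihomog mpoly.mdeg d p).
Proof.
rewrite [fga_eval _ _]fga_evalE ps_eval_of; last by move=> la; exact: fgval0.
rewrite poly_seriesE rmorph_sum fps_coef_sum pihomogE raddf_sum [RHS]big_mkcond.
apply: eq_bigr => m _.
transitivity ((fpsC (iota p@_m) * \prod_j fpsX1 (t j) ^+ m j) d).
  congr (fps_coef _ d); rewrite rmorphM; congr (_ * _); first exact: pol_evalC.
  rewrite rmorph_prod; apply: eq_bigr => j _; rewrite rmorphXn; congr (_ ^+ _).
  by rewrite [LHS]pol_evalX /= basis_eval_basis.
rewrite fps_coefCM prod_fpsX1 /= eq_sym.
by case: eqP => _; rewrite ?mulr0 // [RHS]mpoly.mmapZ mpoly.mmapX.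
Qed.

End BasisEval.

(** * Density of the polynomials in the basis variables *)

Lemma ideal_powM (P : comPzRingType) (I : ideal P) k m x y :
  ideal_pow I k x -> ideal_pow I m y -> ideal_pow I (k + m)%N (x * y).
Proof.
elim: k x => [|k IH] x Ix Iy; first exact: idealM.
have h0 : ideal_pow I (k.+1 + m)%N (0 * y) by rewrite mul0r; apply: ideal0.
have hD a b : ideal_pow I (k.+1 + m)%N (a * y) -> ideal_pow I (k.+1 + m)%N (b * y) ->
    ideal_pow I (k.+1 + m)%N ((a + b) * y).
  by rewrite mulrDl; apply: (@idealD _ (ideal_pow I (k.+1 + m)%N)).
have hM a b : ideal_pow I (k.+1 + m)%N (b * y) -> ideal_pow I (k.+1 + m)%N (a * b * y).
  by rewrite -mulrA; apply: (@idealM _ (ideal_pow I (k.+1 + m)%N)).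
apply: (Ix (@Ideal P [set x | ideal_pow I (k.+1 + m)%N (x * y)] h0 hD hM)).
move=> _ [a [c [Ia Ic ->]]] /=; rewrite -mulrA; apply: ideal_powS => //.
exact: IH.
Qed.

Lemma cmpl_projM_eq0 (P : comPzRingType) (I : ideal P) k m (u v : completion I) :
  cmpl_proj k u = 0 -> cmpl_proj m v = 0 -> cmpl_proj (k + m)%N (u * v) = 0.
Proof.
have [a ->] := cmpl_pi_surj u; have [b ->] := cmpl_pi_surj v.
rewrite -rmorphM !cmpl_projE => ak bm; apply/quot_pi0 => /=; apply: ideal_powM.
  by apply/quot_pi0; rewrite (aproj_le a (leq_addr m k)).
by apply/quot_pi0; rewrite (aproj_le b (leq_addl k m)).
Qed.

Section Approximation.
Context (R : comNzRingType) (F : fgl R).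
Context (K : realType) (n : nat) (A : gcm n) (D : root_datum K A).
Context (L : demazure_lattice D).
Local Notation Lam := (lattice_elt L).
Local Notation S := (fga F L).
Local Notation J := (fga_ideal F L).

(** The image of the [k]-th neighbourhood of 0 of the completion, that is, the quotient topology on
    [S]. *)
Definition fga_small k (s : S) : Prop :=
  exists2 u : pseries R Lam, s = quot_pi J u & cmpl_proj k u = 0.

Lemma fga_small0 s : fga_small 0 s.
Proof.
have [u ->] := quot_pi_surj s; exists u => //; have [a ->] := cmpl_pi_surj u.
by rewrite cmpl_projE; apply/quot_pi0.
Qed.
Lemma fga_smallD k s t : fga_small k s -> fga_small k t -> fga_small k (s + t).
Proof.
move=> [u -> uk] [v -> vk]; exists (u + v); first by rewrite rmorphD.
by rewrite rmorphD /= uk vk addr0.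
Qed.
Lemma fga_smallN k s : fga_small k s -> fga_small k (- s).
Proof.
move=> [u -> uk]; exists (- u); first by rewrite rmorphN.
by rewrite rmorphN /= uk oppr0.
Qed.
Lemma fga_smallB k s t : fga_small k s -> fga_small k t -> fga_small k (s - t).
Proof. by move=> sk /fga_smallN; apply: fga_smallD. Qed.
Lemma fga_smallM k m s t :
  fga_small k s -> fga_small m t -> fga_small (k + m)%N (s * t).
Proof.
move=> [u -> uk] [v -> vm]; exists (u * v); first by rewrite rmorphM.
exact: cmpl_projM_eq0.
Qed.
Lemma fga_smallMl k s t : fga_small k t -> fga_small k (s * t).
Proof. exact: (fga_smallM (fga_small0 s)). Qed.
Lemma fga_small_sum k (I : Type) (r : seq I) (P : pred I) (E : I -> S) :
  (forall i, P i -> fga_small k (E i)) ->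
  fga_small k (\sum_(i <- r | P i) E i).
Proof.
move=> h; elim/big_ind: _ => //; last exact: fga_smallD.
by exists 0; rewrite rmorph0.
Qed.
Lemma fga_small_le k m s : (k <= m)%N -> fga_small m s -> fga_small k s.
Proof. by move=> km [u -> um]; exists u => //; apply: cmpl_proj_eq0 um. Qed.

Lemma fgaX_small la : fga_small 1 (fgaX F la).
Proof. by exists (psX la) => //; apply: psX_proj1. Qed.

Lemma fga_eval_small (B : comNzRingType) (iota : {rmorphism R -> B})
    (g : {additive Lam -> fgroup iota F}) k s :
  fga_small k s -> fps_vanish k (fga_eval g s).
Proof.
move=> [u -> uk]; rewrite fga_evalE; apply: ps_eval_vanish uk => la.
exact: fgval0.
Qed.

Definition fga_partial_sum m la mu : S :=
  \sum_(i < m) \sum_(j < m) fgaC F L (F i j) * (fgaX F la ^+ i * fgaX F mu ^+ j).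

Lemma sub_fga_ideal f : fga_rel F f -> J f.
Proof. by move=> hf k; exists f => //; apply: sub_ideal_gen. Qed.

Lemma fgaX0 : fgaX F (0 : Lam) = 0.
Proof. by apply/quot_pi0/sub_fga_ideal; left. Qed.

Lemma fgaXD la mu : fgaX F (la + mu) = quot_pi J (ps2_eval F (psX la) (psX mu)).
Proof. by apply/quot_piP/sub_fga_ideal; right; exists la, mu. Qed.

(** The truncation index has the shape [m.+2] that [sum_row0] splits. *)
Lemma fgaX_add_approx la mu k : exists m,
  fga_small k (fgaX F (la + mu) - fga_partial_sum m.+2 la mu).
Proof.
have [N hN] := ps2_cvg F (psX_proj1 R la) (psX_proj1 R mu) k.
exists N; exists (ps2_eval F (psX la) (psX mu) - ps2_partial F (psX la) (psX mu) N.+2).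
  rewrite rmorphB fgaXD; congr (_ - _); rewrite [RHS]rmorph_sum.
  apply: eq_bigr => i _; rewrite rmorph_sum; apply: eq_bigr => j _.
  by rewrite !rmorphM !rmorphXn.
by rewrite rmorphB /= hN ?subrr // -addn2 leq_addr.
Qed.

End Approximation.

Lemma subr_prod (T : comPzRingType) (s t a b : T) :
  s * t - a * b = t * (s - a) + a * (t - b).
Proof. by ring. Qed.

Lemma addr_subl (V : zmodType) (y a c : V) : y + c = - (- (y + a)) - (a - c).
Proof. by rewrite opprK opprB addrACA subrr addr0. Qed.

Lemma mulrB_exp (T : comPzRingType) (a x y z : T) i j :
  exists c, a * (x ^+ i.+1 * y ^+ j) - a * (x ^+ i.+1 * z ^+ j) = c * (x * (y - z)).
Proof.
exists (a * x ^+ i * \sum_(k < j) y ^+ (j.-1 - k) * z ^+ k).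
by rewrite -!mulrBr subrXX exprSr; ring.
Qed.

Section Density.
Context (R : idomainType) (F : fgl R).
Context (K : realType) (n : nat) (A : gcm n) (D : root_datum K A).
Context (L : demazure_lattice D).
Local Notation Lam := (lattice_elt L).
Local Notation S := (fga F L).
Context (b : seq (dual (rd_h D))) (hb : zbasis (dl_lattice L) b).
Local Notation r := (size b).
Local Notation fga_poly := (fga_poly F hb).

Definition fga_approx k (s : S) : Prop := exists p, fga_small k (s - fga_poly p).

Lemma fga_approx_poly k p : fga_approx k (fga_poly p).
Proof. by exists p; rewrite subrr; exists 0; rewrite rmorph0. Qed.

Lemma fga_approxD k s t : fga_approx k s -> fga_approx k t -> fga_approx k (s + t).
Proof.
move=> [p sp] [q tq]; exists (p + q); rewrite rmorphD opprD addrACA.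
exact: (fga_smallD sp tq).
Qed.
Lemma fga_approxN k s : fga_approx k s -> fga_approx k (- s).
Proof. by move=> [p sp]; exists (- p); rewrite rmorphN -opprD; exact: (fga_smallN sp). Qed.
Lemma fga_approxM k s t : fga_approx k s -> fga_approx k t -> fga_approx k (s * t).
Proof.
move=> [p sp] [q tq]; exists (p * q).
rewrite (rmorphM fga_poly p q) (subr_prod s t (fga_poly p) (fga_poly q)).
exact: (fga_smallD (fga_smallMl t sp) (fga_smallMl _ tq)).
Qed.
Lemma fga_approx_sum k (I : Type) (e : seq I) (P : pred I) (E : I -> S) :
  (forall i, P i -> fga_approx k (E i)) ->
  fga_approx k (\sum_(i <- e | P i) E i).
Proof.
move=> h; elim/big_ind: _ => //; last exact: fga_approxD.
by rewrite -(rmorph0 fga_poly); apply: fga_approx_poly.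
Qed.
Lemma fga_approxX k s m : fga_approx k s -> fga_approx k (s ^+ m).
Proof.
move=> sk; elim: m => [|m IH]; last by rewrite exprS; apply: fga_approxM.
by rewrite expr0 -(rmorph1 fga_poly); apply: fga_approx_poly.
Qed.
Lemma fga_approxC k c : fga_approx k (fgaC F L c).
Proof. by rewrite -(fga_polyC F hb); apply: fga_approx_poly. Qed.
Lemma fga_approx_close k s t :
  fga_small k (s - t) -> fga_approx k t -> fga_approx k s.
Proof.
move=> st [p tp]; exists p; rewrite -(subrKA t).
exact: (fga_smallD st tp).
Qed.

Lemma fga_approxXD k la mu : fga_approx k (fgaX F la) ->
  fga_approx k (fgaX F mu) -> fga_approx k (fgaX F (la + mu)).
Proof.
move=> lak muk; have [m hm] := fgaX_add_approx F la mu k.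
apply: fga_approx_close hm _.
apply: fga_approx_sum => i _; apply: fga_approx_sum => j _.
apply: fga_approxM; first exact: fga_approxC.
by apply: fga_approxM; apply: fga_approxX.
Qed.

(* [0 = F(x, y)] gives [y = - \sum_(i > 0, j) F_ij x^i y^j], which determines
   [y] modulo terms of order [k + 1] from [x] and from [y] modulo order [k]. *)
Lemma fga_approxXN k la : (forall m, fga_approx m (fgaX F la)) ->
  fga_approx k (fgaX F (- la)).
Proof.
move=> lak; elim: k => [|k [p yp]]; first by exists 0; apply: fga_small0.
set x := fgaX F la in lak; set y := fgaX F (- la) in yp *.
have [m] := fgaX_add_approx F la (- la) k.+1.
rewrite subrr fgaX0 sub0r /fga_partial_sum -/x -/y.
pose T (z : S) := \sum_(i < m.+1) \sum_(j < m.+2)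
  fgaC F L (F i.+1 j) * (x ^+ i.+1 * z ^+ j).
have -> : \sum_(i < m.+2) \sum_(j < m.+2) fgaC F L (F i j) * (x ^+ i * y ^+ j) =
    y + T y.
  apply: (sum_row0 _ _ _ (C := fun i j => fgaC F L (F i j))) => j.
  rewrite fglC fglx0 -(fga_polyC F hb); case: eqP => _.
    by rewrite mpolyC1 rmorph1.
  by rewrite mpolyC0 rmorph0.
move=> yT; apply: (@fga_approx_close _ _ (- T (fga_poly p))); last first.
  apply: fga_approxN; apply: fga_approx_sum => i _; apply: fga_approx_sum => j _.
  apply: fga_approxM; first exact: fga_approxC.
  by apply: fga_approxM; apply: fga_approxX => //; apply: fga_approx_poly.
rewrite opprK (addr_subl y (T y) (T (fga_poly p))).
apply: (fga_smallB (fga_smallN yT)).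
rewrite -sumrB; apply: fga_small_sum => i _; rewrite -sumrB.
apply: fga_small_sum => j _.
have [c ->] := mulrB_exp (fgaC F L (F i.+1 j)) x y (fga_poly p) i j.
exact: (fga_smallMl c (fga_smallM (fgaX_small F la) yp)).
Qed.

Lemma fga_approxX_lattice k la : fga_approx k (fgaX F la).
Proof.
have P0 m : fga_approx m (fgaX F (0 : Lam)).
  by rewrite fgaX0 -(rmorph0 fga_poly); apply: fga_approx_poly.
have Pn la' : (forall m, fga_approx m (fgaX F la')) ->
    forall c m, fga_approx m (fgaX F (la' *+ c)).
  move=> h; elim=> [|c IH] m; first exact: P0.
  rewrite mulrS; exact: (fga_approxXD (h m) (IH m)).
rewrite -(basis_coordK hb la); move: k.
elim/big_ind: _ => [//|x y hx hy k|j _]; first exact: (fga_approxXD (hx k) (hy k)).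
have hj m : fga_approx m (fgaX F (basis_elt hb j)).
  by rewrite -fga_polyX; apply: fga_approx_poly.
case: (basis_coord hb la j) => c k; first exact: (Pn _ hj c k).
rewrite NegzE mulrNz; exact: (fga_approxXN k (Pn _ hj c.+1)).
Qed.

(** Modulo order [k], a term of a representing sequence replaces [s] by a polynomial in the [x_la],
    and each [x_la] is approximated through the formal group law from the basis variables. *)
Lemma fga_approx_all k s : fga_approx k s.
Proof.
have [u ->] := quot_pi_surj s; have [a ->] := cmpl_pi_surj u.
apply: (@fga_approx_close _ _ (quot_pi (fga_ideal F L) (cmpl_of _ (a k)))).
  exists (cmpl_pi a - cmpl_of _ (a k)); first by rewrite rmorphB.
  by rewrite rmorphB /= cmpl_projE cmpl_proj_of subrr.
move: (a k) => p; pose f : {rmorphism mvpoly R Lam -> S} :=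
  quot_pi (fga_ideal F L) \o cmpl_of (aug_ideal R Lam).
change (fga_approx k (f p)); elim/mvpoly_ind: p => [c|la|p q|p q].
- exact: fga_approxC.
- exact: fga_approxX_lattice.
- by move=> hp hq; rewrite rmorphD; exact: (fga_approxD hp hq).
- by move=> hp hq; rewrite rmorphM; exact: (fga_approxM hp hq).
Qed.

End Density.

(** * The isomorphism with power series, and reduction modulo one variable *)

Section SeriesIso.
Context (R : idomainType) (F : fgl R).
Context (K : realType) (n : nat) (A : gcm n) (D : root_datum K A).
Context (L : demazure_lattice D).
Local Notation Lam := (lattice_elt L).
Context (b : seq (dual (rd_h D))) (hb : zbasis (dl_lattice L) b).
Local Notation r := (size b).
Local Notation B := (mpoly r R).
Local Notation iota := (@mpolyC r R).
Local Notation fga_poly := (fga_poly F hb).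
Local Notation poly_series := (poly_series R hb).
Local Notation ev t := (fga_eval (basis_eval F hb t)).
Local Notation hom d := (pihomog mpoly.mdeg d).

Let X (j : 'I_r) : B := 'X_j.

Lemma mmap_id (p : B) : mpoly.mmap iota X p = p.
Proof.
rewrite [RHS]mpolyE; apply: eq_bigr => m _.
by rewrite mpoly.mmap1_id mul_mpolyC.
Qed.

Lemma ev_approx t s p d : fga_small d.+1 (s - fga_poly p) ->
  ev t s d = mpoly.mmap iota t (hom d p).
Proof.
move=> sp; rewrite -(fga_eval_poly F hb); apply: (@fps_coef_eq _ d.+1) => //.
rewrite -rmorphB; exact: (fga_eval_small _ sp).
Qed.

Lemma evX_approx s p d k : fga_small k (s - fga_poly p) -> (d < k)%N ->
  ev X s d = hom d p.
Proof.
move=> sp dk; have sp' := fga_small_le dk sp.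
by rewrite (ev_approx X sp') mmap_id.
Qed.

(** By density this is a statement about polynomials: evaluation at [t] is the generic evaluation
    followed by substitution of [t_j] for ['X_j]. *)
Lemma ev_specialize t s d : ev t s d = mpoly.mmap iota t (ev X s d).
Proof.
have [p sp] := fga_approx_all hb d.+1 s.
by rewrite (ev_approx t sp) (evX_approx sp).
Qed.

Lemma evX_homog s d : ev X s d \is d.-homog.
Proof.
have [p sp] := fga_approx_all hb d.+1 s.
by rewrite (evX_approx sp) //; apply: pihomogP.
Qed.

Lemma ideal_pow_sum (P : comPzRingType) (I : ideal P) k (T : eqType) (e : seq T)
    (E : T -> P) :
  (forall i, i \in e -> ideal_pow I k (E i)) -> ideal_pow I k (\sum_(i <- e) E i).
Proof.
move=> h; rewrite big_seq; elim/big_ind: _ => //; first exact: ideal0.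
exact: idealD.
Qed.

Lemma poly_series_homog d (p : B) : p \is d.-homog ->
  ideal_pow (aug_ideal R Lam) d (poly_series p).
Proof.
move=> /dhomogP ph; rewrite poly_seriesE; apply: ideal_pow_sum => m mp.
apply: idealM; rewrite -(ph m mp) /= mpoly.mdegE.
elim: (index_enum _) => [|j s IH]; first by rewrite !big_nil.
rewrite !big_cons; apply: ideal_powM IH; rewrite -[_ ^+ _]mulr1.
by apply: ideal_pow_exp => //; apply: augmentationX.
Qed.

(** The ideal defining [fga] is closed, so membership is tested modulo each neighbourhood. There [s]
    is a polynomial [p] whose homogeneous parts of degree less than [k] are coefficients of
    [ev X s], hence 0; so [p] lies in the [k]-th power of the augmentation ideal. *)
Lemma evX_inj s : ev X s = 0 -> s = 0.
Proof.
move=> s0; have [u us] := quot_pi_surj s; rewrite us; apply/quot_pi0 => k.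
have [p sp] := fga_approx_all hb k s; have [e se ek] := sp.
have pk : cmpl_proj k (cmpl_of (aug_ideal R Lam) (poly_series p)) = 0.
  rewrite cmpl_proj_of; apply/quot_pi0.
  (* A bound on the degree of [p], so that [p] is the sum of its homogeneous parts up to [N]. *)
  pose N := maxn k (mpoly.mmeasure mpoly.mdeg p).
  rewrite [p](@pihomog_partitionE _ _ mpoly.mdeg N) ?leq_maxr //.
  rewrite (rmorph_sum poly_series); apply: ideal_pow_sum => d _.
  have [dk|kd] := ltnP d k; last first.
    by apply: (ideal_pow_le kd); apply/poly_series_homog/pihomogP.
  by rewrite -(evX_approx sp dk) s0 fps_coef0 rmorph0; apply: ideal0.
have Jv : fga_ideal F L (u - cmpl_of _ (poly_series p) - e).
  apply/quot_pi0; rewrite !rmorphB /= -us -se /fga_poly /=.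
  exact: subrr.
have [v J0v vk] := Jv k; exists v => //.
by rewrite -vk !rmorphB /= pk ek !subr0.
Qed.

Lemma ev_poly t p : ev t (fga_poly p) =
  pol_eval iota (fun la => fgval (basis_eval F hb t la)) (poly_series p).
Proof.
rewrite [ev t _]fga_evalE; apply: ps_eval_of => la; exact: fgval0.
Qed.

Lemma evX_surj (P : nat -> B) : (forall d, P d \is d.-homog) ->
  exists s, ev X s = Fps P.
Proof.
move=> Ph; pose a k := \sum_(e < k) poly_series (P e).
have aP k : ideal_pow (aug_ideal R Lam) k (a k.+1 - a k).
  rewrite /a big_ord_recr /= addrAC subrr add0r; exact: poly_series_homog.
exists (quot_pi _ (cmpl_pi (AdicSeq aP))); apply: fps_eq => d.
rewrite fga_evalE (ps_evalE iota _ _ (ltnSn d)); last by move=> la; exact: fgval0.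
transitivity (\sum_(e < d.+1) mpoly.mmap iota X (hom d (P e))).
  rewrite /= /a rmorph_sum fps_coef_sum; apply: eq_bigr => e _.
  by rewrite -(fga_eval_poly F hb) ev_poly.
rewrite (bigD1 ord_max) //= mmap_id pihomog_dE // big1 ?addr0 // => e ed.
rewrite mmap_id (@pihomog_ne0 _ _ _ e) //.
Qed.

Section Kernel.
Variable j0 : 'I_r.
Let X0 (j : 'I_r) : B := if j == j0 then 0 else 'X_j.
Local Notation x := (fgaX F (basis_elt hb j0)).

Lemma mmap_X0_subr (p : B) : exists q, p - mpoly.mmap iota X0 p = 'X_j0 * q.
Proof.
pose f : {rmorphism B -> B} := mpoly.mmap iota X0.
pose P (p : B) := exists q, p - f p = 'X_j0 * q.
have PD p1 p2 : P p1 -> P p2 -> P (p1 + p2).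
  move=> [q1 e1] [q2 e2]; exists (q1 + q2).
  by rewrite rmorphD opprD addrACA e1 e2 mulrDr.
have PM p1 p2 : P p1 -> P p2 -> P (p1 * p2).
  move=> [q1 e1] [q2 e2]; exists (p2 * q1 + f p1 * q2).
  by rewrite rmorphM subr_prod e1 e2 mulrDr !(mulrCA 'X_j0).
have PC c : P (mpolyC r c).
  exists 0; rewrite mulr0; apply/eqP; rewrite subr_eq0; apply/eqP/esym.
  exact: mpoly.mmapC.
have PX j : P 'X_j.
  have fX : f 'X_j = X0 j by rewrite /f /= mpoly.mmapX mpoly.mmap1U.
  rewrite /P fX /X0; case: eqP => [->|_]; first by exists 1; rewrite mulr1 subr0.
  by exists 0; rewrite mulr0 subrr.
have P1 : P 1 by have := PC 1; rewrite mpolyC1.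
have P0 : P 0 by have := PC 0; rewrite mpolyC0.
have PXn j k : P ('X_j ^+ k).
  by elim: k => [|k IH]; [rewrite expr0|rewrite exprS; exact: (PM _ _ (PX j) IH)].
change (P p); rewrite [p]mpolyE; apply: (big_ind P P0 PD) => m _.
rewrite -mul_mpolyC; apply: (PM _ _ (PC _)).
rewrite mpolyXE_id; exact: (big_ind P P1 PM (fun j _ => PXn j (m j))).
Qed.

Lemma evX_basis : ev X x = fpsX1 'X_j0.
Proof. by rewrite fga_evalX /= basis_eval_basis. Qed.

Lemma evX_basisM s : ev X (x * s) = fpsX1 'X_j0 * ev X s.
Proof. by rewrite -evX_basis; exact: rmorphM. Qed.

Lemma hom_mulX d (q : B) : hom d.+1 ('X_j0 * q) = 'X_j0 * hom d q.
Proof.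
rewrite [q]mpolyE mulr_sumr !raddf_sum mulr_sumr; apply: eq_bigr => m _.
rewrite /= -scalerAr !linearZ /= -scalerAr -mpolyXD !pihomogX /=.
by rewrite mpoly.mdegD mpoly.mdeg1 add1n eqSS; case: eqP => _; rewrite ?mulr0 ?mpolyXD.
Qed.

Lemma hom0_mulX (q : B) : hom 0 ('X_j0 * q) = 0.
Proof.
rewrite [q]mpolyE mulr_sumr raddf_sum big1 // => m _.
rewrite /= -scalerAr linearZ /= -mpolyXD pihomogX /= mpoly.mdegD mpoly.mdeg1.
exact: scaler0.
Qed.

Lemma basis_eval_X0 : basis_eval F hb X0 (basis_elt hb j0) = 0.
Proof.
rewrite basis_eval_basis /X0 eqxx; apply: val_inj; apply: fps_eq => d.
by rewrite fps_coef0; apply: if_same.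
Qed.

(** Setting ['X_j0] to 0 kills each homogeneous part of [s], which is then divisible by ['X_j0].
    Surjectivity of [ev X] glues the quotients into an element of [fga], and injectivity identifies
    its product with [x]. *)
Lemma ev_kernel s : ev X0 s = 0 <-> exists s', s = x * s'.
Proof.
split=> [s0|[s' ->]]; last first.
  by rewrite rmorphM /= fga_evalX /= basis_eval_X0 mul0r.
have qP d : exists q, ev X s d = 'X_j0 * q.
  have [q e] := mmap_X0_subr (ev X s d); exists q.
  by rewrite -e -ev_specialize s0 fps_coef0 subr0.
pose q d := sval (cid (qP d)).
have qE d : ev X s d = 'X_j0 * q d by rewrite /q; case: cid.
(* The chosen quotient [q d.+1] is not known to be homogeneous; its part of degree [d] is kept. *)
have [s' s'E] := @evX_surj (fun d => hom d (q d.+1)) (fun d => pihomogP _ _ _).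
exists s'; apply/eqP; rewrite -subr_eq0; apply/eqP/evX_inj.
apply: etrans (rmorphB (ev X) s (x * s')) _; apply/eqP; rewrite subr_eq0; apply/eqP.
apply: etrans (esym (evX_basisM s')); rewrite s'E; apply: fps_eq => d.
rewrite -[LHS](pihomog_dE (evX_homog s d)) [ev X s d]qE.
case: d => [|d]; last by rewrite hom_mulX fps_coefX1M.
by rewrite hom0_mulX fps_coef0M mul0r.
Qed.

Lemma basis_lreg s : x * s = 0 -> s = 0.
Proof.
move=> xs0; apply: evX_inj.
have e : fpsX1 'X_j0 * ev X s = 0 by rewrite -evX_basisM xs0; exact: rmorph0.
apply: (fps_mulf_eq0 e); apply/eqP => /(congr1 (fun f : fps B => f 1%N)).
rewrite fps_coef0 /= => /(congr1 (mpoly.mcoeff U_(j0)%MM)) /eqP.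
by rewrite mcoeffXU eqxx mpoly.mcoeff0 oner_eq0.
Qed.

Hypothesis char0 : [pchar R] =i pred0.

Lemma intr_char0 (c : int) : c%:~R = 0 :> R -> c = 0.
Proof.
have h k : k%:R = 0 :> R -> k = 0%N.
  by move/eqP; rewrite (proj1 (pcharf0P R) char0) => /eqP.
case: c => k; first by move=> /h ->.
by rewrite NegzE mulrNz => /eqP; rewrite oppr_eq0 => /eqP/h.
Qed.

(** The hypothesis puts [la - mu] in the kernel of an additive map into the formal group. The linear
    coefficient of its image is the sum of the [c_j 'X_j] for [j] other than [j0], where the [c_j]
    are the coordinates; characteristic 0 makes these vanish. *)
Lemma ev_separate la mu : ev X0 (fgaX F la) = ev X0 (fgaX F mu) ->
  exists m : int, la - mu = basis_elt hb j0 *~ m.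
Proof.
move=> lamu; have e : basis_eval F hb X0 la = basis_eval F hb X0 mu.
  by apply: val_inj; rewrite /= -!(fga_evalX (basis_eval F hb X0)).
have : basis_eval F hb X0 (la - mu) = 0.
  by rewrite raddfB /= e subrr.
move: (la - mu) => z z0; exists (basis_coord hb z j0).
rewrite -[LHS](basis_coordK hb); apply: etrans (bigD1 j0 isT) _.
suff s0 : \sum_(j < r | j != j0) basis_elt hb j *~ basis_coord hb z j = 0.
  rewrite s0; exact: addr0.
apply: big1 => j jj0.
suff zj : basis_coord hb z j = 0 by rewrite zj; exact: mulr0z.
have : fg_coef1 (basis_eval F hb X0 z) = 0 by rewrite z0; exact: raddf0.
rewrite basis_eval_coef1 => /(congr1 (mpoly.mcoeff U_(j)%MM)).
have cE k : mpoly.mcoeff U_(j)%MM (X0 k *~ basis_coord hb z k) =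
    if k == j then (basis_coord hb z k)%:~R else 0.
  rewrite raddfMz /= /X0; case: (k =P j) => [->|/eqP/negbTE kj].
    by rewrite (negbTE jj0) mcoeffXU eqxx.
  by case: ifP; rewrite ?mcoeffXU ?kj ?mpoly.mcoeff0 mul0rz.
rewrite raddf_sum (eq_bigr _ (fun k _ => cE k)).
rewrite -big_mkcond big_pred1_eq mpoly.mcoeff0; exact: intr_char0.
Qed.

Lemma evX_basis1 : ev X x 1%N = 'X_j0.
Proof. by rewrite evX_basis. Qed.

(** The linear part of [x - y] is twice ['X_j0]. If [x] divided [e], then [x - y] would be a
    multiple of [x ^+ 2], without linear part, so that 2 would be 0 in [R]. *)
Lemma ev_quotient y : ev X0 y = 0 -> ev X y 1%N = - 'X_j0 ->
  exists2 e, x - y = x * e & ev X0 e != 0.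
Proof.
move=> y0 y1; have x0 : ev X0 x = 0 by rewrite fga_evalX /= basis_eval_X0.
have [e xe] : exists e, x - y = x * e.
  apply/ev_kernel; apply: etrans (rmorphB (ev X0) x y) _.
  rewrite [X in X - _ = _]x0 [X in _ - X = _]y0; exact: subrr.
exists e => //; apply: contra_eqN (xe) => /eqP /ev_kernel [e' ee'].
apply/eqP => {}xe; have := congr1 (fun s => ev X s 1%N) xe.
rewrite /= ee' !evX_basisM !fps_coefX1M fps_coef0M mul0r mulr0.
have -> : ev X (x - y) = ev X x - ev X y by exact: rmorphB.
rewrite fps_coefB evX_basis1 y1 opprK.
move=> /(congr1 (mpoly.mcoeff U_(j0)%MM)).
rewrite mpoly.mcoeffD mcoeffXU eqxx mpoly.mcoeff0.
by move=> /(intr_char0 (c := 2)).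
Qed.

Lemma ev_opp : exists2 e, x - fgaX F (- basis_elt hb j0) = x * e & ev X0 e != 0.
Proof.
apply: ev_quotient; first by rewrite fga_evalX raddfN /= basis_eval_X0 oppr0.
have -> : ev X (fgaX F (- basis_elt hb j0)) 1%N =
    fg_coef1 (- basis_eval F hb X (basis_elt hb j0)) by rewrite fga_evalX raddfN.
by rewrite basis_eval_basis raddfN.
Qed.

End Kernel.

End SeriesIso.

(** * Simple roots are prime *)

Definition rdvd (T : comPzRingType) (a b : T) := exists c, b = a * c.

Section SimpleRoot.
Context (R : idomainType) (char0 : [pchar R] =i pred0) (F : fgl R).
Context (K : realType) (n : nat) (A : gcm n) (D : root_datum K A).
Context (L : demazure_lattice D).
Local Notation S := (fga F L).

(** The interface with power series. [phi] sets to 0 the variable of the simple root in a basis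
    containing it; its target has no zero divisors, which makes the generator of its kernel
    prime. *)
Lemma fga_simple_root (i : 'I_n) :
  let x := fgaX F (lattice_root L i) in
  exists r (phi : {rmorphism S -> fps (mpoly r R)}),
  [/\ forall s, phi s = 0 <-> rdvd x s,
      forall s, phi (fga_act F L (simple_weyl D i) s) = phi s,
      forall la mu, phi (fgaX F la) = phi (fgaX F mu) ->
        exists m : int, la - mu = lattice_root L i *~ m,
      forall s, x * s = 0 -> s = 0 &
      exists2 e, x - fgaX F (- lattice_root L i) = x * e & phi e != 0].
Proof.
have [b hb ib] := dl_basis L i; have jlt : (index (simple_root D i) b < size b)%N.
  by rewrite index_mem.
pose j := Ordinal jlt; have ji : basis_elt hb j = lattice_root L i.
  by apply: val_inj; rewrite /= nth_index.
rewrite /= -ji; pose X0 k : mpoly (size b) R := if k == j then 0 else 'X_k.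
have g0 : basis_eval F hb X0 (basis_elt hb j) = 0 := basis_eval_X0 F hb j.
exists (size b), (fga_eval (basis_eval F hb X0)); split.
- exact: ev_kernel.
- move=> s; apply: fga_eval_act => la /=.
  (* A simple reflection moves [la] by an integral multiple of the simple root, which the evaluation
     sends to 0. *)
  suff -> : lattice_act (simple_weyl D i) la =
      la - basis_elt hb j *~ sval (cid (dl_int i (lattice_valP la))).
    by rewrite raddfB raddfMz /= g0 mul0rz subr0.
  rewrite ji; apply: val_inj; rewrite /= simple_reflE; case: cid => c /= ->.
  rewrite scaler_int; congr (_ - _).
  by have := raddfMz (@lattice_val K n A D L) c (lattice_root L i) => ->.
- move=> la mu; exact: ev_separate.
- exact: basis_lreg.
- exact: ev_opp.
Qed.

End SimpleRoot.

(** * Length and rank two in the Weyl group *)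

Section DihedralCoordinates.
Context (T : comPzRingType) (p q a b : T).

Lemma dih_subl (m x y : T) : x - (a + x * 2%:~R + y * m) = - m * y - x - a.
Proof. by rewrite mulrz_nat; ring. Qed.

Lemma dih_subr (m x y : T) : y - (b + x * m + y * 2%:~R) = - m * x - y - b.
Proof. by rewrite mulrz_nat; ring. Qed.

(* For [p = - A i j], [q = - A j i], [a = <la, al_i^v>] and [b = <la, al_j^v>]:
   the coordinates of [x al_i + y al_j] modulo [la] after applying [k] times,
   alternately, [s_j] and [s_i]. *)
Fixpoint dih k (x y : T) : T * T :=
  if k is k'.+1 then
    let z := dih k' x y in
    if odd k' then (p * z.2 - z.1 - a, z.2) else (z.1, q * z.1 - z.2 - b)
  else (x, y).

End DihedralCoordinates.

Lemma rmorph_dih (T U : comPzRingType) (f : {rmorphism T -> U}) p q a b k x y :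
  let z := dih p q a b k x y in
  dih (f p) (f q) (f a) (f b) k (f x) (f y) = (f z.1, f z.2).
Proof.
elim: k => [//|k IH] /=; move: IH => /= ->.
by case: (odd k); rewrite /= !(rmorphB, rmorphM).
Qed.

Lemma dih_ge0 (p q : int) k : 0 <= p -> 0 <= q -> 4 <= p * q ->
  let z := dih p q 0 0 k 1 0 in 0 <= z.1 /\ 0 <= z.2.
Proof.
move=> p0 q0 pq4.
(* Nonnegativity alone is not inductive. From [q x <= 2 y] and [4 <= p q] follows [2 x <= p y], so
   that [x' = p y - x] is nonnegative and [p y <= 2 x']; the other parity is symmetric. *)
suff: let z := dih p q 0 0 k 1 0 in
    [/\ 0 <= z.1, 0 <= z.2 & if odd k then q * z.1 <= 2 * z.2 else p * z.2 <= 2 * z.1].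
  by case.
elim: k => [|k] /=; first by rewrite mulr0.
case: (dih _ _ _ _ _ _ _) => x y /=; case: (odd k) => /= -[x0 y0 h].
  by split => //; nia.
by split => //; nia.
Qed.

Section Combination.
Context (T : pzRingType) (V : lmodType T) (la u v : V) (x y c : T).

Lemma comb2_subr : la + x *: u + y *: v - c *: v = la + x *: u + (y - c) *: v.
Proof. by rewrite -addrA -scalerBl. Qed.

Lemma comb2_subl : la + x *: u + y *: v - c *: u = la + (x - c) *: u + y *: v.
Proof. by rewrite addrAC -[la + _ - _]addrA -scalerBl. Qed.

End Combination.

Section Weyl.
Context (K : realType) (n : nat) (A : gcm n) (D : root_datum K A).
Local Notation V := (dual (rd_h D)).
Local Notation W := (weyl D).
Local Notation s := (simple_weyl D).
Local Notation al := (simple_root D).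

Lemma weylME (v w : W) la : (v * w)%g la = v (w la).
Proof. exact: comp_lfunE. Qed.
Lemma weyl1E la : (1%g : W) la = la.
Proof. exact: id_lfunE. Qed.
Lemma weylVK (w : W) la : w (w^-1%g la) = la.
Proof. by rewrite -weylME mulgV weyl1E. Qed.
Lemma weylKV (w : W) la : w^-1%g (w la) = la.
Proof. by rewrite -weylME mulVg weyl1E. Qed.

Lemma simple_weylE i la : s i la = la - pairing la i *: al i.
Proof. exact: simple_reflE. Qed.

Lemma pairing_root i j : pairing (al j) i = (A i j)%:~R.
Proof. exact: rd_pairing. Qed.

Lemma simple_weyl_root i : s i (al i) = - al i.
Proof.
rewrite simple_weylE pairing_root gcm_diag scaler_int mulrz_nat mulr2n.
by rewrite opprD addrA subrr sub0r.
Qed.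

Lemma simple_weylK i : (s i * s i)%g = 1%g.
Proof. by apply: weyl_eq; apply: simple_reflK. Qed.

Lemma simple_weylV i : (s i)^-1%g = s i.
Proof. by apply: mulg1_eq; apply: simple_weylK. Qed.

Lemma weyl_ind (P : W -> Prop) :
  P 1%g -> (forall i w, P w -> P (s i * w)%g) -> forall w, P w.
Proof.
move=> P1 PM w; have [t wt] := weyl_wordP w.
elim: t w wt => [|i t IH] w wt; first by rewrite (_ : w = 1%g) //; apply: weyl_eq.
rewrite (_ : w = s i * (s i * w))%g; last by rewrite mulgA simple_weylK mul1g.
apply: PM; apply: IH; rewrite [LHS](_ : _ = (simple_refl D i \o w)%VF) // wt /=.
by rewrite comp_lfunA simple_reflK comp_lfun1l.
Qed.

Definition word_weyl (t : seq 'I_n) : W := foldr (fun i w => s i * w)%g 1%g t.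

Lemma word_weyl_cat t u : word_weyl (t ++ u) = (word_weyl t * word_weyl u)%g.
Proof. by elim: t => [|i t IH] /=; rewrite ?mul1g // IH mulgA. Qed.

Lemma weyl_has_length (w : W) :
  exists k, `[< exists t, size t = k /\ w = word_weyl t >].
Proof.
elim/weyl_ind: w => [|i w [k /asboolP [t [tk ->]]]].
  by exists 0%N; apply/asboolP; exists [::].
by exists k.+1; apply/asboolP; exists (i :: t); rewrite /= tk.
Qed.

Definition weyl_length (w : W) : nat := ex_minn (weyl_has_length w).
Local Notation len := weyl_length.

Lemma length_word t : (len (word_weyl t) <= size t)%N.
Proof.
rewrite /len; case: ex_minnP => k _; apply.
by apply/asboolP; exists t.
Qed.

Lemma reduced_word w : exists2 t, w = word_weyl t & size t = len w.
Proof.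
rewrite /len; case: ex_minnP => k /asboolP [t [tk ->]] _.
by exists t.
Qed.

Lemma lengthM v w : (len (v * w)%g <= len v + len w)%N.
Proof.
have [t -> <-] := reduced_word v; have [u -> <-] := reduced_word w.
by rewrite -word_weyl_cat -size_cat; apply: length_word.
Qed.

Lemma length_simple i : (len (s i) <= 1)%N.
Proof. by rewrite -[s i]mulg1; apply: (length_word [:: i]). Qed.

Lemma length_eq0 w : len w = 0%N -> w = 1%g.
Proof. by have [t -> <-] := reduced_word w; case: t. Qed.

Lemma length_simpleM i w : (len (s i * w)%g <= (len w).+1)%N.
Proof.
by apply: leq_trans (lengthM _ _) _; rewrite -add1n leq_add2r length_simple.
Qed.

Section Dihedral.
Variables i j : 'I_n.

Definition alt_letter (k : nat) := if odd k then i else j.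
(** The alternating product of [k] simple reflections whose rightmost factor, for [k > 0], is
    [s j]. *)
Fixpoint alt_weyl k : W :=
  if k is k'.+1 then (s (alt_letter k') * alt_weyl k')%g else 1%g.

Lemma alt_weylS k : alt_weyl k.+1 = (s (alt_letter k) * alt_weyl k)%g.
Proof. by []. Qed.

Lemma alt_weyl_word k : exists2 t, alt_weyl k = word_weyl t &
  size t = k /\ {subset t <= [:: i; j]}.
Proof.
elim: k => [|k [t e [tk tij]]]; first by exists [::].
exists (alt_letter k :: t); first by rewrite /= e.
split=> [|l]; first by rewrite /= tk.
rewrite inE => /predU1P [->|/tij//]; rewrite /alt_letter !inE.
by case: odd; rewrite eqxx ?orbT.
Qed.

Lemma alt_weylE k (la : V) (x y : K[i]%C) :
  let z := dih (- (A i j)%:~R) (- (A j i)%:~R) (pairing la i) (pairing la j) k x y in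
  alt_weyl k (la + x *: al i + y *: al j) = la + z.1 *: al i + z.2 *: al j.
Proof.
elim: k => [|k IH]; first by rewrite weyl1E.
cbv zeta; rewrite alt_weylS weylME {}IH /=.
case: (dih _ _ _ _ _ _ _) => x' y' /=; rewrite simple_weylE /alt_letter.
have pE l : pairing (la + x' *: al i + y' *: al j) l =
    pairing la l + x' * (A l i)%:~R + y' * (A l j)%:~R.
  by rewrite /pairing !add_lfunE !scale_lfunE -!pairing_root.
case: (odd k) => /=; rewrite pE gcm_diag.
  apply: etrans (comb2_subl _ _ _ _ _ _) _.
  have e := congr1 (fun c => la + c *: al i + y' *: al j)
    (dih_subl (pairing la i) (A i j)%:~R x' y').
  exact: e.
apply: etrans (comb2_subr _ _ _ _ _ _) _.
have e := congr1 (fun c => la + x' *: al i + c *: al j)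
  (dih_subr (pairing la j) (A j i)%:~R x' y').
exact: e.
Qed.

End Dihedral.

End Weyl.

(** The finite rank two types: [p q] is 0, 1, 2 or 3 (types A1 x A1, A2, B2, G2), with [m] equal to
    2, 3, 4 or 6. The last clause is the braid relation in coordinates. *)
Lemma dih_finite (p q : int) : 0 <= p -> 0 <= q -> p * q < 4 -> (p = 0 <-> q = 0) ->
  exists m : nat, [/\ (0 < m)%N,
    forall k, (k < m)%N -> let z := dih p q 0 0 k 1 0 in 0 <= z.1 /\ 0 <= z.2 &
    forall (T : comPzRingType) (a b : T),
      let z := dih p%:~R q%:~R a b m 0 0 in
      dih q%:~R p%:~R b a m 0 0 = (z.2, z.1)].
Proof.
have dihP m (P Q : int) : (forall k : 'I_m, let z := dih P Q 0 0 k 1 0 in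
    (0 <= z.1) && (0 <= z.2)) ->
    forall k, (k < m)%N -> let z := dih P Q 0 0 k 1 0 in 0 <= z.1 /\ 0 <= z.2.
  by move=> h k km; apply/andP; apply: (h (Ordinal km)).
case: p q => [[|[|[|[|p]]]]|p] [[|[|[|[|q]]]]|q] // _ _ pq pq0;
  try (by exfalso; move: pq; rewrite -!PoszM; clear; lia);
  try (by have := proj1 pq0 erefl); try (by have := proj2 pq0 erefl).
- exists 2%N; split=> [//||T a b /=]; last by congr pair; ring.
  by apply: dihP => -[[|[|k]]].
- exists 3%N; split=> [//||T a b /=]; last by congr pair; ring.
  by apply: dihP => -[[|[|[|k]]]].
- exists 4%N; split=> [//||T a b /=]; last by congr pair; ring.
  by apply: dihP => -[[|[|[|[|k]]]]].
- exists 6%N; split=> [//||T a b /=]; last by congr pair; ring.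
  by apply: dihP => -[[|[|[|[|[|[|k]]]]]]].
- exists 4%N; split=> [//||T a b /=]; last by congr pair; ring.
  by apply: dihP => -[[|[|[|[|k]]]]].
- exists 6%N; split=> [//||T a b /=]; last by congr pair; ring.
  by apply: dihP => -[[|[|[|[|[|[|k]]]]]]].
Qed.

Section WeylRank2.
Context (K : realType) (n : nat) (A : gcm n) (D : root_datum K A).
Local Notation V := (dual (rd_h D)).
Local Notation s := (simple_weyl D).
Local Notation al := (simple_root D).

Lemma alt_weylSr i j k : alt_weyl D i j k.+1 = (alt_weyl D j i k * s j)%g.
Proof.
elim: k => [|k IH]; first by rewrite /= mulg1 mul1g.
rewrite alt_weylS IH mulgA alt_weylS; congr (s _ * _ * _)%g.
by rewrite /alt_letter /=; case: odd.
Qed.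

Lemma alt_weyl_split i j m k : exists2 t,
  alt_weyl D i j (k + m) = (word_weyl D t * alt_weyl D i j m)%g & size t = k.
Proof.
elim: k => [|k [t e tk]]; first by exists [::]; rewrite ?mul1g.
exists (alt_letter i j (k + m) :: t); last by rewrite /= tk.
by rewrite addSn alt_weylS e mulgA.
Qed.

(** As long as [k] stays below the length [m] of the braid relation, if there is one, the
    coordinates are nonnegative. Beyond it, the relation rewrites the last [m] letters so that they
    end in [s i], which then cancels. *)
Lemma alt_weyl_root i j k : i != j ->
  (exists x y : nat, alt_weyl D i j k (al i) = al i *+ x + al j *+ y) \/
  (exists2 t, (alt_weyl D i j k * s i)%g = word_weyl D t & (size t < k)%N).
Proof.
move=> ij; pose p := - A i j; pose q := - A j i.
have p0 : 0 <= p by rewrite oppr_ge0 gcm_offdiag.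
have q0 : 0 <= q by rewrite oppr_ge0 gcm_offdiag // eq_sym.
have pq0 : p = 0 <-> q = 0.
  rewrite /p /q; split=> /eqP; rewrite oppr_eq0 => /eqP /gcm_sym0 ->; exact: oppr0.
have rootE m : let z := dih p q 0 0 m 1 0 in
    alt_weyl D i j m (al i) = al i *~ z.1 + al j *~ z.2.
  have e := rmorph_dih (intr : {rmorphism int -> K[i]%C}) p q 0 0 m 1 0.
  have := alt_weylE i j m (0 : V) 1 0; rewrite scale1r scale0r addr0 add0r => h.
  have pair0 l : pairing (0 : V) l = 0 by rewrite /pairing zero_lfunE.
  move: h; rewrite !pair0 -!rmorphN.
  rewrite rmorph0 rmorph1 in e; rewrite /= in e; rewrite /= e /= !add0r => ->.
  by rewrite !scaler_int.
have left m : (let z := dih p q 0 0 m 1 0 in 0 <= z.1 /\ 0 <= z.2) ->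
    exists x y : nat, alt_weyl D i j m (al i) = al i *+ x + al j *+ y.
  move: (rootE m); case: (dih _ _ _ _ _ _ _) => -[x|x] [y|y] //= e [] // _ _.
  by exists x, y.
have [pq4|pq4] := lerP 4 (p * q); first by left; apply: left; apply: dih_ge0.
have [m [m0 ge0 braid]] := dih_finite p0 q0 pq4 pq0.
have [km|mk] := ltnP k m; first by left; apply: left; apply: ge0.
right; have [t e tk] := alt_weyl_split i j m (k - m).
(* An equality of operators on all weights, not only on the span of the two roots; hence the
   arbitrary [a] and [b] in [dih_finite]. *)
have {}braid : alt_weyl D i j m = alt_weyl D j i m.
  apply: weyl_eq; apply/lfunP => la.
  have := alt_weylE i j m la 0 0; have := alt_weylE j i m la 0 0.
  rewrite !scale0r !addr0 -!(rmorphN intr) /= -/p -/q braid /= => -> ->.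
  by rewrite addrAC.
case: m m0 ge0 mk tk e braid => // m _ _ mk tk e braid.
have [u eu [um _]] := alt_weyl_word D i j m.
exists (t ++ u); last by rewrite size_cat tk um; move: mk; clear; lia.
rewrite word_weyl_cat -eu -[in LHS](subnK mk) e braid -mulgA alt_weylSr.
by rewrite -mulgA simple_weylK mulg1.
Qed.

(** A letter put in front of an alternating word either extends it or cancels its first letter. *)
Lemma alt_weyl_of_word i j t : {subset t <= [:: i; j]} -> exists2 k, (k <= size t)%N &
  word_weyl D t = alt_weyl D i j k \/ word_weyl D t = alt_weyl D j i k.
Proof.
elim: t => [|a t IH] tij; first by exists 0%N => //; left.
have [|k kt] := IH; first by move=> l lt; apply: tij; rewrite inE lt orbT.
have aij : a \in [:: i; j] by apply: tij; rewrite mem_head.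
have step i' j' : a \in [:: i'; j'] -> word_weyl D t = alt_weyl D i' j' k ->
    exists2 k, (k <= (size t).+1)%N &
      word_weyl D (a :: t) = alt_weyl D i' j' k \/
      word_weyl D (a :: t) = alt_weyl D j' i' k.
  move=> aij' e; have [al|al] := eqVneq a (alt_letter i' j' k).
    by exists k.+1 => //; left; rewrite alt_weylS /= e al.
  have {al}ae : a = alt_letter i' j' k.+1.
    move: al aij'; rewrite /alt_letter !inE /=.
    by case: odd => /= /negbTE ->; rewrite ?orbF => /eqP.
  case: k kt e ae => [|k] kt e ae.
    by exists 1%N => //; right; rewrite alt_weylS /= e ae.
  exists k; first by rewrite (leq_trans _ (leqW kt)).
  left; rewrite /= e alt_weylS mulgA ae.
  by rewrite /alt_letter /= negbK simple_weylK mul1g.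
case=> [/step|/step h]; first exact.
have [|k' k't h'] := h; first by move: aij; rewrite !inE orbC.
by exists k' => //; case: h'; [right|left].
Qed.

End WeylRank2.

(** * Signs of roots and strong exchange *)

Section WeylRoots.
Context (K : realType) (n : nat) (A : gcm n) (D : root_datum K A).
Local Notation V := (dual (rd_h D)).
Local Notation W := (weyl D).
Local Notation s := (simple_weyl D).
Local Notation al := (simple_root D).
Local Notation len := (@weyl_length K n A D).

Definition nneg (la : V) := exists c : 'I_n -> nat, la = \sum_i al i *+ c i.

Lemma simple_root_free (c : 'I_n -> int) :
  \sum_i al i *~ c i = 0 -> forall i, c i = 0.
Proof.
move=> e i; have /freeP free := rd_root_free D.
apply/eqP; rewrite -(intr_eq0 K[i]%C); apply/eqP; move: i.
apply: (free (fun i => (c i)%:~R)); rewrite -[RHS]e; apply: eq_bigr => i _.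
by rewrite scaler_int /simple_root (tnth_nth 0).
Qed.

Lemma nneg_root i : nneg (al i).
Proof.
exists (fun j => (j == i)%:R); rewrite (bigD1 i) //= eqxx big1 ?addr0 // => j.
by move=> /negbTE ->.
Qed.

Lemma nnegD la mu : nneg la -> nneg mu -> nneg (la + mu).
Proof.
move=> [c ->] [d ->]; exists (fun i => (c i + d i)%N).
by rewrite -big_split; apply: eq_bigr => i _; rewrite mulrnDr.
Qed.

Lemma nneg0 : nneg 0.
Proof. by exists (fun=> 0%N); rewrite big1. Qed.

Lemma nnegMn la k : nneg la -> nneg (la *+ k).
Proof.
move=> h; elim: k => [|k IH]; first exact: nneg0.
by rewrite mulrS; exact: (nnegD h IH).
Qed.

Lemma nneg_anti la : nneg la -> nneg (- la) -> la = 0.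
Proof.
move=> [c ce] [d de].
have e : \sum_i al i *~ ((c i + d i)%N : int) = 0.
  transitivity (la - la); last exact: subrr.
  rewrite {1}ce de -big_split; apply: eq_bigr => i _.
  by rewrite -[LHS]/(_ *+ _) mulrnDr.
rewrite ce; apply: big1 => i _; have /eqP := simple_root_free e i.
by rewrite eqz_nat addn_eq0 => /andP [/eqP -> _].
Qed.

Lemma nneg_simple_root i : ~ nneg (- al i).
Proof.
move=> /(nneg_anti (nneg_root i)) ali.
have e : \sum_j al j *~ ((j == i)%:R : int) = 0.
  apply: big1 => j _; case: (j =P i) => [->|_]; last exact: mulr0z.
  by rewrite ali mul0rz.
by have := simple_root_free e i; rewrite eqxx.
Qed.

Lemma length_simpleMr w i : (len (w * s i)%g <= (len w).+1)%N.
Proof.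
by apply: leq_trans (lengthM _ _) _; rewrite -addn1 leq_add2l length_simple.
Qed.

(* Tits: writing [w = v u] with [u] in the dihedral group of [s_i] and of a
   right descent [s_j] of [w] reduces to rank two. *)
Lemma weyl_root_nneg w i : (len w <= len (w * s i)%g)%N -> nneg (w (al i)).
Proof.
have [N] := ubnP (len w); elim: N w i => // N IH w i; rewrite ltnS => wN wi.
have [t wt tw] := reduced_word w; case/lastP: t wt tw => [|t j] wt tw.
  by rewrite wt weyl1E; apply: nneg_root.
have wj : w = (word_weyl D t * s j)%g.
  by rewrite wt -cats1 word_weyl_cat /= mulg1.
have lt : (len (word_weyl D t) < len w)%N.
  by rewrite -tw size_rcons ltnS length_word.
have ij : i != j.
  apply: contraTneq wi => ->; rewrite wj -mulgA simple_weylK mulg1 -wj.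
  by rewrite -ltnNge.
pose P k := `[< exists v u, [/\ len v = k, w = (v * word_weyl D u)%g,
  (len v + size u = len w)%N & {subset u <= [:: i; j]}] >].
have Pt : P (len (word_weyl D t)).
  apply/asboolP; exists (word_weyl D t), [:: j].
  split=> //; first by rewrite wj /= mulg1.
    apply/eqP; rewrite eqn_leq; apply/andP; split; first by rewrite addn1.
    by rewrite [in X in (X <= _)%N]wj addn1; exact: length_simpleMr.
  by move=> l; rewrite !inE => ->; rewrite orbT.
have [k /asboolP [v [u [vk wvu vuw uij]]] kmin] := ex_minnP (ex_intro (fun k => P k) _ Pt).
have vlt : (len v < N)%N.
  by rewrite vk; apply: leq_ltn_trans (kmin _ Pt) (leq_trans lt wN).
(* By minimality of its length, [v] has neither [s i] nor [s j] as a right descent, so the induction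
   hypothesis applies to it. *)
have vmin a : a \in [:: i; j] -> nneg (v (al a)).
  move=> aij; apply: IH => //; rewrite leqNgt; apply/negP => va.
  suff /kmin : P (len (v * s a)%g) by rewrite -vk leqNgt va.
  have e : w = (v * s a * word_weyl D (a :: u))%g.
    by rewrite /= mulgA -[(v * _ * _)%g]mulgA simple_weylK mulg1.
  apply/asboolP; exists (v * s a)%g, (a :: u); split => //.
    apply/eqP; rewrite eqn_leq; apply/andP; split.
      by rewrite /= -vuw addnS -addSn leq_add2r.
    rewrite {1}e; apply: leq_trans (lengthM _ _) _.
    by rewrite leq_add2l length_word.
  by move=> l; rewrite inE => /predU1P [->|/uij].
have wlt t' : (w * s i)%g = (v * word_weyl D t')%g -> (size t' < size u)%N -> False.
  move=> e t'u; have := leq_trans wi (eq_leq (congr1 len e)).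
  rewrite leqNgt => /negP; apply; apply: leq_ltn_trans (lengthM _ _) _.
  by rewrite -vuw ltn_add2l (leq_ltn_trans (length_word _ _)).
have [k' k'u ue] := alt_weyl_of_word D uij.
have k'E : k' = size u.
  apply/eqP; rewrite eqn_leq k'u /= -(leq_add2l (len v)) vuw wvu.
  apply: leq_trans (lengthM _ _) _; rewrite leq_add2l.
  have altk a b : (len (alt_weyl D a b k') <= k')%N.
    by have [t' -> [t'k _]] := alt_weyl_word D a b k'; rewrite -t'k length_word.
  by case: ue => ->.
(* If the alternating word ended in [s i], this letter would cancel in [w * s i] and contradict the
   assumption on lengths. *)
have {}ue : word_weyl D u = alt_weyl D i j k'.
  case: ue => // ue; case: k' k'u k'E ue => [|k'] k'u k'E ue; first by rewrite ue.
  have [t' t'e [t'k _]] := alt_weyl_word D i j k'.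
  case: (@wlt t'); last by rewrite t'k -k'E.
  by rewrite wvu ue alt_weylSr t'e -!mulgA simple_weylK mulg1.
have [[x [y e]]|[t' t'e t'k]] := alt_weyl_root D k' ij; last first.
  by case: (@wlt t'); rewrite -?k'E // wvu ue -mulgA t'e.
rewrite wvu weylME ue e linearD !linearMn.
have ji : j \in [:: i; j] by rewrite !inE eqxx orbT.
exact: (nnegD (nnegMn x (vmin i (mem_head _ _))) (nnegMn y (vmin j ji))).
Qed.

Lemma weyl_simpleN (w : W) i : (w * s i)%g (al i) = - w (al i).
Proof. by rewrite weylME simple_weyl_root linearN. Qed.

Lemma weyl_root_sign (w : W) i : nneg (w (al i)) \/ nneg (- w (al i)).
Proof.
have [h|h] := leqP (len w) (len (w * s i)%g); first by left; exact: weyl_root_nneg.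
right; rewrite -weyl_simpleN; apply: weyl_root_nneg.
by rewrite -mulgA simple_weylK mulg1 ltnW.
Qed.

Lemma simple_root_comb_inj (f g : 'I_n -> int) :
  \sum_i al i *~ f i = \sum_i al i *~ g i -> f =1 g.
Proof.
move=> e i; apply/eqP; rewrite -subr_eq0; apply/eqP; move: i.
apply: (@simple_root_free (fun i => f i - g i)).
under eq_bigr do rewrite mulrzBr; by rewrite sumrB e subrr.
Qed.

Lemma simple_root_comb i : al i = \sum_j al j *~ ((j == i)%:R : int).
Proof.
rewrite (bigD1 i) //= eqxx big1 => [|j /negbTE ->]; last exact: mulr0z.
by rewrite addr0.
Qed.

Lemma weyl_root_comb (w : W) i : exists f : 'I_n -> int, w (al i) = \sum_j al j *~ f j.
Proof.
have [[c ->]|[c e]] := weyl_root_sign w i; first by exists (fun j => c j).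
exists (fun j => - (c j : int)); rewrite -[LHS]opprK e -sumrN.
by apply: eq_bigr => j _; rewrite mulrNz.
Qed.

(** Applying the inverse of [w] gives [al k] as [m] times a vector with integral coordinates, so [m]
    divides 1. *)
Lemma weyl_root_primitive (w : W) k i (m : int) :
  w (al k) = al i *~ m -> m = 1 \/ m = - 1.
Proof.
move=> e; have [f fe] := weyl_root_comb w^-1%g i.
have : al k = \sum_j al j *~ (f j * m).
  rewrite -[LHS](weylKV w) e [LHS]raddfMz /= fe mulrz_suml.
  by apply: eq_bigr => j _; exact: (esym (mulrzA _ _ _)).
rewrite {1}[al k]simple_root_comb => /simple_root_comb_inj /(_ k); rewrite eqxx.
move=> /(congr1 absz) /esym /eqP; rewrite abszM muln_eq1 => /andP [_].
by case: m {e} => [[|[]]|[]] //; [left|right].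
Qed.

Lemma simple_weyl_comb i (c : 'I_n -> nat) :
  s i (\sum_j al j *+ c j) =
  \sum_j al j *+ c j - al i *~ (\sum_j A i j *+ c j).
Proof.
rewrite raddf_sum /= mulrz_sumr -sumrB; apply: eq_bigr => j _.
rewrite raddfMn /= simple_weylE pairing_root scaler_int mulrnBl; congr (_ - _).
rewrite -[A i j *+ c j]mulr_natr natz mulrzA; reflexivity.
Qed.

(** [s i] only changes the coordinate on [al i]. If the image were negative, the other coordinates
    would all vanish, and the root, a nonnegative multiple of [al i], would be [al i] by
    primitivity. *)
Lemma simple_weyl_nneg (w : W) k i :
  nneg (w (al k)) -> w (al k) <> al i -> nneg (s i (w (al k))).
Proof.
move=> [c ce] wki; rewrite -weylME.
have [//|[d]] := weyl_root_sign (s i * w)%g k; rewrite weylME ce simple_weyl_comb.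
set M : int := \sum_j A i j *+ c j; move=> de; case: wki.
have e : \sum_j al j *~ ((c j + d j)%N : int) = \sum_j al j *~ (M * (j == i)%:R).
  transitivity (al i *~ M); last first.
    by rewrite {1}[al i]simple_root_comb mulrz_suml; apply: eq_bigr => j _; rewrite -mulrzA mulrC.
  transitivity (\sum_j al j *+ c j + \sum_j al j *+ d j).
    by rewrite -big_split; apply: eq_bigr => j _; rewrite -[LHS]/(_ *+ _) mulrnDr.
  by rewrite -de opprB addrC subrK.
have cE j : j != i -> c j = 0%N.
  move=> /negbTE ji; have := simple_root_comb_inj e j; rewrite ji mulr0.
  by clear; lia.
have {}ce : w (al k) = al i *~ (c i : int).
  rewrite ce (bigD1 i) //= big1 ?addr0 // => j /cE ->; exact: mulr0n.
case: (weyl_root_primitive ce) => ci; last by exfalso; move: ci; clear; lia.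
by rewrite ce ci.
Qed.

(* An element of [W] acting trivially modulo [al_i] is [1] or [s_i]. *)
Lemma weyl_transvection (g : W) i :
  (forall j, exists m : int, g (al j) = al j + al i *~ m) -> g = 1%g \/ g = s i.
Proof.
have fix1 (h : W) : (forall j, exists m : int, h (al j) = al j + al i *~ m) ->
    h (al i) = al i -> h = 1%g.
  move=> hj hi; apply: length_eq0; have [t ht tl] := reduced_word h.
  case/lastP: t ht tl => [|t j] ht tl; first by rewrite -tl.
  exfalso; have hs : h = (word_weyl D t * s j)%g.
    by rewrite ht -cats1 word_weyl_cat /= mulg1.
  (* The last letter [s j] of a reduced word is a right descent, so [h (al j)] is negative. But its
     coordinate on [al j] is 1 if [j] differs from [i], and [h] fixes [al i]. *)
  have neg : nneg (- h (al j)).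
    rewrite -weyl_simpleN; apply: weyl_root_nneg.
    rewrite -mulgA simple_weylK mulg1 hs -mulgA simple_weylK mulg1 -hs -tl.
    by rewrite size_rcons ltnW // ltnS length_word.
  have [ji|ji] := eqVneq j i; first by rewrite ji hi in neg; exact: (nneg_simple_root neg).
  have [m me] := hj j; have [d de] := neg.
  have : \sum_k al k *~ (- (d k : int)) =
      \sum_k al k *~ ((k == j)%:R + (k == i)%:R * m).
    transitivity (h (al j)).
      by rewrite -[RHS]opprK de -sumrN; apply: eq_bigr => k _; rewrite mulrNz.
    rewrite me {1}[al j]simple_root_comb {1}[al i]simple_root_comb mulrz_suml.
    rewrite -big_split; apply: eq_bigr => k _; rewrite /= -mulrzA -mulrzDr.
    by congr (_ *~ _); rewrite /= !natz.
  move=> /simple_root_comb_inj /(_ j); rewrite eqxx (negbTE ji) mul0r.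
  by case: (d j).
move=> gj; have [m mi] := gj i.
have : g (al i) = al i *~ (1 + m) by rewrite mulrzDr mulr1z.
move=> /[dup] gi /weyl_root_primitive [m1|m1]; rewrite m1 in gi.
  by left; apply: fix1.
(* Here [g] negates [al i], so [g * s i] fixes it and the first case applies. *)
right; rewrite -[g]mulg1 -(simple_weylK D i) mulgA.
rewrite (_ : (g * s i)%g = 1%g) ?mul1g //; apply: fix1.
  move=> j; have [k jk] := gj j; exists (k + A i j).
  rewrite weylME simple_weylE pairing_root scaler_int raddfB raddfMz /= gi jk.
  by rewrite mulrzDr mulrNz mulr1z mulNrz opprK addrA.
by rewrite weyl_simpleN gi mulrNz opprK.
Qed.

Lemma weyl_reflectionE (u : W) k (la : V) :
  (u * s k * u^-1)%g la = la - pairing (u^-1%g la) k *: u (al k).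
Proof. by rewrite !weylME simple_weylE linearB linearZ /= weylVK. Qed.

Lemma pairing_weyl_root (w : W) j k :
  exists m : int, pairing (w (al j)) k = m%:~R.
Proof.
have [f ->] := weyl_root_comb w j; exists (\sum_l A k l * f l).
rewrite /pairing sum_lfunE rmorph_sum; apply: eq_bigr => l _.
rewrite -scaler_int scale_lfunE -/(pairing (al l) k) pairing_root [RHS]rmorphM.
exact: mulrC.
Qed.

(** The conjugate of [s k] acts on simple roots trivially modulo [al i], so [weyl_transvection]
    leaves 1 and [s i]; the value [- al i] at [al i] excludes 1. This spares a comparison of
    coroots. *)
Lemma weyl_reflection_simple (u : W) k i :
  u (al k) = al i -> (u * s k * u^-1)%g = s i.
Proof.
move=> uki; have [j||//] := @weyl_transvection (u * s k * u^-1)%g i.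
  have [m me] := pairing_weyl_root u^-1%g j k; exists (- m).
  by rewrite weyl_reflectionE uki me scaler_int mulrNz.
move=> e; exfalso; apply: (@nneg_simple_root i).
have := congr1 (fun w : W => w (al i)) e; rewrite weyl1E -{1}uki !weylME weylKV.
rewrite simple_weyl_root linearN /= uki => ->; exact: nneg_root.
Qed.

(** Reading a reduced word of [w] from the left, the positive root [u (al k)] becomes negative at
    some letter. Just before, it is the simple root of that letter, and the reflection deletes the
    letter. *)
Lemma strong_exchange (u w : W) k :
  nneg (u (al k)) -> nneg (- (w^-1)%g (u (al k))) ->
  (len ((u * s k * u^-1) * w)%g < len w)%N.
Proof.
have [t -> <-] := reduced_word w.
elim: t u {w} => [|i t IH] u upos wneg.
  exfalso; move: wneg; rewrite invg1 weyl1E => uneg.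
  have u0 := nneg_anti upos uneg; apply: (@nneg_simple_root k).
  by rewrite -(weylKV u (al k)) u0 linear0 oppr0; exact: nneg0.
rewrite [word_weyl _ _]/= in wneg *; set w := word_weyl D t in IH wneg *.
have [uki|uki] := pselect (u (al k) = al i).
  rewrite (weyl_reflection_simple uki) mulgA simple_weylK mul1g ltnS.
  exact: length_word.
have := IH (s i * u)%g; rewrite weylME => /(_ (simple_weyl_nneg upos uki)).
have wneg' : nneg (- w^-1%g (s i (u (al k)))).
  by move: wneg; rewrite invgM weylME simple_weylV.
move=> /(_ wneg'); rewrite invgM simple_weylV => lt.
have -> : (u * s k * u^-1 * (s i * w))%g =
    (s i * (s i * u * s k * (u^-1 * s i) * w))%g.
  by rewrite !mulgA simple_weylK mul1g.
apply: leq_ltn_trans (length_simpleM _ _) _; rewrite ltnS; exact: lt.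
Qed.

End WeylRoots.

(** * The elements attached to roots *)

Section PolRename.
Context (R : comNzRingType) (I : choiceType).

Lemma pol_rename_comp (g h : I -> I) (p : mvpoly R I) :
  pol_rename R g (pol_rename R h p) = pol_rename R (g \o h) p.
Proof.
pose r1 : {rmorphism mvpoly R I -> mvpoly R I} := pol_rename R g \o pol_rename R h.
have rC c : r1 (malgC c) = pol_rename R (g \o h) (malgC c).
  have e := congr1 (pol_rename R g) (pol_renameC h c).
  apply: etrans e _; apply: etrans (pol_renameC g c) _.
  apply: esym; exact: (pol_renameC (g \o h) c).
have rX i : r1 (polX R i) = pol_rename R (g \o h) (polX R i).
  have e := congr1 (pol_rename R g) (pol_renameX R h i).
  apply: etrans e _; apply: etrans (pol_renameX R g (h i)) _.
  apply: esym; exact: (pol_renameX R (g \o h) i).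
exact (eq_mvpoly_rmorph rC rX p).
Qed.

Lemma pol_rename_id (p : mvpoly R I) : pol_rename R id p = p.
Proof.
pose r1 : {rmorphism mvpoly R I -> mvpoly R I} := idfun.
have rC c : pol_rename R id (malgC c) = r1 (malgC c) := pol_renameC id c.
have rX i : pol_rename R id (polX R i) = r1 (polX R i) := pol_renameX R id i.
exact (eq_mvpoly_rmorph rC rX p).
Qed.

End PolRename.

Section Roots.
Context (R : idomainType) (char0 : [pchar R] =i pred0) (F : fgl R).
Context (K : realType) (n : nat) (A : gcm n) (D : root_datum K A).
Context (L : demazure_lattice D).
Local Notation Lam := (lattice_elt L).
Local Notation S := (fga F L).
Local Notation W := (weyl D).
Local Notation s := (simple_weyl D).
Local Notation act := (fga_act F L).

Lemma lattice_actM (v w : W) (la : Lam) :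
  lattice_act (v * w)%g la = lattice_act v (lattice_act w la).
Proof. by apply: val_inj; apply: weylME. Qed.

Lemma lattice_act1 (la : Lam) : lattice_act 1%g la = la.
Proof. by apply: val_inj; apply: weyl1E. Qed.

Lemma ps_rename_comp (g h : Lam -> Lam) (u : pseries R Lam) :
  ps_rename g (ps_rename h u) = ps_rename (g \o h) u.
Proof.
have [a ->] := cmpl_pi_surj u.
apply: etrans (congr1 (ps_rename g) (cmpl_mapE _ _)) _.
apply: etrans (cmpl_mapE _ _) _; apply: etrans _ (esym (cmpl_mapE _ _)).
congr cmpl_pi; apply: adic_seq_eq => k /=.
exact: pol_rename_comp.
Qed.

Lemma ps_rename_id (u : pseries R Lam) : ps_rename id u = u.
Proof.
have [a ->] := cmpl_pi_surj u; apply: etrans (cmpl_mapE _ _) _.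
congr cmpl_pi; apply: adic_seq_eq => k /=.
exact: pol_rename_id.
Qed.

Lemma fga_actM v w (x : S) : act (v * w)%g x = act v (act w x).
Proof.
have [u ->] := quot_pi_surj x.
apply: etrans (quot_mapE _ _) _; apply: esym.
apply: etrans (congr1 (act v) (quot_mapE _ _)) _; apply: etrans (quot_mapE _ _) _.
apply: etrans (congr1 (quot_pi _) (ps_rename_comp _ _ _)) _.
have g : lattice_act v \o lattice_act w = lattice_act (v * w)%g :> (Lam -> Lam).
  by apply/funext => la; exact: esym (lattice_actM v w la).
have e := congr1 (fun g => quot_pi (fga_ideal F L) (ps_rename g u)) g; exact: e.
Qed.

Lemma fga_act1 (x : S) : act 1%g x = x.
Proof.
have [u ->] := quot_pi_surj x; apply: etrans (quot_mapE _ _) _.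
have g : lattice_act 1%g = id :> (Lam -> Lam).
  by apply/funext => la; exact: lattice_act1.
have e := congr1 (fun g => quot_pi (fga_ideal F L) (ps_rename g u)) g.
apply: etrans e _; exact: (congr1 (quot_pi _) (ps_rename_id u)).
Qed.

Lemma fga_actVK w (x : S) : act w (act w^-1%g x) = x.
Proof. by rewrite -fga_actM mulgV fga_act1. Qed.
Lemma fga_actKV w (x : S) : act w^-1%g (act w x) = x.
Proof. by rewrite -fga_actM mulVg fga_act1. Qed.

(** A root is given by a pair [(u, k)], so that no representative has to be chosen; the opposite
    root is given by [(u * s k, k)]. *)
Definition lroot (u : W) (k : 'I_n) : Lam := lattice_act u (lattice_root L k).
Definition xroot (u : W) (k : 'I_n) : S := fgaX F (lroot u k).
Definition refl (u : W) (k : 'I_n) : W := (u * s k * u^-1)%g.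

Lemma lrootM v u k : lattice_act v (lroot u k) = lroot (v * u)%g k.
Proof. by rewrite /lroot lattice_actM. Qed.

Lemma fga_act_xroot v u k : act v (xroot u k) = xroot (v * u)%g k.
Proof. by rewrite /xroot -lrootM; exact: fga_actX. Qed.

Lemma lrootN u k : lroot (u * s k)%g k = - lroot u k.
Proof.
rewrite /lroot lattice_actM -raddfN; congr (lattice_act u _).
by apply: val_inj; exact: simple_weyl_root.
Qed.

Lemma rdvd_act w (x y : S) : rdvd x y -> rdvd (act w x) (act w y).
Proof. by move=> [c ->]; exists (act w c); exact: rmorphM. Qed.

Lemma rdvd_actE w (x y : S) : rdvd (act w x) y <-> rdvd x (act w^-1%g y).
Proof.
split=> h; first by have := rdvd_act w^-1%g h; rewrite fga_actKV.
by have := rdvd_act w h; rewrite fga_actVK.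
Qed.

Lemma rdvd_xroot u k y : rdvd (xroot u k) y <-> rdvd (xroot 1%g k) (act u^-1%g y).
Proof. by rewrite -[u in xroot u k]mulg1 -fga_act_xroot; exact: rdvd_actE. Qed.

Lemma xroot_simple k : xroot 1%g k = fgaX F (lattice_root L k).
Proof. by rewrite /xroot /lroot lattice_act1. Qed.

Lemma xroot_lreg u k x : xroot u k * x = 0 -> x = 0.
Proof.
have [r [phi [_ _ _ lreg _]]] := fga_simple_root char0 F L k.
move=> /(congr1 (act u^-1%g)) e.
have {}e : fgaX F (lattice_root L k) * act u^-1%g x = 0.
  rewrite -xroot_simple -(mulVg u) -fga_act_xroot.
  apply: etrans (esym (rmorphM (act u^-1%g) _ _)) _.
  by apply: etrans e _; exact: rmorph0.
rewrite -(fga_actVK u x) (lreg _ e); exact: rmorph0.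
Qed.

Lemma xroot_prime u k x y : rdvd (xroot u k) (x * y) ->
  rdvd (xroot u k) x \/ rdvd (xroot u k) y.
Proof.
have [r [phi [ker _ _ _ _]]] := fga_simple_root char0 F L k.
have dvdE z : rdvd (xroot u k) z <-> phi (act u^-1%g z) = 0.
  apply: iff_trans (rdvd_xroot u k z) _; rewrite xroot_simple.
  exact: iff_sym (ker _).
move=> /dvdE e; have {}e : phi (act u^-1%g x) * phi (act u^-1%g y) = 0.
  rewrite -[RHS]e; apply: etrans (esym (rmorphM phi _ _)) _.
  apply: congr1; apply: esym; exact: rmorphM.
have [x0|x0] := eqVneq (phi (act u^-1%g x)) 0; first by left; apply/dvdE.
right; apply/dvdE; exact: (fps_mulf_eq0 e x0).
Qed.

Lemma xroot_ndvd1 u k : ~ rdvd (xroot u k) 1.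
Proof.
have [r [phi [ker _ _ _ _]]] := fga_simple_root char0 F L k.
move=> /rdvd_xroot; rewrite xroot_simple => /ker e.
have : phi 1 = 0.
  rewrite -[RHS]e; apply: congr1; apply: esym; exact: (rmorph1 (act u^-1%g)).
by rewrite rmorph1 => /eqP; rewrite oner_eq0.
Qed.

Lemma xroot_separate u k la mu : rdvd (xroot u k) (fgaX F la - fgaX F mu) ->
  exists m : int, la - mu = lroot u k *~ m.
Proof.
have [r [phi [ker _ sep _ _]]] := fga_simple_root char0 F L k.
move=> /rdvd_xroot; rewrite xroot_simple => /ker e.
have {}e : phi (fgaX F (lattice_act u^-1%g la)) = phi (fgaX F (lattice_act u^-1%g mu)).
  apply/eqP; rewrite -subr_eq0; apply/eqP; apply: etrans _ e.
  apply: etrans (esym (rmorphB phi _ _)) _; apply: congr1.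
  apply: esym; apply: etrans (rmorphB (act u^-1%g) _ _) _.
  exact: (congr2 (fun a b => a - b) (fga_actX _ _ _) (fga_actX _ _ _)).
have [m me] := sep _ _ e; exists m.
have : lattice_act u (lattice_act u^-1%g la - lattice_act u^-1%g mu) =
    lattice_act u (lattice_root L k *~ m) by rewrite me.
by rewrite raddfB raddfMz /= -!lattice_actM mulgV !lattice_act1.
Qed.

Lemma xroot_refl u k x : rdvd (xroot u k) (x - act (refl u k) x).
Proof.
have [r [phi [ker inv _ _ _]]] := fga_simple_root char0 F L k.
apply/rdvd_xroot; rewrite xroot_simple; apply/ker; set y := act u^-1%g x.
have -> : act u^-1%g (x - act (refl u k) x) = y - act (s k) y.
  apply: etrans (rmorphB (act u^-1%g) _ _) _; apply: congr1; apply: congr1.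
  have e : (u^-1 * refl u k)%g = (s k * u^-1)%g by rewrite /refl !mulgA mulVg mul1g.
  apply: etrans (esym (fga_actM _ _ x)) _; rewrite e; exact: fga_actM.
apply: etrans (rmorphB phi _ _) _.
apply: etrans (congr1 (fun t => phi y - t) (inv y)) _; exact: subrr.
Qed.

Lemma xroot_opp u k : exists2 e,
  xroot u k - xroot (u * s k)%g k = xroot u k * e & ~ rdvd (xroot u k) e.
Proof.
have [r [phi [ker _ _ _ [e ee e0]]]] := fga_simple_root char0 F L k.
exists (act u e).
  have e1 : act u (fgaX F (lattice_root L k)) = xroot u k := fga_actX F u _.
  have e2 : act u (fgaX F (- lattice_root L k)) = xroot (u * s k)%g k.
    apply: etrans (fga_actX F u _) _; apply: congr1.
    apply: etrans (raddfN (@lattice_act K n A D L u) _) _; apply: esym; exact: lrootN.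
  apply: etrans (esym (congr2 (fun a b => a - b) e1 e2)) _.
  apply: etrans (esym (rmorphB (act u) _ _)) _.
  apply: etrans (congr1 (act u) ee) _; apply: etrans (rmorphM (act u) _ _) _.
  exact: (congr1 (fun t => t * act u e) e1).
move=> /rdvd_xroot; rewrite xroot_simple fga_actKV => /ker; exact/eqP.
Qed.

Lemma xroot_dvd_opp u k : rdvd (xroot u k) (xroot (u * s k)%g k).
Proof.
have [e /eqP] := xroot_opp u k; rewrite subr_eq addrC -subr_eq => /eqP <- _.
exists (1 - e); apply: esym; apply: etrans (mulrBr _ _ _) _.
by congr (_ - _); exact: mulr1.
Qed.

End Roots.

(** * Localization and the affine Demazure algebra *)

Section Localization.
Context (S : comPzRingType) (G : set S).
Local Notation loc := (loc G).
Local Notation loc_of := (loc_of G).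

Lemma mult_closure_lreg : (forall x, G x -> forall y, x * y = 0 -> y = 0) ->
  forall m, mult_closure G m -> forall y, m * y = 0 -> y = 0.
Proof.
move=> reg _ [l lG ->]; elim: l lG => [|x l IH] lG y; first by rewrite big_nil mul1r.
rewrite big_cons -mulrA => /(reg _ (lG _ (mem_head _ _))).
by apply: IH => z zl; apply: lG; rewrite inE zl orbT.
Qed.

Lemma loc_of_inj : (forall x, G x -> forall y, x * y = 0 -> y = 0) ->
  injective loc_of.
Proof.
move=> reg x y /loc_piP [m mG] /=; rewrite !mulr1 => /eqP.
rewrite -subr_eq0 -mulrBr => /eqP /(mult_closure_lreg reg mG) /eqP.
by rewrite subr_eq0 => /eqP.
Qed.

Lemma loc_fraction (q : loc) : exists a l,
  (forall x, x \in l -> G x) /\ loc_of (\prod_(x <- l) x) * q = loc_of a.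
Proof.
elim/loc_ind: q => x; have [l lG lE] := fdenP x; exists (fnum x), l; split=> //.
by rewrite loc_piE -lE mulrCA loc_den_inv ?mulr1 //; apply: fdenP.
Qed.

Lemma loc_rmorph_eq (T : comPzRingType) (f g : {rmorphism loc -> T}) :
  (forall x, f (loc_of x) = g (loc_of x)) -> f =1 g.
Proof.
move=> fg; elim/loc_ind => x; rewrite loc_piE !rmorphM fg; congr (_ * _).
set p := pzinv _; have e : loc_of (fden x) * p = 1 by apply/loc_den_inv/fdenP.
have ef : g (loc_of (fden x)) * f p = 1 by rewrite -fg -rmorphM e rmorph1.
have eg : g (loc_of (fden x)) * g p = 1 by rewrite -rmorphM e rmorph1.
by rewrite -[f p]mulr1 -eg mulrCA mulrA ef mul1r.
Qed.

Section Lift.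
Context (T : comPzRingType) (f : {rmorphism S -> T}).
Hypothesis fG : forall x, G x -> exists y, f x * y = 1.

Lemma loc_lift_of x : loc_lift f (loc_of x) = f x.
Proof.
rewrite (loc_liftE fG) /= rmorph1.
by rewrite (@pzinv_eq _ 1 1) ?mulr1.
Qed.

Lemma pzinv_liftM m m' : mult_closure G m -> mult_closure G m' ->
  pzinv (f (m * m')) = pzinv (f m) * pzinv (f m').
Proof.
move=> mG m'G; apply: pzinv_eq; rewrite rmorphM mulrACA.
by rewrite (mult_closure_inv fG mG) (mult_closure_inv fG m'G) mulr1.
Qed.

Fact loc_lift_is_zmod_morphism : zmod_morphism (loc_lift f : loc -> T).
Proof.
elim/loc_ind => x; elim/loc_ind => y; rewrite -[- loc_pi y]loc_piN -[loc_pi x + _]loc_piD.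
rewrite !(loc_liftE fG) /= (pzinv_liftM (fdenP x) (fdenP y)).
have := mult_closure_inv fG (fdenP x); have := mult_closure_inv fG (fdenP y).
set p := pzinv (f (fden x)); set p' := pzinv (f (fden y)) => e' e.
rewrite rmorphD !rmorphM rmorphN mulrDl.
transitivity (f (fnum x) * p * (f (fden y) * p') - f (fnum y) * p' * (f (fden x) * p)).
  by ring.
by rewrite e e' !mulr1.
Qed.
Fact loc_lift_is_monoid_morphism : monoid_morphism (loc_lift f : loc -> T).
Proof.
split=> [|q q']; first by rewrite -[1]/(loc_of 1) loc_lift_of rmorph1.
move: q q'; elim/loc_ind => x; elim/loc_ind => y; rewrite -[loc_pi x * _]loc_piM.
rewrite !(loc_liftE fG) /= (pzinv_liftM (fdenP x) (fdenP y)) rmorphM.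
by ring.
Qed.
End Lift.

End Localization.

(** * Coefficients and action in the twisted group algebra *)

Lemma mcoeff_sum_mono (V : zmodType) (T : choiceType) (d : {fset T}) (E : T -> V)
    (h : T -> T) x : injective h ->
  monalg.mcoeff (h x) (\sum_(w <- d) << E w *g h w >> : {malg V[T]}) =
  if x \in d then E x else 0.
Proof.
move=> inj; rewrite raddf_sum /=.
rewrite (eq_bigr (fun w => if w == x then E w else 0)); last first.
  by move=> w _; rewrite monalg.mcoeffU (inj_eq inj); case: eqP.
case: ifP => [xd|/negbT xd].
  rewrite (big_fsetD1 x xd) /= eqxx big1_fset ?addr0 // => w.
  by rewrite !inE => /andP [/negbTE ->].
by rewrite big1_fset // => w wd _; case: eqP => // wx; rewrite -wx wd in xd.
Qed.

Lemma big_fset_single (V : zmodType) (T : choiceType) (d : {fset T}) (E : T -> V) v :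
  v \in d -> (forall w, w != v -> E w = 0) -> \sum_(w <- d) E w = E v.
Proof.
move=> vd Ev; rewrite (big_fsetD1 v vd) /= big1_fset ?addr0 // => w.
by rewrite !inE => /andP [/Ev].
Qed.

Lemma big_fset_pair (V : zmodType) (T : choiceType) (E : T -> V) v w :
  v != w -> \sum_(x <- [fset v; w]%fset) E x = E v + E w.
Proof. by move=> vw; rewrite big_fsetU1 ?inE //= big_seq_fset1. Qed.

Lemma msupp_sub2 (V : zmodType) (T : choiceType) (z : {malg V[T]}) v w :
  (forall x, x != v -> x != w -> monalg.mcoeff x z = 0) ->
  (monalg.msupp z `<=` [fset v; w])%fset.
Proof.
move=> h; apply/fsubsetP => x xz; rewrite in_fset2.
apply: contraLR xz => /norP [xv xw]; rewrite -monalg.mcoeff_eq0.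
by rewrite h.
Qed.

Lemma mulr_bool_sub (T : pzRingType) (p a b : T) :
  p * (true%:R - false%:R) * a + p * (false%:R - true%:R) * b = p * (a - b).
Proof. by rewrite subr0 sub0r mulr1 mulrN1 mulNr mulrBr. Qed.

Lemma mulr_perm4 (T : comPzRingType) (c q x e : T) :
  c * (q * (x * e)) = c * e * (x * q).
Proof. by ring. Qed.

Lemma mulr_perm5 (T : comPzRingType) (c x m q : T) :
  c * (x * m * q) = x * (m * (c * q)).
Proof. by ring. Qed.

Lemma mulr_perm6 (T : comPzRingType) (c q x m : T) :
  c * (q * (x * m)) = c * (x * q) * m.
Proof. by ring. Qed.

Lemma mulr_cancel2 (T : comPzRingType) (x y a : T) : x * y = 1 -> y * (x * a) = a.
Proof. by move=> e; rewrite mulrA [y * x]mulrC e mul1r. Qed.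

Lemma mulr_cancel3 (T : comPzRingType) (x y m q : T) :
  x * y = 1 -> y * (x * m * q) = m * q.
Proof. by move=> e; rewrite -mulrA (mulr_cancel2 _ e). Qed.

Lemma mulr_cancelN (T : comPzRingType) (x y a b : T) :
  x * y = 1 -> - (x * a) * (y * - b) = a * b.
Proof.
by move=> e; rewrite mulrN mulNr mulrN opprK mulrACA e mul1r.
Qed.

Lemma subr_sub0K (V : zmodType) (x y : V) : x = x - y - (0 - y).
Proof. by rewrite sub0r opprK subrK. Qed.

Section AffineDemazure.
Context (R : idomainType) (char0 : [pchar R] =i pred0) (F : fgl R).
Context (K : realType) (n : nat) (A : gcm n) (D : root_datum K A).
Context (L : demazure_lattice D).
Local Notation Lam := (lattice_elt L).
Local Notation S := (fga F L).
Local Notation W := (weyl D).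
Local Notation s := (simple_weyl D).
Local Notation al := (simple_root D).
Local Notation act := (fga_act F L).
Local Notation Q := (fga_loc F L).
Local Notation incl := (@loc_incl R F K n A D L).
Local Notation xroot := (xroot F L).
Local Notation len := (@weyl_length K n A D).
Local Notation G := [set fgaX F be | be in positive_roots L].

HB.instance Definition _ := GRing.RMorphism.copy incl (loc_of G).

Lemma nneg_lattice (la : Lam) : nneg (lattice_val la) <->
  exists c : 'I_n -> nat, la = \sum_i lattice_root L i *+ c i.
Proof.
have E (c : 'I_n -> nat) : lattice_val (\sum_i lattice_root L i *+ c i) =
    \sum_i al i *+ c i.
  by rewrite raddf_sum; apply: eq_bigr => i _; rewrite raddfMn.
split=> -[c]; first by move=> e; exists c; apply: val_inj; rewrite /= E.
by move=> ->; exists c; rewrite E.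
Qed.

Lemma positive_rootsP be : positive_roots L be <->
  exists (u : W) k, be = lroot L u k /\ nneg (u (al k)).
Proof.
split=> [[[u [k ->]] /nneg_lattice h]|[u [k [-> h]]]].
  by exists u, k.
by split; [exists u, k|apply/nneg_lattice].
Qed.

Lemma positive_xroot (u : W) k : nneg (u (al k)) -> G (xroot u k).
Proof. by move=> h; exists (lroot L u k) => //; apply/positive_rootsP; exists u, k. Qed.

Lemma positive_lreg x : G x -> forall y, x * y = 0 -> y = 0.
Proof.
move=> [be /positive_rootsP [u [k [-> _]]] <-] y; exact: (xroot_lreg char0).
Qed.

Lemma incl_inj : injective incl.
Proof. exact: (loc_of_inj positive_lreg). Qed.

(** For a negative root, [x_al] divides [x_(- al)], which is one of the denominators of [Q]. *)
Lemma xroot_unit (u : W) k : exists y, incl (xroot u k) * y = 1.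
Proof.
have pos (u' : W) : nneg (u' (al k)) -> incl (xroot u' k) * pzinv (incl (xroot u' k)) = 1.
  by move=> h; apply/loc_den_inv/sub_mult_closure/positive_xroot.
have [h|h] := weyl_root_sign u k; first by exists (pzinv (incl (xroot u k))); exact: pos.
have [c ce] := xroot_dvd_opp char0 F L u k.
have := pos (u * s k)%g; rewrite weyl_simpleN ce => /(_ h) e.
exists (incl c * pzinv (incl (xroot u k * c))); apply: etrans (mulrA _ _ _) _.
by rewrite -rmorphM.
Qed.

Let f w : {rmorphism S -> Q} := incl \o act w.

(** The hypothesis of the universal property of the localization: with it, [fga_loc_act] is a ring
    morphism. *)
Lemma act_positive_unit w x : G x -> exists y, f w x * y = 1.
Proof.
move=> [be /positive_rootsP [u [k [-> _]]] <-]; rewrite /f /=.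
have [y e] := xroot_unit (w * u)%g k; exists y.
by rewrite -e -fga_act_xroot.
Qed.

Local Notation qact := (@fga_loc_act R F K n A D L).

HB.instance Definition _ w := GRing.isZmodMorphism.Build Q Q (qact w)
  (loc_lift_is_zmod_morphism (@act_positive_unit w)).
HB.instance Definition _ w := GRing.isMonoidMorphism.Build Q Q (qact w)
  (loc_lift_is_monoid_morphism (@act_positive_unit w)).

Lemma qact_incl w x : qact w (incl x) = incl (act w x).
Proof. exact: (loc_lift_of (@act_positive_unit w)). Qed.

Lemma qactM v w q : qact (v * w)%g q = qact v (qact w q).
Proof.
pose g : {rmorphism Q -> Q} := qact v \o qact w.
apply: (@loc_rmorph_eq _ _ _ (qact (v * w)%g) g) => x.
apply: etrans (qact_incl _ _) _; apply: etrans (congr1 incl (fga_actM _ _ _)) _.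
apply: esym; apply: etrans (congr1 (qact v) (qact_incl w x)) _; exact: qact_incl.
Qed.

Lemma qact1 q : qact 1%g q = q.
Proof.
apply: (@loc_rmorph_eq _ _ _ (qact 1%g) idfun) => x.
apply: etrans (qact_incl _ _) _; apply: congr1; exact: fga_act1.
Qed.

Local Notation tw := (twisted F L).
Local Notation cf z w := (monalg.mcoeff w z).
Implicit Types z : tw.

Lemma tw_actEw (d : {fset W}) z q : (msupp z `<=` d)%fset ->
  tw_act z q = \sum_(w <- d) cf z w * qact w q.
Proof.
move=> zd; rewrite /tw_act (big_fset_incl _ zd) // => w _.
by rewrite -mcoeff_eq0 => /eqP ->; rewrite mul0r.
Qed.

Lemma tw_actB z z' q : tw_act (z - z') q = tw_act z q - tw_act z' q.
Proof.
rewrite !(@tw_actEw (msupp z `|` msupp z')%fset) ?fsubsetUl ?fsubsetUr //.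
  by rewrite -sumrB; apply: eq_bigr => w _; rewrite monalg.mcoeffB mulrBl.
exact: msuppB_le.
Qed.

Lemma tw_act_sum (I : Type) (r : seq I) (E : I -> tw) q :
  tw_act (\sum_(i <- r) E i) q = \sum_(i <- r) tw_act (E i) q.
Proof.
have act0 : tw_act (0 : tw) q = 0 by rewrite -(subrr (0 : tw)) tw_actB subrr.
have actD z z' : tw_act (z + z') q = tw_act z q + tw_act z' q.
  have -> : z + z' = z - (0 - z') by rewrite sub0r opprK.
  by rewrite !tw_actB act0 sub0r opprK.
elim: r => [|i r IH]; first by rewrite !big_nil.
by rewrite !big_cons actD IH.
Qed.

Lemma tw_act_mono q w q' : tw_act (tw_mono q w) q' = q * qact w q'.
Proof.
rewrite (@tw_actEw [fset w]%fset) ?msuppU_le //.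
by rewrite big_seq_fset1 mcoeffUU.
Qed.

Lemma tw_act_scale q z q' : tw_act (tw_scale q z) q' = q * tw_act z q'.
Proof.
rewrite /tw_scale tw_act_sum mulr_sumr.
by apply: eq_bigr => w _; rewrite tw_act_mono mulrA.
Qed.

Lemma tw_act_mul z z' q : tw_act (tw_mul z z') q = tw_act z (tw_act z' q).
Proof.
rewrite /tw_mul tw_act_sum; apply: eq_bigr => w _.
rewrite tw_act_sum raddf_sum mulr_sumr.
apply: eq_bigr => w' _; rewrite tw_act_mono qactM.
apply: etrans (esym (mulrA _ _ _)) _; apply: congr1; apply: esym.
exact: (rmorphM (qact w)).
Qed.

Lemma mcoeff_tw_mul0 (q : Q) z v :
  (if v \in monalg.msupp z then q * cf z v else 0) = q * cf z v.
Proof.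
case: ifP => // /negbT; rewrite -monalg.mcoeff_eq0 => /eqP ->; exact: esym (mulr0 q).
Qed.

Lemma mcoeff_scale q z v : cf (tw_scale q z) v = q * cf z v.
Proof.
apply: etrans (mcoeff_sum_mono _ (fun w => q * cf z w) v (h := id) _) _ => //.
exact: mcoeff_tw_mul0.
Qed.

Lemma mcoeff_mono_mul q u z v :
  cf (tw_mul (tw_mono q u) z) v = q * qact u (cf z (u^-1 * v)%g).
Proof.
have U0 : monalg.msupp (tw_mono q u) = if q == 0 then fset0 else [fset u]%fset.
  exact: monalg.msuppU.
rewrite /tw_mul U0; have [->|q0] := eqVneq q 0.
  by rewrite big_seq_fset0 mul0r raddf0.
rewrite big_seq_fset1 monalg.mcoeffUU -{1}(mulVKg u v).
have e := mcoeff_sum_mono (monalg.msupp z) (fun w => q * qact u (cf z w))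
  (u^-1 * v)%g (@mulgI _ u).
apply: etrans e _.
case: ifP => // /negbT; rewrite -monalg.mcoeff_eq0 => /eqP ->.
by rewrite rmorph0 mulr0.
Qed.

Lemma mcoeff_mul z z' v : cf (tw_mul z z') v =
  \sum_(w <- monalg.msupp z) cf z w * qact w (cf z' (w^-1 * v)%g).
Proof.
rewrite /tw_mul raddf_sum; apply: eq_bigr => w _.
have e := mcoeff_sum_mono (monalg.msupp z') (fun w' => cf z w * qact w (cf z' w'))
  (w^-1 * v)%g (@mulgI _ w).
rewrite mulVKg in e; apply: etrans e _.
case: ifP => // /negbT; rewrite -monalg.mcoeff_eq0 => /eqP ->.
by rewrite rmorph0 mulr0.
Qed.

Lemma mcoeff_mulEw (d : {fset W}) z z' v : (monalg.msupp z `<=` d)%fset ->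
  cf (tw_mul z z') v = \sum_(w <- d) cf z w * qact w (cf z' (w^-1 * v)%g).
Proof.
move=> zd; rewrite mcoeff_mul (big_fset_incl _ zd) // => w _.
rewrite -monalg.mcoeff_eq0 => /eqP ->; exact: mul0r.
Qed.

Lemma mcoeff_mulr_mono z (b : S) v :
  cf (tw_mul z (tw_mono (incl b) 1%g)) v = cf z v * incl (act v b).
Proof.
rewrite (@mcoeff_mulEw (v |` monalg.msupp z)%fset) ?fsubsetUr //.
have vd : v \in (v |` monalg.msupp z)%fset by rewrite !inE eqxx.
apply: etrans (big_fset_single vd _) _ => [w wv|].
  rewrite monalg.mcoeffU -(inj_eq (@mulgI _ w)) mulg1 mulVKg (negbTE wv).
  rewrite mulr0n rmorph0; exact: mulr0.
by rewrite mulVg monalg.mcoeffUU qact_incl.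
Qed.

Lemma simple_weyl_neq1 i : s i != 1%g.
Proof.
apply/eqP => e; apply: (@nneg_simple_root K n A D i).
rewrite -simple_weyl_root e weyl1E; exact: nneg_root.
Qed.

Lemma mcoeff_demazure_mul i z v :
  cf (tw_mul (demazure_elt F L 1%g i) z) v =
  pzinv (incl (xroot 1%g i)) * (cf z v - qact (s i) (cf z (s i * v)%g)).
Proof.
set p := pzinv _.
have cE w : cf (demazure_elt F L 1%g i) w = p * ((1%g == w)%:R - (s i == w)%:R).
  rewrite /demazure_elt mcoeff_scale invg1 mulg1 mul1g.
  apply: etrans (congr1 _ (raddfB (monalg.mcoeff w) _ _)) _.
  have E u : cf (tw_delta F L u) w = (u == w)%:R by exact: monalg.mcoeffU.
  exact: (congr2 (fun a b => p * (a - b)) (E 1%g) (E (s i))).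
have sub : (monalg.msupp (demazure_elt F L 1%g i) `<=` [fset 1%g; s i])%fset.
  apply: msupp_sub2 => w w1 ws; apply: etrans (cE w) _.
  rewrite ![_ == w]eq_sym (negbTE w1) (negbTE ws) subrr; exact: mulr0.
have s1 : 1%g != s i by rewrite eq_sym simple_weyl_neq1.
rewrite (mcoeff_mulEw _ _ sub) (big_fset_pair _ s1) !cE !eqxx (negbTE s1).
rewrite (negbTE (simple_weyl_neq1 i)); apply: etrans (mulr_bool_sub _ _ _) _.
by rewrite invg1 mul1g simple_weylV [qact 1%g _]qact1.
Qed.

Lemma tw_act_delta w (x : S) : tw_act (tw_delta F L w) (incl x) = incl (act w x).
Proof. by rewrite tw_act_mono mul1r qact_incl. Qed.

(** * Elements preserving [S] and their poles *)

Definition integral z := forall x : S, exists y : S, tw_act z (incl x) = incl y.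

Lemma integral_subalgebra : tw_subalgebra integral.
Proof.
split=> [x|z z' hz hz' x|z z' hz hz' x|c z hz x].
- by exists x; rewrite tw_act_mono qact1 mul1r.
- have [y e] := hz x; have [y' e'] := hz' x; exists (y - y').
  rewrite tw_actB e e'; exact: esym (rmorphB incl _ _).
- have [y' e'] := hz' x; have [y e] := hz y'; exists y.
  by rewrite tw_act_mul e'.
have [y e] := hz x; exists (fgaC F L c * y); rewrite tw_act_scale e.
exact: esym (rmorphM incl _ _).
Qed.

Lemma integral_mono b : integral (tw_mono (incl b) 1%g).
Proof.
move=> x; exists (b * x); rewrite tw_act_mono qact1; exact: esym (rmorphM incl _ _).
Qed.

Lemma integral_demazure w i : integral (demazure_elt F L w i).
Proof.
move=> x; have [y e] := xroot_refl char0 w i x; exists y.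
have [t xt] := xroot_unit w i.
have e2 : tw_act (tw_delta F L 1%g - tw_delta F L (refl w i)) (incl x) =
    incl (xroot w i) * incl y.
  apply: etrans (tw_actB _ _ _) _.
  apply: etrans (congr2 (fun a b => a - b) (tw_act_delta _ _) (tw_act_delta _ _)) _.
  apply: etrans (esym (rmorphB incl _ _)) _.
  apply: etrans (congr1 incl (etrans (congr1 (fun a => a - _) (fga_act1 x)) e)) _.
  exact: (rmorphM incl).
apply: etrans (tw_act_scale _ _ _) _; apply: etrans (congr1 _ e2) _.
apply: etrans (congr1 (fun p => p * _) (pzinv_eq xt)) _.
apply: etrans (mulrA _ _ _) _; apply: etrans (congr1 (fun p => p * _) (mulrC _ _)) _.
apply: etrans (congr1 (fun p => p * _) xt) _; exact: mul1r.
Qed.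

Lemma affine_demazure_integral z : affine_demazure F L z -> integral z.
Proof.
move=> hz; apply: hz; [exact: integral_subalgebra|exact: integral_mono|].
exact: integral_demazure.
Qed.

Lemma integral_scale (b : S) z : integral z -> integral (tw_scale (incl b) z).
Proof.
move=> hz x; have [y e] := hz x; exists (b * y).
apply: etrans (tw_act_scale _ _ _) _; apply: etrans (congr1 _ e) _.
exact: esym (rmorphM incl _ _).
Qed.

(** If every difference were divisible, taking [b = x_la] would give [w la - w' la] in the multiples
    of the root [u (al k)], for all [la]. The element [g] below would then act trivially modulo
    [al k], hence be 1 or [s k], which are the two excluded cases. *)
Lemma root_neq_separate (u w w' : W) k : w' <> w -> w' <> (refl u k * w)%g ->
  exists b, ~ rdvd (xroot u k) (act w b - act w' b).
Proof.
move=> w'w w'r; apply: contrapT => /forallNP h.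
have sep (la : Lam) : exists m : int,
    lattice_act w la - lattice_act w' la = lroot L u k *~ m.
  have hla := contrapT (h (fgaX F la)).
  have e := congr2 (fun a b : S => a - b) (fga_actX F w la) (fga_actX F w' la).
  apply: (xroot_separate char0); exact: (eq_ind _ (rdvd (xroot u k)) hla _ e).
pose g : W := (u^-1 * w' * w^-1 * u)%g.
have gE j : exists m : int, g (al j) = al j + al k *~ m.
  (* The test weight is chosen so that [w] sends it to [u (al j)] and [w'] sends it to
     [u (g (al j))]. *)
  have [m me] := sep (lroot L (w^-1 * u)%g j); exists (- m).
  have eV : w ((w^-1 * u)%g (al j)) - w' ((w^-1 * u)%g (al j)) = u (al k) *~ m.
    have := congr1 (@lattice_val K n A D L) me.
    by rewrite raddfB raddfMz.
  have eg : u (g (al j)) = w' ((w^-1 * u)%g (al j)).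
    by rewrite -!weylME /g !mulgA mulgV mul1g.
  have ew : w ((w^-1 * u)%g (al j)) = u (al j).
    by rewrite -!weylME !mulgA mulgV mul1g.
  rewrite ew -eg in eV.
  have : u^-1%g (u (al j) - u (g (al j))) = u^-1%g (u (al k) *~ m) by rewrite eV.
  rewrite raddfB raddfMz /= !weylKV => /eqP; rewrite subr_eq addrC -subr_eq => /eqP <-.
  by rewrite mulrNz.
have w'g : w' = (u * g * u^-1 * w)%g.
  by rewrite /g !mulgA mulgV mul1g mulgK mulgVK.
case: (weyl_transvection gE) => ge; rewrite ge in w'g.
  by apply: w'w; rewrite w'g mulg1 mulgV mul1g.
exact: (w'r w'g).
Qed.

(* [z b - w'(b) z] has coefficient [z_v (v(b) - w'(b))] at [v]: the support of
   [z] can be shrunk to [{w}] at the cost of a factor prime to [x_(u al_k)]. *)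
Lemma integral_isolate (u w : W) k (l : seq W) z : integral z ->
  (forall v, cf z v <> 0 -> v = w \/ v \in l) ->
  (forall v, v \in l -> v <> w /\ v <> (refl u k * w)%g) ->
  exists2 c : S, ~ rdvd (xroot u k) c & exists t : S, incl c * cf z w = incl t.
Proof.
elim: l z => [|w' l IH] z hz supp hl.
  exists 1; first exact: (xroot_ndvd1 char0).
  (* With support in [{w}], acting on 1 returns the coefficient itself. *)
  have [t e] := hz 1; exists t; rewrite -e.
  have sub : (monalg.msupp z `<=` [fset w; w])%fset.
    apply: msupp_sub2 => x xw _; apply: contrapT => /supp [xw'|//].
    by rewrite xw' eqxx in xw.
  rewrite (tw_actEw _ sub) fsetUid big_seq_fset1.
  apply: etrans (congr1 (fun p => p * _) (rmorph1 incl)) _.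
  apply: etrans (mul1r _) _; apply: esym.
  apply: etrans (congr1 _ (qact_incl w 1)) _.
  apply: etrans (congr1 (fun a => _ * incl a) (rmorph1 (act w))) _.
  apply: etrans (congr1 _ (rmorph1 incl)) _; exact: mulr1.
have [w'w w'r] := hl _ (mem_head _ _).
have [b hb] := root_neq_separate w'w w'r.
pose z1 : tw := tw_mul z (tw_mono (incl b) 1%g) - tw_scale (incl (act w' b)) z.
have z1E v : cf z1 v = cf z v * incl (act v b - act w' b).
  apply: etrans (raddfB (monalg.mcoeff v) _ _) _.
  apply: etrans (congr2 (fun a b => a - b) (mcoeff_mulr_mono z b v)
    (etrans (mcoeff_scale _ z v) (mulrC _ _))) _.
  apply: etrans (esym (mulrBr _ _ _)) _; apply: congr1; exact: esym (rmorphB incl _ _).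
have hz1 : integral z1.
  have [_ hB hM _] := integral_subalgebra.
  exact: (hB _ _ (hM _ _ hz (integral_mono b)) (integral_scale _ hz)).
have [||c hc [t ht]] := IH z1 hz1.
- move=> v; rewrite z1E => v0.
  have [v0'|] : cf z v = 0 \/ cf z v <> 0 by exact: EM.
    by rewrite v0' mul0r in v0.
  move=> /supp [|]; first by left.
  rewrite inE => /orP [/eqP vw'|]; last by right.
  case: v0; rewrite vw' subrr; apply: etrans (congr1 _ (rmorph0 incl)) _; exact: mulr0.
- by move=> v vl; apply: hl; rewrite inE vl orbT.
exists (c * (act w b - act w' b)); first by move=> /(xroot_prime char0) [].
exists t; rewrite -ht z1E; apply: etrans (congr1 (fun a => a * _) (rmorphM incl _ _)) _.
apply: etrans (esym (mulrA _ _ _)) _; apply: congr1; exact: mulrC.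
Qed.

Lemma integral_regular (u w : W) k z : integral z -> cf z (refl u k * w)%g = 0 ->
  exists2 c : S, ~ rdvd (xroot u k) c & exists t : S, incl c * cf z w = incl t.
Proof.
move=> hz zr; apply: (@integral_isolate u w k
  [seq v <- monalg.msupp z | (v != w) && (v != refl u k * w)%g] z hz).
- move=> v v0; have [->|vw] := eqVneq v w; [by left|right].
  have vr : v != (refl u k * w)%g by apply/eqP => vr; apply: v0; rewrite vr.
  have vz : v \in monalg.msupp z by rewrite -monalg.mcoeff_neq0; apply/eqP.
  rewrite mem_filter; apply/andP; split; last exact: vz.
  apply/andP; exact: conj vw vr.
by move=> v; rewrite mem_filter => /andP [/andP [/eqP ? /eqP ?] _].
Qed.

(** For [b] the preimage of [x_al] by [w], killing the coefficient at [s_al w] multiplies the one at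
    [w] by [x_al - x_(- al) = x_al e]. As [e] is prime to [x_al], [integral_regular] bounds the
    pole. *)
Lemma integral_simple_pole (u w : W) k z : integral z ->
  exists2 c : S, ~ rdvd (xroot u k) c &
    exists t : S, incl c * (incl (xroot u k) * cf z w) = incl t.
Proof.
move=> hz; have [e ee he] := xroot_opp char0 F L u k.
pose b := act w^-1%g (xroot u k).
pose z1 : tw := tw_mul z (tw_mono (incl b) 1%g) - tw_scale (incl (act (refl u k * w)%g b)) z.
have z1E v : cf z1 v = cf z v * incl (act v b - act (refl u k * w)%g b).
  apply: etrans (raddfB (monalg.mcoeff v) _ _) _.
  apply: etrans (congr2 (fun a b => a - b) (mcoeff_mulr_mono z b v)
    (etrans (mcoeff_scale _ z v) (mulrC _ _))) _.
  apply: etrans (esym (mulrBr _ _ _)) _; apply: congr1; exact: esym (rmorphB incl _ _).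
have hz1 : integral z1.
  have [_ hB hM _] := integral_subalgebra.
  exact: (hB _ _ (hM _ _ hz (integral_mono b)) (integral_scale _ hz)).
have [|c hc [t ht]] := @integral_regular u w k z1 hz1.
  rewrite z1E subrr; apply: etrans (congr1 _ (rmorph0 incl)) _; exact: mulr0.
exists (c * e); first by move=> /(xroot_prime char0) [].
exists t; rewrite -ht z1E.
have -> : act w b - act (refl u k * w)%g b = xroot u k * e.
  rewrite /b fga_actVK fga_actM fga_actVK fga_act_xroot -ee /refl.
  by rewrite -mulgA mulVg mulg1.
apply: etrans (congr1 (fun a => a * _) (rmorphM incl _ _)) _.
apply: esym; apply: etrans (congr1 (fun a => _ * (_ * a)) (rmorphM incl _ _)) _.
exact: mulr_perm4.
Qed.

(** If [x] is a factor of a denominator of [q], with numerator [a], then [c q] in [S] shows that [x]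
    divides [c a]. Being prime, it divides [a] and can be cancelled; the number of factors
    decreases. *)
Lemma loc_regular (q : Q) :
  (forall (u : W) k, nneg (u (al k)) ->
    exists2 c : S, ~ rdvd (xroot u k) c & exists t : S, incl c * q = incl t) ->
  exists t : S, q = incl t.
Proof.
move=> hq; have [a [l [lG]]] := loc_fraction q.
elim: l lG a => [|x l IH] lG a.
  rewrite big_nil => e; exists a; rewrite -[RHS]e.
  apply: esym; apply: etrans (congr1 (fun p => p * q) (rmorph1 incl)) _; exact: mul1r.
have [be /positive_rootsP [u [k [beE pos]]] xE] := lG _ (mem_head _ _).
have {}xE : x = xroot u k by rewrite -xE beE.
rewrite big_cons => e; have [c hc [t ht]] := hq u k pos.
set m := \prod_(y <- l) y in IH e *.
have e1 : c * a = x * (m * t).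
  apply: incl_inj; apply: etrans (rmorphM incl _ _) _.
  apply: esym; apply: etrans (rmorphM incl _ _) _.
  apply: etrans (congr1 (fun p => _ * p) (rmorphM incl _ _)) _.
  apply: etrans (congr1 (fun p => _ * (_ * p)) (esym ht)) _.
  apply: etrans (esym (mulr_perm5 _ _ _ _)) _; apply: congr1.
  apply: etrans (congr1 (fun p => p * q) (esym (rmorphM incl _ _))) _; exact: e.
have dv : rdvd (xroot u k) (c * a) by exists (m * t); rewrite -xE; exact: e1.
have [/hc []|[a' ae]] := xroot_prime char0 dv.
have [y xy] := xroot_unit u k; rewrite -xE in xy ae.
apply: (IH _ a') => [z zl|]; first by apply: lG; rewrite inE zl orbT.
have : y * (loc_of G (x * m) * q) = y * loc_of G (x * a') by rewrite e ae.
move=> h; apply: etrans _ (etrans h _).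
  apply: esym; apply: etrans (congr1 (fun p => _ * (p * _)) (rmorphM (loc_of G) _ _)) _.
  exact: (mulr_cancel3 _ _ xy).
apply: etrans (congr1 _ (rmorphM (loc_of G) _ _)) _; exact: (mulr_cancel2 _ xy).
Qed.

(** Up to sign, [N] is the product of the [x_be] over the positive roots [be] that the inverse of
    the word makes negative. The statement records divisibility by each single factor, which is
    enough to absorb simple poles. *)
Lemma demazure_word t : size t = len (word_weyl D t) -> exists (Y : tw) (N : S),
  [/\ affine_demazure F L Y,
      forall v, cf Y v <> 0 -> v = word_weyl D t \/ (len v < size t)%N,
      incl N * cf Y (word_weyl D t) = 1 &
      forall (u : W) k, nneg (u (al k)) ->
        nneg (- (word_weyl D t)^-1%g (u (al k))) -> rdvd (xroot u k) N].
Proof.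
elim: t => [|i t IH] red.
  exists (tw_delta F L 1%g), 1; split.
  - by move=> B [].
  - move=> v v0; left; apply: contrapT => v1; apply: v0.
    apply: etrans (monalg.mcoeffU _ _ _) _; case: eqP => [e|_]; last exact: mulr0n.
    by exfalso; apply: v1; rewrite -e.
  - apply: etrans (congr1 (fun p => p * _) (rmorph1 incl)) _.
    apply: etrans (mul1r _) _; exact: monalg.mcoeffUU.
  - move=> u k pos; rewrite invg1 weyl1E => neg; exfalso.
    apply: (@nneg_simple_root K n A D k).
    by rewrite -(weylKV u (al k)) (nneg_anti pos neg) linear0 oppr0; exact: nneg0.
have redt : size t = len (word_weyl D t).
  apply/eqP; rewrite eqn_leq length_word andbT -ltnS.
  by rewrite [X in (X <= _)%N](_ : _ = len (word_weyl D (i :: t))) ?length_simpleM.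
have [Y [N [hY suppY NY divN]]] := IH redt.
set w' := word_weyl D t in suppY NY divN redt *.
rewrite [word_weyl D _]/= -/w' [size _]/= in red *; set w := (s i * w')%g in red *.
pose p := pzinv (incl (xroot 1%g i)).
exists (tw_mul (demazure_elt F L 1%g i) Y), (- (xroot 1%g i * act (s i) N)); split.
- move=> B hB hS hX; have [_ _ BM _] := hB.
  by apply: BM; [exact: hX|exact: hY].
- move=> v; rewrite mcoeff_demazure_mul => v0.
  have [Yv|Yv] := EM (cf Y v = 0); last first.
    right; case: (suppY v Yv) => [->|lt]; first by rewrite -redt.
    exact: ltnW.
  have [Yv'|Yv'] := EM (cf Y (s i * v)%g = 0).
    exfalso; apply: v0; rewrite Yv Yv'.
    apply: etrans (congr1 (fun a => _ * (0 - a)) (rmorph0 (qact (s i)))) _.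
    apply: etrans (congr1 (fun a => _ * a) (subrr 0)) _; exact: mulr0.
  have vE : v = (s i * (s i * v))%g by rewrite mulgA simple_weylK mul1g.
  case: (suppY _ Yv') => [e|lt]; first by left; rewrite vE e.
  by right; rewrite vE (leq_ltn_trans (length_simpleM _ _)).
(* [w] is longer than every element of the support of [Y], so only the reflected term contributes,
   with a minus sign that [N] compensates. *)
- have Yw : cf Y w = 0.
    apply: contrapT => /suppY [ww'|]; last by rewrite ltnNge -red leqnSn.
    by move: redt; rewrite -ww' -red; clear; lia.
  rewrite mcoeff_demazure_mul Yw sub0r.
  have -> : (s i * w)%g = w' by rewrite /w mulgA simple_weylK mul1g.
  have [y xy] := xroot_unit 1%g i; rewrite (pzinv_eq xy).
  apply: etrans (congr1 (fun p => p * _) (rmorphN incl _)) _.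
  apply: etrans (congr1 (fun p => - p * _) (rmorphM incl _ _)) _.
  apply: etrans (mulr_cancelN _ _ xy) _.
  apply: etrans (congr1 (fun p => p * _) (esym (qact_incl (s i) N))) _.
  apply: etrans (esym (rmorphM (qact (s i)) _ _)) _.
  apply: etrans (congr1 (qact (s i)) NY) _; exact: rmorph1.
move=> u k pos neg.
have dvdN x y : rdvd x y -> rdvd x (- y).
  by move=> [c ->]; exists (- c); rewrite mulrN.
(* The inversions for [w] are [al i] and the images by [s i] of those for [w']. *)
apply: (dvdN); have [uki|uki] := EM (u (al k) = al i).
  have xe : xroot 1%g i = xroot u k.
    rewrite /xroot; apply: congr1; apply: val_inj.
    change ((1%g : W) (al i) = u (al k)); by rewrite weyl1E uki.
  exists (act (s i) N); exact: (congr1 (fun p => p * act (s i) N) xe).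
have siu : nneg ((s i * u)%g (al k)).
  by rewrite weylME; exact: simple_weyl_nneg.
have siuN : nneg (- w'^-1%g ((s i * u)%g (al k))).
  by move: neg; rewrite /w invgM weylME simple_weylV weylME.
have [c Nc] := divN _ _ siu siuN.
exists (xroot 1%g i * act (s i) c).
have e : act (s i) N = xroot u k * act (s i) c.
  apply: etrans (congr1 (act (s i)) Nc) _; apply: etrans (rmorphM (act (s i)) _ _) _.
  apply: (congr1 (fun p => p * act (s i) c)).
  by rewrite fga_act_xroot mulgA simple_weylK mul1g.
apply: etrans (congr1 (fun p => xroot 1%g i * p) e) _; exact: mulrCA.
Qed.

Lemma integral_affine_demazure z : integral z -> affine_demazure F L z.
Proof.
have sub0 z' : (forall v, cf z' v = 0) -> affine_demazure F L z'.
  move=> h; have -> : z' = 0 by apply/malgP => v; rewrite h monalg.mcoeff0.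
  move=> B [B1 BB _ _] _ _; rewrite -(subrr (tw_delta F L 1%g)); exact: BB.
suff main N z' : integral z' -> (forall v, cf z' v <> 0 -> (len v < N)%N) ->
    affine_demazure F L z'.
  move=> hz; pose N := (\max_(v <- monalg.msupp z) len v).+1.
  apply: (main N z hz) => v /eqP; rewrite monalg.mcoeff_neq0 => vz.
  by rewrite ltnS (big_fsetD1 v vz) /= leq_maxl.
elim: N z' => [|N IHN] z' hz' supp.
  by apply: sub0 => v; apply: contrapT => /supp.
(* [l] contains the elements of top length [N] that may remain in the support. They are removed one
   at a time, since subtracting a multiple of [Y] affects only [w] and shorter elements. *)
have H (l : seq W) : (forall v, v \in l -> len v = N) -> forall z', integral z' ->
    (forall v, cf z' v <> 0 -> (len v < N)%N \/ v \in l) -> affine_demazure F L z'.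
  elim: l => [|w l IHl] hl {hz' supp}z' hz' supp.
    by apply: IHN => // v /supp [].
  have wN : len w = N by apply: hl; rewrite mem_head.
  have len_gt v : (N < len v)%N -> cf z' v = 0.
    move=> vN; apply: contrapT => /supp [vN'|/hl vN']; move: vN.
      by rewrite ltnNge ltnW.
    by rewrite vN' ltnn.
  have [t wt tN] := reduced_word w.
  have [|Y [M [hY suppY MY divM]]] := @demazure_word t; first by rewrite -wt.
  rewrite -wt in suppY MY divM.
  (* Each positive root is tested separately: either [M] absorbs the simple pole, or [z'] has no
     term at the reflected element. *)
  have [c ce] : exists c, cf z' w * incl M = incl c.
    apply: loc_regular => u k pos.
    have [neg|neg] := weyl_root_sign (w^-1 * u)%g k; last first.
      have [m' ->] := divM u k pos (eq_rect _ (fun la => nneg (- la)) neg _ (weylME _ _ _)).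
      have [c hc [t' ht']] := integral_simple_pole u w k hz'; exists c => //.
      exists (t' * m'); apply: etrans _ (esym (rmorphM incl _ _)).
      apply: etrans _ (congr1 (fun p => p * incl m') ht').
      apply: etrans (congr1 (fun p => incl c * (cf z' w * p)) (rmorphM incl _ _)) _.
      exact: mulr_perm6.
    (* The inverse of [w] keeps the root positive. Strong exchange, applied to [s_al w], shows that
       this element is longer than [w], hence outside the support. *)
    have [|c hc [t' ht']] := integral_regular (u := u) (w := w) (k := k) hz'.
      have rV : (refl u k)^-1%g = refl u k.
        by rewrite /refl !invgM invgK simple_weylV mulgA.
      have rr : (refl u k * (refl u k * w))%g = w.
        by rewrite mulgA -[X in (X * _ * _)%g]rV mulVg mul1g.
      apply: len_gt; rewrite -wN -[in X in (X < _)%N]rr.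
      apply: strong_exchange pos _.
      have re : refl u k (u (al k)) = - u (al k).
        by rewrite /refl !weylME weylKV simple_weyl_root linearN.
      rewrite invgM rV weylME re linearN opprK.
      change (nneg (w^-1%g (u (al k)))); rewrite -weylME; exact: neg.
    exists c; first exact: hc.
    exists (t' * M); apply: etrans (mulrA _ _ _) _.
    apply: etrans (congr1 (fun p => p * incl M) ht') _; exact: esym (rmorphM incl _ _).
  pose z1 : tw := z' - tw_mul (tw_mono (incl c) 1%g) Y.
  have z1E v : cf z1 v = cf z' v - incl c * cf Y v.
    apply: etrans (raddfB (monalg.mcoeff v) _ _) _.
    have e := mcoeff_mono_mul (incl c) 1%g Y v.
    rewrite invg1 mul1g in e; apply: (congr1 (fun p => cf z' v - p)).
    apply: etrans e _; exact: (congr1 (fun p => incl c * p) (qact1 _)).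
  have hcY : affine_demazure F L (tw_mul (tw_mono (incl c) 1%g) Y).
    move=> B hB hS hX; have [_ _ BM _] := hB.
    by apply: BM; [exact: hS|exact: hY].
  have hz1 : integral z1.
    have [_ hB _ _] := integral_subalgebra.
    exact: (hB _ _ hz' (affine_demazure_integral hcY)).
  have D1 : affine_demazure F L z1.
    apply: IHl => [v vl||v v0]; [by apply: hl; rewrite inE vl orbT|exact: hz1|].
    have [vw|vw] := EM (v = w).
      exfalso; apply: v0; rewrite z1E vw.
      apply: etrans (congr1 (fun p => cf z' w - p * cf Y w) (esym ce)) _.
      apply: etrans (congr1 (fun p => cf z' w - p) (esym (mulrA _ _ _))) _.
      apply: etrans (congr1 (fun p => cf z' w - cf z' w * p) MY) _.
      apply: etrans (congr1 (fun p => cf z' w - p) (mulr1 _)) _; exact: subrr.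
    have [vN|vN] := ltnP (len v) N; [by left|right].
    have Yv : cf Y v = 0.
      apply: contrapT => /suppY [/vw []|]; rewrite tN wN => lt.
      by rewrite leqNgt lt in vN.
    have v1 : cf z' v <> 0.
      move=> zv; apply: v0; rewrite z1E zv Yv.
      apply: etrans (congr1 (fun p => 0 - p) (mulr0 _)) _; exact: subrr.
    have [|] := supp v v1; first by rewrite ltnNge vN.
    rewrite inE => /orP [/eqP /vw []|vl]; exact: vl.
  have -> : z' = z1 - (0 - tw_mul (tw_mono (incl c) 1%g) Y).
    exact: subr_sub0K.
  move=> B hB hS hX; have [B1 BB _ _] := hB.
  have B0 : B 0 by rewrite -(subrr (tw_delta F L 1%g)); exact: BB.
  exact: (BB _ _ (D1 B hB hS hX) (BB _ _ B0 (hcY B hB hS hX))).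
apply: (H [seq v <- monalg.msupp z' | len v == N] _ z' hz') => [v|v v0].
  by rewrite mem_filter => /andP [/eqP].
have vz : v \in monalg.msupp z' by rewrite -monalg.mcoeff_neq0; apply/eqP.
have := supp v v0; rewrite ltnS leq_eqVlt => /orP [vN|vN]; [right|by left].
rewrite mem_filter; apply/andP; exact: conj vN vz.
Qed.

End AffineDemazure.

Theorem theorem4p1 (R : idomainType) (char0 : [pchar R] =i pred0) (F : fgl R)
    (K : realType) (n : nat) (A : gcm n) (D : root_datum K A)
    (L : demazure_lattice D) :
  affine_demazure F L =
  [set z : twisted F L |
    forall s : fga F L, exists t : fga F L,
      tw_act z (loc_incl s) = loc_incl t].
Proof.
apply/funext => z; apply/propext; split.
  exact: (affine_demazure_integral char0).
exact: (integral_affine_demazure char0).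
Qed.
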